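(* There exist constants $C>0$ and $\epsilon_0>0$ such that for all $0<\epsilon<\epsilon_0$ and all $u_0\in L^2(\mathbb{T}^2)$, $$\|u_0\|_{L^2(\mathbb{T}^2)}^2\leq C_{\Omega_\epsilon}\int_0^{\frac{1}{2\pi}}\|e^{it\Delta}u_0\|_{L^2(\Omega_\epsilon)}^2\,dt,\qquad C_{\Omega_\epsilon}=\exp\left(\exp\left(\frac{C\log(\epsilon^{-1})}{\log\log(\epsilon^{-1})}\right)\right).$$
   Context: $\mathbb{T}^2=\mathbb{R}^2/\mathbb{Z}^2$ is the standard flat torus with Laplacian $\Delta=\partial_{x_1}^2+\partial_{x_2}^2$, $e^{it\Delta}$ is the free Schr\''odinger propagator on $L^2(\mathbb{T}^2)$, and $\Omega_\epsilon=B(0,\epsilon)\subset\mathbb{T}^2$ is the ball of radius $\epsilon$ centered at $0$. The constant $C$ is independent of $\epsilon$ and $u_0$. *)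

(* Defs.v *)
From mathcomp Require Import all_boot all_order all_algebra.
From mathcomp Require Import complex ring.
From mathcomp Require Import all_classical all_reals all_analysis.

Set Implicit Arguments.
Unset Strict Implicit.
Unset Printing Implicit Defensive.

Import Order.TTheory GRing.Theory Num.Theory.
Import numFieldNormedType.Exports.

Local Open Scope classical_set_scope.
Local Open Scope ring_scope.
Local Open Scope complex_scope.

Section Torus.
Variable R : realType.

Implicit Types (u v : R * R -> R[i]) (x : R * R) (k : int * int).

(* Functions on R^2/Z^2 are Z^2-periodic functions on R^2, integrated over the
   fundamental domain [0,1)^2. *)
Definition torus_periodic u : Prop :=
  forall x k, u (x.1 + k.1%:~R, x.2 + k.2%:~R) = u x.

Definition torus_cell : set (R * R) := `[0, 1[ `*` `[0, 1[.

Local Notation leb2 := (@lebesgue_measure R \x @lebesgue_measure R)%E.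

(* The norm that the library puts on R * R is the maximum norm, hence the
   explicit Euclidean distance. *)
Definition torus_ball (e : R) : set (R * R) :=
  [set x | exists k,
     Num.sqrt ((x.1 - k.1%:~R) ^+ 2 + (x.2 - k.2%:~R) ^+ 2) < e].

Definition sqr_normc (z : R[i]) : R := complex.Re z ^+ 2 + complex.Im z ^+ 2.

(* the square of the norm of u in L^2(A), for A a subset of the torus *)
Definition L2norm_sqr (A : set (R * R)) u : \bar R :=
  (\int[leb2]_(x in torus_cell `&` A) (sqr_normc (u x))%:E)%E.

(* u represents an element of L^2(R^2/Z^2) *)
Definition in_L2 u : Prop :=
  [/\ torus_periodic u,
      measurable_fun setT (fun x => complex.Re (u x)),
      measurable_fun setT (fun x => complex.Im (u x)) &
      (L2norm_sqr setT u < +oo)%E].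

Definition expi (a : R) : R[i] := cos a +i* sin a.

Definition torus_char k x : R[i] :=
  expi (2 * pi * (k.1%:~R * x.1 + k.2%:~R * x.2)).

Definition torus_integral u : R[i] :=
  (\int[leb2]_(x in torus_cell) complex.Re (u x))%R +i*
  (\int[leb2]_(x in torus_cell) complex.Im (u x))%R.

Definition fourier_coef u k : R[i] :=
  torus_integral (fun x => u x * (torus_char k x)^*).

Definition laplacian (f : R * R -> R) x : R :=
  'D_(1, 0) ('D_(1, 0) f) x + 'D_(0, 1) ('D_(0, 1) f) x.

Definition laplace_eigenvalue k : R :=
  - (4 * pi ^+ 2 * (k.1%:~R ^+ 2 + k.2%:~R ^+ 2)).

Let phase_derive (g dg : R -> R) (c a b : R) (x w : R * R) :
  (forall y : R, is_derive y 1 g (dg y)) ->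
  'D_w (fun y : R * R => g (c * (a * y.1 + b * y.2))) x =
  c * (a * w.1 + b * w.2) * dg (c * (a * x.1 + b * x.2)).
Proof.
move=> gdg; set lw := c * _; set lx := c * _.
pose phi (h : R) := g (h * lw + lx).
have -> : 'D_w (fun y : R * R => g (c * (a * y.1 + b * y.2))) x = 'D_1 phi (0 : R).
  rewrite /derive; set p := (fun h : R => _); set q := (fun h : R => _).
  suff -> : p = q by [].
  apply/funext => h; rewrite /p /q /phi /lw /lx /= /GRing.scale /=.
  rewrite mul0r add0r mulr1 addr0.
  by congr (_ * (g _ - _)); ring.
have line : is_derive (0 : R) 1 (fun h : R => h * lw + lx) lw.
  have -> : (fun h : R => h * lw + lx) = lw *: id + cst lx :> (R -> R).
    by apply/funext => h /=; rewrite mulrC.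
  have := is_deriveD (is_deriveZ lw (is_derive_id (0 : R) 1))
    (is_derive_cst lx (0 : R) 1).
  by rewrite addr0 /GRing.scale /= mulr1.
have gl : is_derive (0 * lw + lx) 1 g (dg lx) by rewrite mul0r add0r.
have := @is_derive1_comp R g (fun h => h * lw + lx) 0 _ _ gl line.
by move=> /@derive_val ->; rewrite mulrC.
Qed.

Let phase_laplacian (g dg ddg : R -> R) k x :
  (forall y : R, is_derive y 1 g (dg y)) ->
  (forall y : R, is_derive y 1 dg (ddg y)) ->
  laplacian (fun y => g (2 * pi * (k.1%:~R * y.1 + k.2%:~R * y.2))) x =
  - laplace_eigenvalue k * ddg (2 * pi * (k.1%:~R * x.1 + k.2%:~R * x.2)).
Proof.
move=> gdg dgddg; rewrite /laplacian.
have D1 w : 'D_w (fun y : R * R => g (2 * pi * (k.1%:~R * y.1 + k.2%:~R * y.2))) =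
    fun y => (fun s => 2 * pi * (k.1%:~R * w.1 + k.2%:~R * w.2) * dg s)
      (2 * pi * (k.1%:~R * y.1 + k.2%:~R * y.2)).
  by apply/funext => y; exact: phase_derive.
have dgZ (c y : R) : is_derive y 1 (fun s => c * dg s) (c * ddg y).
  exact: (is_deriveZ c (dgddg y)).
have D2 (c : R) w :
    'D_w (fun y : R * R => c * dg (2 * pi * (k.1%:~R * y.1 + k.2%:~R * y.2))) x =
    2 * pi * (k.1%:~R * w.1 + k.2%:~R * w.2) *
    (c * ddg (2 * pi * (k.1%:~R * x.1 + k.2%:~R * x.2))).
  exact: (phase_derive _ _ _ _ _ (dgZ c)).
rewrite !D1 !D2.
by rewrite /laplace_eigenvalue /=; ring.
Qed.

Lemma laplacian_char_re k x :
  laplacian (fun y => complex.Re (torus_char k y)) x =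
  laplace_eigenvalue k * complex.Re (torus_char k x).
Proof.
rewrite (@phase_laplacian cos (fun y => - sin y) (fun y => - cos y)).
by rewrite mulrNN.
Qed.

Lemma laplacian_char_im k x :
  laplacian (fun y => complex.Im (torus_char k y)) x =
  laplace_eigenvalue k * complex.Im (torus_char k x).
Proof.
rewrite (@phase_laplacian sin cos (fun y => - sin y)).
by rewrite mulrNN.
Qed.

(* exp(i t Laplacian) is the Fourier multiplier obtained by functional calculus
   from laplacian_char_re and laplacian_char_im above.  A representative of the
   image is selected by choice: by Riesz-Fischer one exists when u is in L^2,
   and it is unique up to a null set. *)
Definition schrodinger (t : R) u : R * R -> R[i] :=
  xget (fun=> 0) [set v | in_L2 v /\
    forall k, fourier_coef v k = expi (t * laplace_eigenvalue k) * fourier_coef u k].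

Definition obs_const (C e : R) : R :=
  expR (expR (C * ln (e^-1) / ln (ln (e^-1)))).

End Torus.

(* Main.v *)
(* [1/(2 pi)] is a period of the free evolution, so the time integral is
   diagonal in the circles [|k|^2 = n] and it suffices to bound, uniformly in [n],
   the [l^2] norm of the coefficients of a trigonometric polynomial supported on
   one circle by its energy on the box [[0, eps/2[^2], which lies in the ball.
   The threshold between low and high [n] is a power of [1/eps].
   - Low [n]: the divisor bound limits the number [N] of lattice points to
     [exp (O (log (1/eps) / log log (1/eps)))], and removing frequencies one at a
     time by differencing, as in Turan's lemma, costs a factor exponential in
     [N log (1/eps)].
   - High [n]: a lattice triangle inscribed in a large circle is long, so each
     frequency has at most one close neighbour, and the Gram matrix of the
     characters on the box is diagonally dominant.
   Parseval and Riesz-Fischer come from the uniqueness of Fourier coefficients,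
   which is obtained by showing that every measurable set is a bounded pointwise
   limit, built in steps, of functions that preserve vanishing moments. *)

Require Import Defs.
From mathcomp Require Import all_boot all_order all_algebra.
From mathcomp Require Import complex.
From mathcomp Require Import all_classical all_reals all_analysis.
From mathcomp Require Import measurable_realfun.
From mathcomp Require Import zify ring lra.

Import Order.TTheory GRing.Theory Num.Theory.
Import numFieldNormedType.Exports.
Set Implicit Arguments.
Unset Strict Implicit.
Unset Printing Implicit Defensive.
Local Open Scope classical_set_scope.
Local Open Scope ring_scope.

(** * Lattice points on circles *)

(** The threshold is dictated by diagonal dominance. A pair of near frequencies leaves only a gap of
    order [r^4] in the Gram matrix of a box of side [r], and the far entries, at most [r / g] each,
    must fit into half of it. The triangle argument allows a separation [g] of order [n^(1/6)],
    while the number of points on the circle grows more slowly than any power of [n]; so a power of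
    [1/eps] is enough. Above it the loss is polynomial in [1/eps], and the double exponential comes
    from the low circles alone. A box replaces the disc because the integral of a character over it
    factors into two one-dimensional integrals. The evolved state is a representative selected by
    choice, so the energy observed at time [t] is not known to be measurable in [t]. The time
    integral is therefore only bounded from below, by integrals of explicit minorants coming from
    finite Fourier sums. The truncation error is the defect in Bessel's inequality, which the flow
    does not increase since it keeps the moduli of the coefficients. *)

Lemma size_fibers (T U : eqType) (f : T -> U) (c : nat) (s : seq T) (t : seq U) :
  {in s, forall x, f x \in t} ->
  {in t, forall y, (size [seq x <- s | f x == y] <= c)%N} ->
  (size s <= c * size t)%N.
Proof.
elim: t s => [|y t IH] s st fib.
  by case: s st {fib} => [|x s] // /(_ x (mem_head _ _)); rewrite in_nil.
rewrite -(count_predC (fun x => f x == y)) -!size_filter mulnS leq_add//.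
  exact: fib (mem_head _ _).
apply: IH => [x|z zt].
  rewrite mem_filter /= => /andP[fxy /st]; by rewrite inE (negbTE fxy).
rewrite -filter_predI (leq_trans _ (fib z _)) ?inE ?zt ?orbT//.
rewrite !size_filter; apply: sub_count => x /= /andP[//].
Qed.

(** * The divisor bound *)

Lemma size_divisors_pfactor (p k m : nat) : prime p -> coprime p m -> (0 < m)%N ->
  (size (divisors (m * p ^ k)) <= k.+1 * size (divisors m))%N.
Proof.
move=> pp pm m0; have p0 := prime_gt0 pp.
have n0 : (0 < m * p ^ k)%N by rewrite muln_gt0 m0 expn_gt0 p0.
have -> : (k.+1 * size (divisors m) =
    size [seq (p ^ i * e)%N | i <- iota 0 k.+1, e <- divisors m])%N.
  by rewrite size_allpairs size_iota.
apply: uniq_leq_size; first exact: divisors_uniq.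
move=> d; rewrite -dvdn_divisors// => dn.
have d0 : (0 < d)%N := dvdn_gt0 n0 dn.
have [q pq dE] := pfactor_coprime pp d0.
move: dn; rewrite dE => dn.
apply/allpairsP; exists (logn p d, q); split.
- rewrite [_.1]/= mem_iota add0n ltnS; set j := logn p d in dn *.
  have : (p ^ j %| p ^ k)%N.
    rewrite -(@Gauss_dvdr _ m); last by rewrite coprimeXl.
    exact: dvdn_trans (dvdn_mull _ (dvdnn _)) dn.
  by rewrite dvdn_Pexp2l// prime_gt1.
- rewrite [_.2]/= -dvdn_divisors// -(@Gauss_dvdl _ _ (p ^ k)); last first.
    by rewrite coprimeXr// coprime_sym.
  exact: dvdn_trans (dvdn_mulr _ (dvdnn _)) dn.
- by rewrite mulnC.
Qed.

(** Raise [k.+1 <= m * 2 ^ (k %/ m)] to the power [m]. A small prime [p] thus pays the fixed price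
    [m ^ m], and the rest [2 ^ k] is absorbed by [p ^ k]. *)
Lemma expn_succ_le (k m : nat) : (0 < m)%N -> (k.+1 ^ m <= m ^ m * 2 ^ k)%N.
Proof.
move=> m0; have h : (k.+1 <= m * 2 ^ (k %/ m))%N.
  apply: (@leq_trans (m * (k %/ m).+1)).
    by rewrite mulnC; exact: ltn_ceil.
  by rewrite leq_mul2l ltn_expl ?orbT.
apply: (@leq_trans ((m * 2 ^ (k %/ m)) ^ m)); first by rewrite leq_exp2r.
by rewrite expnMn -expnM leq_mul2l leq_exp2l// leq_trunc_div orbT.
Qed.

(* In [d(n)^m <= prod (a_p + 1)^m] a prime [p >= 2^m] contributes at most
   [p^a_p], and a smaller one at most [m^m p^a_p]. *)
Lemma size_divisors_exp (m n : nat) : (0 < m)%N -> (0 < n)%N ->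
  (size (divisors n) ^ m <=
   n * (m ^ m) ^ count (fun p => p < 2 ^ m) (primes n))%N.
Proof.
move=> m0; have [N] := ubnP n; elim: N n => // N IH n nN n0.
have [n1|n1] := leqP n 1.
  have -> : n = 1%N by lia.
  by rewrite (_ : divisors 1 = [:: 1%N])//= exp1n muln_gt0.
set p := pdiv n; have pp : prime p by rewrite pdiv_prime.
have [q pq nE] := pfactor_coprime pp n0.
set k := logn p n in nE.
have k0 : (0 < k)%N by rewrite logn_gt0 mem_primes pp n0 pdiv_dvd.
have q0 : (0 < q)%N by move: n0; rewrite nE muln_gt0 => /andP[].
have qN : (q < N)%N.
  rewrite (leq_trans _ (_ : n <= N)%N)// nE -[q in (q < _)%N]muln1 ltn_pmul2l//.
  by rewrite -(expn0 p) ltn_exp2l// prime_gt1.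
have {}IH := IH q qN q0.
have primesE : perm_eq (primes n) (p :: primes q).
  apply: uniq_perm; first exact: primes_uniq.
    rewrite /= primes_uniq andbT mem_primes pp q0 /=.
    by rewrite -prime_coprime.
  move=> x; rewrite nE primesM ?expn_gt0 ?(prime_gt0 pp)// primesX// (primes_prime pp).
  by rewrite !inE orbC.
rewrite (permP primesE) /= expnD [in X in (_ <= X * _)%N]nE.
apply: (@leq_trans ((k.+1 * size (divisors q)) ^ m)).
  by rewrite leq_exp2r// [in X in divisors X]nE size_divisors_pfactor.
rewrite expnMn.
suff h : (k.+1 ^ m <= p ^ k * (m ^ m) ^ (p < 2 ^ m))%N.
  apply: (leq_trans (leq_mul h IH)); apply: eq_leq.
  by rewrite -!mulnA [RHS]mulnCA; congr muln; rewrite mulnCA.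
have [pm|pm] := ltnP p (2 ^ m).
  apply: (leq_trans (expn_succ_le k m0)); rewrite mulnC leq_mul//.
  by rewrite leq_exp2r ?prime_gt1.
rewrite expn0 muln1; apply: (@leq_trans ((2 ^ k) ^ m)).
  by rewrite leq_exp2r// ltn_expl.
by rewrite -expnM mulnC expnM leq_exp2r.
Qed.

(** The primes below [2 ^ m] are counted crudely by [2 ^ m]. Taking [m]-th roots with [m] a small
    multiple of [log log n] gives the classical bound [exp (O (log n / log log n))]. *)
Lemma size_divisors_bound (m n : nat) : (0 < m)%N -> (0 < n)%N ->
  (size (divisors n) ^ m <= n * m ^ (m * 2 ^ m))%N.
Proof.
move=> m0 n0; apply: (leq_trans (size_divisors_exp m0 n0)).
rewrite leq_mul2l expnM leq_pexp2l ?orbT// ?expn_gt0 ?m0//.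
rewrite -size_filter -[leqRHS](size_iota 0).
apply: uniq_leq_size; first by rewrite filter_uniq// primes_uniq.
by move=> x; rewrite mem_filter mem_iota => /andP[].
Qed.

(** * Counting lattice points on a circle *)

(** For Gaussian integers, [lattice_dot k l] and [lattice_det k l] are the real and imaginary parts
    of [l] times the conjugate of [k], and [lattice_lagrange] is the multiplicativity of the norm.
    Integer gcds below stand in for factorization in that ring. *)
Definition lattice_norm (k : int * int) : int := k.1 ^+ 2 + k.2 ^+ 2.
Definition lattice_det (k l : int * int) : int := k.1 * l.2 - k.2 * l.1.
Definition lattice_dot (k l : int * int) : int := k.1 * l.1 + k.2 * l.2.

Lemma lattice_lagrange k l :
  lattice_det k l ^+ 2 + lattice_dot k l ^+ 2 = lattice_norm k * lattice_norm l.
Proof. by rewrite /lattice_det /lattice_dot /lattice_norm; ring. Qed.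

Lemma primitive_coprime_norm (n : int) (k : int * int) : coprimez k.1 k.2 ->
  lattice_norm k = n -> coprimez k.1 n /\ coprimez k.2 n.
Proof.
rewrite /lattice_norm => ck <-; rewrite !expr2; split.
- by rewrite /coprimez gcdzMDl -/(coprimez _ _) coprimezMr ck.
- by rewrite /coprimez addrC gcdzMDl -/(coprimez _ _) coprimezMr coprimez_sym ck.
Qed.

(* Modulo a divisor of [n] the points [k0] and [k] are proportional either as they
   stand or after conjugation; the gcd records the splitting of [n]. *)
Lemma primitive_same_gcd (n : int) (k0 k l : int * int) :
  coprimez k0.1 k0.2 -> coprimez k.1 k.2 ->
  lattice_norm k0 = n -> lattice_norm k = n -> lattice_norm l = n -> 0 < n ->
  gcdz n (lattice_det k0 k) = gcdz n (lattice_det k0 l) ->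
  (n %| 2 * lattice_det k l)%Z.
Proof.
move=> c0 ck n0 nk nl npos; set d := gcdz n _ => dl.
have dn : (d %| n)%Z by exact: dvdz_gcdl.
have /dvdzP[e nE] := dn.
have d0 : d != 0 by apply/eqP => d0; move: npos; rewrite nE d0 mulr0 ltxx.
have e0 : e != 0 by apply/eqP => e0; move: npos; rewrite nE e0 mul0r ltxx.
(* Up to sign, the determinant of [k0] and the conjugate of [j]. Its product with [lattice_det k0 j]
   is divisible by [n], so what [d] misses of [n] falls on [Y j]. *)
pose Y (j : int * int) := k0.1 * j.2 + k0.2 * j.1.
have eY j : lattice_norm j = n -> d = gcdz n (lattice_det k0 j) -> (e %| Y j)%Z.
  move=> nj dj.
  have h : (n %| lattice_det k0 j * Y j)%Z.
    apply/dvdzP; exists (j.2 ^+ 2 - k0.2 ^+ 2).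
    have k0E : k0.1 ^+ 2 = n - k0.2 ^+ 2 by rewrite -n0 addrK.
    have jE : j.1 ^+ 2 = n - j.2 ^+ 2 by rewrite -nj addrK.
    transitivity (k0.1 ^+ 2 * j.2 ^+ 2 - k0.2 ^+ 2 * j.1 ^+ 2).
      by rewrite /lattice_det /Y; ring.
    by rewrite k0E jE; ring.
  have [q qE] : exists q, lattice_det k0 j = q * d.
    by apply/dvdzP; rewrite dj; exact: dvdz_gcdr.
  have cq : coprimez e q.
    have : gcdz (e * d) (q * d) = `|d|%N :> int.
      by rewrite -nE -qE -dj; rewrite gez0_abs// /d /gcdz.
    rewrite -mulz_gcdl -[X in _ = X]mul1r => /mulIf; rewrite /coprimez => ->//.
  rewrite -(Gauss_dvdzr _ cq) -(dvdz_mul2r d0) -nE.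
  by rewrite mulrAC -qE.
have [a0n b0n] := primitive_coprime_norm c0 n0.
have [akn bkn] := primitive_coprime_norm ck nk.
have ek := eY k nk erefl; have el := eY l nl dl.
have dk : (d %| lattice_det k0 k)%Z by exact: dvdz_gcdr.
have {}dl : (d %| lattice_det k0 l)%Z by rewrite dl; exact: dvdz_gcdr.
have en : (e %| n)%Z by rewrite nE dvdz_mulr.
have ddet : (d %| lattice_det k l)%Z.
  rewrite -(@Gauss_dvdzr _ k0.1); last by apply: (coprime_dvdl dn); rewrite -coprimezE coprimez_sym.
  have -> : k0.1 * lattice_det k l =
      k.1 * lattice_det k0 l - l.1 * lattice_det k0 k.
    by rewrite /lattice_det; ring.
  by rewrite rpredB// dvdz_mull.
have edet : (e %| lattice_det k l)%Z.
  rewrite -(@Gauss_dvdzr _ k0.1); last by apply: (coprime_dvdl en); rewrite -coprimezE coprimez_sym.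
  have -> : k0.1 * lattice_det k l = k.1 * Y l - l.1 * Y k.
    by rewrite /lattice_det /Y; ring.
  by rewrite rpredB// dvdz_mull.
(* [d] and [e] may share a factor, but it divides the sum of the two determinants, [2 * k0.1 * k.2],
   and is prime to both coordinates. This is the origin of the factor 2 in the conclusion. *)
have g2 : (gcdz d e %| 2)%Z.
  have gd := dvdz_gcdl d e; have ge := dvdz_gcdr d e.
  have gn := dvdz_trans gd dn.
  rewrite -(@Gauss_dvdzr _ k0.1); last by apply: (coprime_dvdl gn); rewrite -coprimezE coprimez_sym.
  rewrite -(@Gauss_dvdzl _ _ k.2); last by apply: (coprime_dvdl gn); rewrite -coprimezE coprimez_sym.
  have -> : k0.1 * 2 * k.2 = lattice_det k0 k + Y k.
    by rewrite /lattice_det /Y; ring.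
  by rewrite rpredD// (dvdz_trans _ dk, dvdz_trans _ ek).
have [u [v uv]] := Bezoutz d e.
have /dvdzP[w wE] := g2.
have {}wE : 2%R = w * gcdz d e by rewrite -wE.
have -> : 2 * lattice_det k l = w * (u * (d * lattice_det k l) + v * (e * lattice_det k l)).
  by rewrite wE -uv; ring.
rewrite dvdz_mull// rpredD// dvdz_mull// nE; last by rewrite dvdz_mul.
by rewrite mulrC dvdz_mul.
Qed.

(** The determinant and the dot product with [k] determine a point, and by Lagrange's identity the
    determinant fixes the dot product up to sign. *)
Lemma lattice_inj (k l l' : int * int) : 0 < lattice_norm k ->
  lattice_norm l = lattice_norm l' -> lattice_det k l = lattice_det k l' ->
  (0 <= lattice_dot k l) = (0 <= lattice_dot k l') -> l = l'.
Proof.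
move=> k0 nl dl sl.
have : lattice_dot k l ^+ 2 = lattice_dot k l' ^+ 2.
  have := lattice_lagrange k l; have := lattice_lagrange k l'.
  by rewrite nl dl => <- /addrI.
move/eqP; rewrite eqf_sqr => /orP dotE.
have {dotE}dotE : lattice_dot k l = lattice_dot k l'.
  case: dotE => /eqP// E; move: sl; rewrite E oppr_ge0.
  by case: ltgtP => // ->; rewrite oppr0.
have E1 (j : int * int) : lattice_norm k * j.1 =
    k.1 * lattice_dot k j - k.2 * lattice_det k j.
  by rewrite /lattice_norm /lattice_dot /lattice_det; ring.
have E2 (j : int * int) : lattice_norm k * j.2 =
    k.2 * lattice_dot k j + k.1 * lattice_det k j.
  by rewrite /lattice_norm /lattice_dot /lattice_det; ring.
have k0' : lattice_norm k != 0 by rewrite gt_eqF.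
rewrite [l]surjective_pairing [l']surjective_pairing; congr (_, _).
- by apply: (mulfI k0'); rewrite !E1 dl dotE.
- by apply: (mulfI k0'); rewrite !E2 dl dotE.
Qed.

(** By Lagrange's identity [2 * lattice_det k l] lies between [- 2 n] and [2 n], so it is one of
    five multiples of [n]; the sign of the dot product doubles the count. *)
Lemma size_primitive_same_gcd (n : int) (k : int * int) (s : seq (int * int)) :
  0 < n -> lattice_norm k = n -> uniq s ->
  {in s, forall l, lattice_norm l = n /\ (n %| 2 * lattice_det k l)%Z} ->
  (size s <= 10)%N.
Proof.
move=> n0 nk us sP.
pose f (l : int * int) := (2 * lattice_det k l, 0 <= lattice_dot k l).
rewrite -(size_map f).
pose t := [seq (q * n, b) | q <- [:: -2; -1; 0; 1; 2] : seq int, b <- [:: true; false]].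
rewrite (_ : 10%N = size t)//; apply: uniq_leq_size.
  rewrite map_inj_in_uniq// => l l' /sP[nl _] /sP[nl' _] [dE sE].
  apply: (@lattice_inj k); rewrite ?nk ?nl ?nl'//.
  by move: dE; lia.
move=> y /mapP[l ls ->]; have [nl /dvdzP[q qE]] := sP _ ls.
apply/allpairsP; exists (q, 0 <= lattice_dot k l); split => //=; last first.
  by rewrite /f -qE.
  by rewrite !inE; case: (0 <= _).
have h : (2 * lattice_det k l) ^+ 2 <= 4 * n ^+ 2.
  have := lattice_lagrange k l; rewrite nk nl => L.
  have -> : 4 * n ^+ 2 = (2 * lattice_det k l) ^+ 2 + (2 * lattice_dot k l) ^+ 2.
    by rewrite !expr2 -L; ring.
  by rewrite lerDl sqr_ge0.
have {h} : q ^+ 2 <= 4.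
  by move: h; rewrite qE exprMn ler_pM2r// exprn_gt0.
by rewrite !inE; nia.
Qed.

(** With a base point [k0] fixed, the points are sorted by the divisor [gcd (n, lattice_det k0 k)]
    of [n], and each class has at most ten members. *)
Lemma size_primitive_circle (n : int) (s : seq (int * int)) :
  0 < n -> uniq s ->
  {in s, forall k, lattice_norm k = n /\ coprimez k.1 k.2} ->
  (size s <= 10 * size (divisors `|n|))%N.
Proof.
move=> n0; case: s => // k0 s us sP; set s' := k0 :: s in us sP *.
have [nk0 ck0] := sP k0 (mem_head _ _).
apply: (@size_fibers _ _ (fun k => gcdn `|n| `|lattice_det k0 k|)).
  move=> k ks; rewrite -dvdn_divisors ?dvdn_gcdl//; lia.
move=> d _; set r := [seq x <- s' | _].
have rP l : l \in r -> gcdz n (lattice_det k0 l) = d /\ l \in s'.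
  by rewrite mem_filter => /andP[/eqP <-].
have ur : uniq r by rewrite filter_uniq.
case: r rP ur => // k r rP ur.
have [dk ks] := rP k (mem_head _ _); have [nk ck] := sP _ ks.
apply: (@size_primitive_same_gcd n k) => // l lr.
have [dl ls] := rP _ lr; have [nl cl] := sP _ ls.
by split=> //; apply: (@primitive_same_gcd n k0 k l); rewrite ?dk ?dl.
Qed.

Lemma size_divisors_dvd (d n : nat) : (0 < n)%N -> (d %| n)%N ->
  (size (divisors d) <= size (divisors n))%N.
Proof.
move=> n0 dn; have d0 := dvdn_gt0 n0 dn; apply: uniq_leq_size.
  exact: divisors_uniq.
by move=> e; rewrite -!dvdn_divisors// => /dvdn_trans; apply.
Qed.

(** A point whose coordinates have gcd [g] is [g] times a primitive point on the circle of
    [n / g^2]. Since [g] divides [n], the choice of [g] costs the second factor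
    [size (divisors n)]. *)
Lemma size_circle (n : int) (s : seq (int * int)) :
  0 < n -> uniq s -> {in s, forall k, lattice_norm k = n} ->
  (size s <= 10 * size (divisors `|n|) ^ 2)%N.
Proof.
move=> n0 us sP; rewrite expnS expn1 mulnA.
have an0 : (0 < `|n|)%N by lia.
have gdvd k : k \in s -> ((gcdn `|k.1| `|k.2|)%:Z ^+ 2 %| n)%Z.
  move=> ks; rewrite -(sP _ ks) /lattice_norm rpredD//.
    by rewrite dvdz_exp2r//; exact: dvdz_gcdl.
  by rewrite dvdz_exp2r//; exact: dvdz_gcdr.
apply: (@size_fibers _ _ (fun k => gcdn `|k.1| `|k.2|)).
  move=> k ks; rewrite -dvdn_divisors//.
  have := gdvd k ks; rewrite dvdzE; apply: dvdn_trans.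
  by rewrite expr2 abszM dvdn_mulr.
move=> g _; set r := [seq x <- s | _].
have rP l : l \in r -> gcdn `|l.1| `|l.2| = g /\ l \in s.
  by rewrite mem_filter => /andP[/eqP <-].
have ur : uniq r by rewrite filter_uniq.
have [->//|r0] := eqVneq r [::].
have [k kr] : exists k, k \in r by case: (r) r0 => // k ? _; exists k; rewrite mem_head.
have [gk ks] := rP _ kr; have gn := gdvd _ ks; rewrite gk in gn.
have g0 : (g : int) != 0.
  apply/eqP => g0; move: gn; rewrite g0 expr0n dvd0z => /eqP nE.
  by rewrite nE ltxx in n0.
have /dvdzP[m mE] := gn.
have m0 : 0 < m by move: n0; rewrite mE pmulr_lgt0// exprn_even_gt0.
pose f (l : int * int) := ((l.1 %/ g)%Z, (l.2 %/ g)%Z).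
have fE l : l \in r -> l.1 = (f l).1 * g /\ l.2 = (f l).2 * g.
  move=> /rP[gl _]; rewrite /f /= !divzK//.
    by rewrite -gl; exact: dvdz_gcdr.
  by rewrite -gl; exact: dvdz_gcdl.
rewrite -(size_map f); apply: leq_trans (_ : _ <= 10 * size (divisors `|m|))%N _.
  apply: size_primitive_circle => //.
    rewrite map_inj_in_uniq// => l l' /fE[l1 l2] /fE[l1' l2'] E.
    rewrite [l]surjective_pairing [l']surjective_pairing.
    by rewrite l1 l2 l1' l2' E.
  move=> y /mapP[l lr ->]; have [l1 l2] := fE _ lr; have [gl ls] := rP _ lr.
  have g2 : (g : int) ^+ 2 != 0 by rewrite expf_neq0.
  split.
    apply: (mulIf g2); rewrite -mE -(sP _ ls) /lattice_norm l1 l2; ring.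
  have : gcdz ((f l).1 * g) ((f l).2 * g) = g :> int.
    by rewrite -l1 -l2 -[in RHS]gl.
  by rewrite -mulz_gcdl -[X in _ = X]mul1r => /mulIf; rewrite /coprimez => ->.
rewrite leq_mul2l size_divisors_dvd//.
by rewrite mE abszM dvdn_mulr.
Qed.

(** * Lattice triangles inscribed in a circle *)

(** The squared circumradius formula: the triangle with vertices [k], [k + u], [k + v] has area
    [|lattice_det u v| / 2] and circumradius [sqrt n]. *)
Lemma circle_triangle (k u v : int * int) (n : int) :
  lattice_norm k = n -> lattice_norm (k.1 + u.1, k.2 + u.2) = n ->
  lattice_norm (k.1 + v.1, k.2 + v.2) = n ->
  4 * n * lattice_det u v ^+ 2 =
  lattice_norm u * lattice_norm v * lattice_norm (u.1 - v.1, u.2 - v.2).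
Proof.
rewrite /lattice_norm /lattice_det /= => nk nu nv.
have Eu : 2 * (k.1 * u.1 + k.2 * u.2) = - (u.1 ^+ 2 + u.2 ^+ 2).
  by apply/eqP; rewrite -subr_eq0; apply/eqP; rewrite -(subrr n) -{1}nu -nk; ring.
have Ev : 2 * (k.1 * v.1 + k.2 * v.2) = - (v.1 ^+ 2 + v.2 ^+ 2).
  by apply/eqP; rewrite -subr_eq0; apply/eqP; rewrite -(subrr n) -{1}nv -nk; ring.
(* The vector [(k.u) v - (k.v) u] is [k] turned by a right angle and multiplied by the determinant,
   up to sign; on the circle [2 k.u = - |u|^2] and [2 k.v = - |v|^2]. *)
transitivity ((2 * (k.1 * u.1 + k.2 * u.2) * v.1 - 2 * (k.1 * v.1 + k.2 * v.2) * u.1) ^+ 2 +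
  (2 * (k.1 * u.1 + k.2 * u.2) * v.2 - 2 * (k.1 * v.1 + k.2 * v.2) * u.2) ^+ 2).
  by rewrite -nk; ring.
by rewrite Eu Ev; ring.
Qed.

(* A lattice triangle has area at least 1/2, and its circumradius is the
   product of its sides over four times its area. *)
Lemma circle_near_unique (n g : int) (k l l' : int * int) :
  lattice_norm k = n -> lattice_norm l = n -> lattice_norm l' = n ->
  0 <= g -> 8 * g ^+ 6 < n -> l != k -> l' != k ->
  `|l.1 - k.1| <= g -> `|l.2 - k.2| <= g ->
  `|l'.1 - k.1| <= g -> `|l'.2 - k.2| <= g -> l = l'.
Proof.
move=> nk nl nl' g0 gn lk lk' l1 l2 l1' l2'.
pose u := (l.1 - k.1, l.2 - k.2); pose v := (l'.1 - k.1, l'.2 - k.2).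
have T : 4 * n * lattice_det u v ^+ 2 =
  lattice_norm u * lattice_norm v * lattice_norm (u.1 - v.1, u.2 - v.2).
  by apply: (@circle_triangle k); rewrite // /u /v /= !subrKC -!surjective_pairing.
have n0 : 0 < n by apply: le_lt_trans gn; rewrite mulr_ge0// exprn_ge0.
have sq2 (a b : int) : `|a| <= b -> a ^+ 2 <= b ^+ 2.
  by move=> ab; rewrite -[a ^+ 2]real_normK ?num_real// lerXn2r// nnegrE// (le_trans _ ab).
have nu : lattice_norm u <= 2 * g ^+ 2.
  by rewrite mulr2n mulrDl mul1r lerD//= sq2.
have nv : lattice_norm v <= 2 * g ^+ 2.
  by rewrite mulr2n mulrDl mul1r lerD//= sq2.
have nuv : lattice_norm (u.1 - v.1, u.2 - v.2) <= 8 * g ^+ 2.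
  rewrite (_ : 8 * g ^+ 2 = (2 * g) ^+ 2 + (2 * g) ^+ 2); last by ring.
  by rewrite lerD//= sq2//; rewrite /u /v /= ; lia.
have n_ge0 (j : int * int) : 0 <= lattice_norm j by rewrite addr_ge0 ?sqr_ge0.
have n_eq0 (j : int * int) : lattice_norm j = 0 -> j.1 = 0 /\ j.2 = 0.
  move/eqP; rewrite paddr_eq0 ?sqr_ge0// !sqrf_eq0 => /andP[/eqP -> /eqP ->] //.
have : lattice_det u v = 0.
  apply/eqP/contraT => D0.
  have D1 : 1 <= lattice_det u v ^+ 2.
    by rewrite -gtz0_ge1 exprn_even_gt0.
  suff : 4 * n <= 32 * g ^+ 6 by lia.
  apply: (@le_trans _ _ (4 * n * lattice_det u v ^+ 2)).
    by rewrite ler_peMr// mulr_ge0// ltW.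
  rewrite T (_ : 32 * g ^+ 6 = (2 * g ^+ 2) * (2 * g ^+ 2) * (8 * g ^+ 2)); last by ring.
  by rewrite ler_pM// ?mulr_ge0// ler_pM.
(* With zero determinant a side of the triangle vanishes, and only [l = l'] is compatible with the
   hypotheses. *)
move=> D0; move: T; rewrite D0 expr0n mulr0 => /esym/eqP.
rewrite !mulf_eq0 -orbA => /or3P[] /eqP/n_eq0 /= [].
- move=> /eqP; rewrite subr_eq0 => /eqP e1 /eqP; rewrite subr_eq0 => /eqP e2.
  by move: lk; rewrite [l]surjective_pairing e1 e2 -surjective_pairing eqxx.
- move=> /eqP; rewrite subr_eq0 => /eqP e1 /eqP; rewrite subr_eq0 => /eqP e2.
  by move: lk'; rewrite [l']surjective_pairing e1 e2 -surjective_pairing eqxx.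
- move=> e1 e2; rewrite [l]surjective_pairing [l']surjective_pairing.
  by congr (_, _); lia.
Qed.

(** * Trigonometric polynomials on small boxes *)

Section Trig.
Variable R : realType.
Implicit Types (x y r c : R) (m : int).

(** Integrates one Taylor inequality into the next: in the chain that starts from [cos x <= 1], each
    difference is the derivative of the following one. *)
Lemma ge0_of_derive (f df : R -> R) : (forall x, is_derive x 1 f (df x)) ->
  f 0 = 0 -> (forall x, 0 <= x -> 0 <= df x) -> forall x, 0 <= x -> 0 <= f x.
Proof.
move=> fdf f0 df0 x x0; rewrite -f0.
apply: (@ger0_derive1_ndecry R f 0) => // y.
- rewrite in_itv /= andbT => /ltW y0; rewrite derive1E.
  by have /@derive_val -> := fdf y; exact: df0.
- apply: continuous_subspaceT => z; apply: differentiable_continuous.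
  by apply/derivable1_diffP.
Qed.

Lemma sin_le_id x : 0 <= x -> sin x <= x.
Proof.
move=> x0; rewrite -subr_ge0.
apply: (@ge0_of_derive (fun x => x - sin x) (fun x => 1 - cos x)) => //.
  by rewrite sin0 subr0.
Qed.

Lemma cos_ge_poly x : 0 <= x -> 0 <= cos x - 1 + x ^+ 2 / 2.
Proof.
apply: (@ge0_of_derive (fun x => cos x - 1 + x ^+ 2 / 2)
  (fun x => x - sin x)).
- by move=> y; apply: is_derive_eq; rewrite /GRing.scale /=; field.
- by rewrite cos0 expr0n /=; ring.
- by move=> y y0; rewrite subr_ge0 sin_le_id.
Qed.

Lemma sin_ge_poly x : 0 <= x -> 0 <= sin x - x + x ^+ 3 / 6.
Proof.
apply: (@ge0_of_derive (fun x => sin x - x + x ^+ 3 / 6)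
  (fun x => cos x - 1 + x ^+ 2 / 2)).
- by move=> y; apply: is_derive_eq; rewrite /GRing.scale /=; field.
- by rewrite sin0 expr0n /=; ring.
- exact: cos_ge_poly.
Qed.

Lemma cos_le_poly x : 0 <= x -> 0 <= 1 - x ^+ 2 / 2 + x ^+ 4 / 24 - cos x.
Proof.
apply: (@ge0_of_derive (fun x => 1 - x ^+ 2 / 2 + x ^+ 4 / 24 - cos x)
  (fun x => sin x - x + x ^+ 3 / 6)).
- by move=> y; apply: is_derive_eq; rewrite /GRing.scale /=; field.
- by rewrite cos0 !expr0n /=; ring.
- exact: sin_ge_poly.
Qed.

Lemma sin_le_poly x : 0 <= x -> 0 <= x - x ^+ 3 / 6 + x ^+ 5 / 120 - sin x.
Proof.
apply: (@ge0_of_derive (fun x => x - x ^+ 3 / 6 + x ^+ 5 / 120 - sin x)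
  (fun x => 1 - x ^+ 2 / 2 + x ^+ 4 / 24 - cos x)).
- by move=> y; apply: is_derive_eq; rewrite /GRing.scale /=; field.
- by rewrite sin0 !expr0n /=; ring.
- exact: cos_le_poly.
Qed.

Lemma sin_ge_half x : 0 <= x <= 1 -> x / 2 <= sin x.
Proof.
move=> /andP[x0 x1]; have := sin_ge_poly x0.
have : x ^+ 3 <= x by rewrite exprS ler_piMr// exprn_ile1.
lra.
Qed.

Lemma sin_le_cubic x : 0 <= x <= 1 -> sin x <= x - x ^+ 3 / 12.
Proof.
move=> /andP[x0 x1]; have := sin_le_poly x0.
have : x ^+ 5 <= x ^+ 3 by rewrite (exprD _ 3 2) ler_piMr ?exprn_ge0// exprn_ile1.
have : 0 <= x ^+ 3 by rewrite exprn_ge0.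
lra.
Qed.

(** The integral of [cos (w * y)] over the interval of length [r] centred at 0. Over a translate it
    is multiplied by the cosine at the midpoint. *)
Definition sinc_int (w r : R) : R := if w == 0 then r else 2 * sin (w * r / 2) / w.

Lemma Rintegral_cos (w x r c : R) : 0 <= r ->
  \int[@lebesgue_measure R]_(y in `[x, x + r[) cos (w * y + c) =
  sinc_int w r * cos (w * (x + r / 2) + c).
Proof.
rewrite le_eqVlt => /predU1P[<-|r0].
  rewrite addr0 set_itv_ge ?bnd_simp// Rintegral_set0 /sinc_int mulr0 mul0r sin0.
  by case: ifP; rewrite ?mulr0 !mul0r.
have cnt : continuous (fun y => cos (w * y + c)).
  move=> y; apply: (@continuous_comp _ _ _ (fun y => w * y + c) cos); last exact: continuous_cos.
  by apply: cvgD; [apply: cvgMr; exact: cvg_id|exact: cvg_cst].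
have xr : x < x + r by rewrite ltrDl.
rewrite Rintegral_itv_bndo_bndc; last first.
  apply: integrableS (_ : lebesgue_measure.-integrable `[x, x + r] _) => //.
    by apply: subset_itvl; rewrite bnd_simp.
  apply: continuous_compact_integrable; first exact: segment_compact.
  by apply: continuous_subspaceT; exact: cnt.
rewrite /sinc_int; have [->|w0] := eqVneq w 0.
  under eq_Rintegral do rewrite mul0r.
  rewrite Rintegral_cst//= lebesgue_measure_itv /= lte_fin xr mul0r.
  by rewrite -EFinB /= mulrC; congr (_ * _); ring.
have D (y : R) : is_derive y 1 (fun y => sin (w * y + c) / w) (cos (w * y + c)).
  have Dl : is_derive y 1 (fun y : R => w * y + c) w.
    by apply: is_derive_eq; rewrite /GRing.scale /=; ring.
  have Ds := @is_derive1_comp R sin (fun y => w * y + c) y _ _ (is_derive_sin _) Dl.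
  have -> : (fun y => sin (w * y + c) / w) = w^-1 *: (sin \o (fun y => w * y + c)).
    by apply/funext => z /=; rewrite mulrC.
  by apply: is_derive_eq; rewrite /GRing.scale /=; field.
have cF : continuous (fun y => sin (w * y + c) / w).
  move=> y; apply: differentiable_continuous; apply/derivable1_diffP.
  exact: (@ex_derive _ _ _ _ _ _ _ (D y)).
rewrite /Rintegral (@continuous_FTC2 _ _ (fun y => sin (w * y + c) / w))//.
- rewrite -EFinB /=.
  have -> : w * (x + r) + c = (w * (x + r / 2) + c) + w * r / 2 by field.
  have -> : w * x + c = (w * (x + r / 2) + c) - w * r / 2 by field.
  by rewrite sinB sinD; field.
- by apply: continuous_subspaceT; exact: cnt.
- split.
  + by move=> y _; apply: (@ex_derive _ _ _ _ _ _ _ (D y)).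
  + exact/cvg_at_right_filter/cF.
  + exact/cvg_at_left_filter/cF.
- by move=> y _; rewrite derive1E; have /@derive_val -> := D y.
Qed.

End Trig.

(** * The energy on a box as a quadratic form in the coefficients *)

Section Plane.
Variable R : realType.
Implicit Types (x : R * R) (r c : R) (k l : int * int).

Local Notation leb := (@lebesgue_measure R).
Local Notation leb2 := (@lebesgue_measure R \x @lebesgue_measure R)%E.
Local Notation sqn := (@Defs.sqr_normc R).

(** An algebra containing all integrands built from finitely many characters; membership gives
    integrability on every set of finite measure at once. *)
Definition bounded_measurable (f : R * R -> R) :=
  measurable_fun setT f /\ exists M, forall x, `|f x| <= M.

Lemma bmeas_integrable (f : R * R -> R) (D : set (R * R)) : bounded_measurable f ->
  measurable D -> (leb2 D < +oo)%E -> leb2.-integrable D (EFin \o f).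
Proof.
move=> [mf [M fM]] mD Doo; apply: measurable_bounded_integrable => //.
  exact: measurable_funTS.
exists M; split; first exact: num_real.
by move=> y My x _; exact: le_trans (fM x) (ltW My).
Qed.

Lemma bmeas_cst c : bounded_measurable (fun=> c).
Proof. by split; [exact: measurable_cst|exists `|c| => _]. Qed.

Lemma bmeasD (f g : R * R -> R) : bounded_measurable f -> bounded_measurable g ->
  bounded_measurable (fun x => f x + g x).
Proof.
move=> [mf [M fM]] [mg [N gN]]; split; first exact: measurable_funD.
by exists (M + N) => x; rewrite (le_trans (ler_normD _ _))// lerD.
Qed.

Lemma bmeasM (f g : R * R -> R) : bounded_measurable f -> bounded_measurable g ->
  bounded_measurable (fun x => f x * g x).
Proof.
move=> [mf [M fM]] [mg [N gN]]; split; first exact: measurable_funM.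
by exists (M * N) => x; rewrite normrM ler_pM.
Qed.

Lemma bmeas_sum (I : Type) (s : seq I) (f : I -> R * R -> R) :
  (forall i, bounded_measurable (f i)) -> bounded_measurable (fun x => \sum_(i <- s) f i x).
Proof.
move=> bf; elim: s => [|i s IH].
  rewrite (_ : (fun _ => _) = fun=> 0); first exact: bmeas_cst.
  by apply/funext => x; rewrite big_nil.
rewrite (_ : (fun _ => _) = fun x => f i x + \sum_(j <- s) f j x); first exact: bmeasD.
by apply/funext => x; rewrite big_cons.
Qed.

Lemma measurable_phase (a b c : R) :
  measurable_fun setT (fun x : R * R => 2 * pi * (a * x.1 + b * x.2) + c).
Proof.
apply: measurable_funD => //; apply: measurable_funM => //.
by apply: measurable_funD; apply: measurable_funM.
Qed.

Lemma bmeas_cos (a b c : R) :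
  bounded_measurable (fun x => cos (2 * pi * (a * x.1 + b * x.2) + c)).
Proof.
split; last by exists 1 => x; exact: cos_max.
apply: (@measurableT_comp _ _ _ _ _ _ (@cos R)); last exact: measurable_phase.
by apply: continuous_measurable_fun; exact: continuous_cos.
Qed.

Lemma Rintegral_bmeas_sum (I : Type) (s : seq I) (f : I -> R * R -> R) (D : set (R * R)) :
  measurable D -> (leb2 D < +oo)%E -> (forall i, bounded_measurable (f i)) ->
  \int[leb2]_(x in D) (\sum_(i <- s) f i x) = \sum_(i <- s) \int[leb2]_(x in D) f i x.
Proof.
move=> mD Doo bf; elim: s => [|i s IH].
  by under eq_Rintegral do rewrite big_nil; rewrite Rintegral_cst// mul0r big_nil.
under eq_Rintegral do rewrite big_cons.
rewrite RintegralD// ?IH ?big_cons//.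
  exact: bmeas_integrable.
by apply: bmeas_integrable => //; exact: bmeas_sum.
Qed.

Lemma Rintegral_prod (A B : set R) (f : R * R -> R) : measurable A -> measurable B ->
  leb2.-integrable (A `*` B) (EFin \o f) ->
  (forall y1, A y1 -> leb.-integrable B (fun y2 => (f (y1, y2))%:E)) ->
  \int[leb2]_(x in A `*` B) f x = \int[leb]_(y1 in A) \int[leb]_(y2 in B) f (y1, y2).
Proof.
move=> mA mB fi fiB; rewrite /Rintegral; congr fine.
rewrite integral_mkcond -integral12_prod_meas1; last first.
  by apply/(@integrable_mkcond _ _ R leb2 _ _ _).1 => //; exact: measurableX.
rewrite [RHS]integral_mkcond; apply: eq_integral => x _.
rewrite /fubini_F /= !patchE; case: ifPn => xA.
  rewrite fineK; last by apply: integrable_fin_num => //; exact: fiB (set_mem xA).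
  rewrite [RHS]integral_mkcond; apply: eq_integral => y _.
  by rewrite !patchE in_setX xA.
by rewrite integral0_eq// => y _; rewrite patchE in_setX (negbTE xA).
Qed.

Definition box x r : set (R * R) := `[x.1, x.1 + r[ `*` `[x.2, x.2 + r[.

Lemma measurable_box x r : measurable (box x r).
Proof. exact: measurableX. Qed.

Lemma itv_lty (a r : R) : (leb `[a, (a + r)%R[ < +oo)%E.
Proof. by rewrite lebesgue_measure_itv /=; case: ifP => _; rewrite -?EFinB ltry. Qed.

Lemma integrable_cos_itv (w c a r : R) :
  leb.-integrable `[a, a + r[ (EFin \o (fun y => cos (w * y + c))).
Proof.
apply: measurable_bounded_integrable => //; first exact: itv_lty.
  apply: measurable_funTS; apply: (@measurableT_comp _ _ _ _ _ _ (@cos R)).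
    by apply: continuous_measurable_fun; exact: continuous_cos.
  by apply: measurable_funD => //; apply: measurable_funM.
exists 1; split; first exact: num_real.
by move=> M M1 z _; exact: le_trans (cos_max _) (ltW M1).
Qed.

Lemma box_lty x r : (leb2 (box x r) < +oo)%E.
Proof.
rewrite /box product_measure1E//; apply: lte_mul_pinfty => //; last exact: itv_lty.
by rewrite ge0_fin_numE//; exact: itv_lty.
Qed.

(** The Fourier transform of the indicator of a box centred at 0, hence real and even; the position
    of the box enters through the characters at its centre. *)
Definition dker (k : int * int) (r : R) : R :=
  sinc_int (2 * pi * k.1%:~R) r * sinc_int (2 * pi * k.2%:~R) r.

Definition center x r : R * R := (x.1 + r / 2, x.2 + r / 2).

Definition phase k x : R := 2 * pi * (k.1%:~R * x.1 + k.2%:~R * x.2).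

Lemma Rintegral_box_cos k x r c : 0 <= r ->
  \int[leb2]_(y in box x r) cos (phase k y + c) =
  dker k r * cos (phase k (center x r) + c).
Proof.
move=> r0; rewrite /box Rintegral_prod//; first last.
- move=> y1 _; have := integrable_cos_itv (2 * pi * k.2%:~R) (2 * pi * k.1%:~R * y1 + c) x.2 r.
  by apply: eq_integrable => // y2 _; congr (cos _)%:E; rewrite /phase /=; ring.
- apply: bmeas_integrable; [exact: bmeas_cos|exact: measurable_box|exact: box_lty].
rewrite /dker; transitivity (\int[leb]_(y1 in `[x.1, x.1 + r[)
  (sinc_int (2 * pi * k.2%:~R) r *
   cos (2 * pi * k.1%:~R * y1 + (2 * pi * k.2%:~R * (x.2 + r / 2) + c)))).
  apply: eq_Rintegral => y1 _.
  transitivity (\int[leb]_(y in `[x.2, x.2 + r[)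
     cos (2 * pi * k.2%:~R * y + (2 * pi * k.1%:~R * y1 + c))).
    by apply: eq_Rintegral => y _; rewrite /phase; congr cos => /=; ring.
  by rewrite Rintegral_cos//; congr (_ * cos _); ring.
rewrite RintegralZl//; last exact: integrable_cos_itv.
rewrite Rintegral_cos// mulrCA mulrA; congr (_ * cos _).
by rewrite /phase /center /=; ring.
Qed.

(** The real part of [z] times the conjugate of [w]. It polarizes the squared modulus and keeps
    every integral real. *)
Definition cdot (z w : R[i]) : R :=
  complex.Re z * complex.Re w + complex.Im z * complex.Im w.

Lemma cdotzz z : cdot z z = sqn z.
Proof. by rewrite /cdot /Defs.sqr_normc !expr2. Qed.

Lemma sqn_ge0 z : 0 <= sqn z.
Proof. by rewrite addr_ge0 ?sqr_ge0. Qed.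

Lemma cdotC z w : cdot z w = cdot w z.
Proof. by rewrite /cdot mulrC [X in _ + X]mulrC. Qed.

Lemma cdot0z z : cdot 0 z = 0.
Proof. by rewrite /cdot /= !mul0r addr0. Qed.

Lemma cdotDl z1 z2 w : cdot (z1 + z2) w = cdot z1 w + cdot z2 w.
Proof. by case: z1 z2 => [a b] [a' b']; rewrite /cdot /=; ring. Qed.

Lemma cdot_suml (I : Type) (s : seq I) (f : I -> R[i]) w :
  cdot (\sum_(i <- s) f i) w = \sum_(i <- s) cdot (f i) w.
Proof.
elim: s => [|i s IH]; first by rewrite !big_nil cdot0z.
by rewrite !big_cons cdotDl IH.
Qed.

Lemma cdot_sumr (I : Type) (s : seq I) (f : I -> R[i]) w :
  cdot w (\sum_(i <- s) f i) = \sum_(i <- s) cdot w (f i).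
Proof. by rewrite cdotC cdot_suml; apply: eq_bigr => i _; exact: cdotC. Qed.

Lemma cdot_le z w : `|cdot z w| <= (sqn z + sqn w) / 2.
Proof.
case: z w => [a b] [a' b']; rewrite /cdot /Defs.sqr_normc /=; rewrite ler_norml.
have := sqr_ge0 (a - a'); have := sqr_ge0 (b - b').
have := sqr_ge0 (a + a'); have := sqr_ge0 (b + b'); nra.
Qed.

Lemma sqnM z w : sqn (z * w) = sqn z * sqn w.
Proof. by case: z w => [a b] [a' b']; rewrite /Defs.sqr_normc /=; ring. Qed.

Lemma sqn_expi (a : R) : sqn (expi a) = 1.
Proof. by rewrite /Defs.sqr_normc /= cos2Dsin2. Qed.

(** The sine is written as a cosine shifted by [pi / 2], so that one formula for cosines of
    arbitrary phase integrates both terms. *)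
Lemma cdot_expi (z w : R[i]) (a b : R) :
  cdot (z * expi a) (w * expi b) = cdot z w * cos (a - b) +
  (complex.Im z * complex.Re w - complex.Re z * complex.Im w) * cos (a - b + pi / 2).
Proof.
case: z w => [p q] [p' q']; rewrite cosDpihalf cosB sinB /cdot /expi /=; ring.
Qed.

Lemma torus_charE k x : torus_char k x = expi (phase k x).
Proof. by []. Qed.

Lemma phaseB k l x : phase k x - phase l x = phase (k.1 - l.1, k.2 - l.2) x.
Proof. by rewrite /phase /= !intrB; ring. Qed.

Definition trig_sum (s : seq (int * int)) (a : int * int -> R[i]) x : R[i] :=
  \sum_(k <- s) a k * torus_char k x.

Lemma sqn_trig_sum s a x : sqn (trig_sum s a x) =
  \sum_(k <- s) \sum_(l <- s) cdot (a k * torus_char k x) (a l * torus_char l x).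
Proof.
by rewrite -cdotzz cdot_suml; apply: eq_bigr => k _; rewrite cdot_sumr.
Qed.

Lemma bmeas_cdot_char k l z w :
  bounded_measurable (fun x => cdot (z * torus_char k x) (w * torus_char l x)).
Proof.
under eq_fun do rewrite !torus_charE cdot_expi phaseB.
apply: bmeasD.
  apply: bmeasM; first exact: bmeas_cst.
  by rewrite /phase; under eq_fun do rewrite -[2 * pi * _]addr0; exact: bmeas_cos.
by apply: bmeasM; [exact: bmeas_cst|exact: bmeas_cos].
Qed.

Lemma bmeas_sqn_trig_sum s a : bounded_measurable (fun x => sqn (trig_sum s a x)).
Proof.
under eq_fun do rewrite sqn_trig_sum.
by apply: bmeas_sum => k; apply: bmeas_sum => l; exact: bmeas_cdot_char.
Qed.

Lemma Rintegral_box_cdot_char k l z w x r : 0 <= r ->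
  \int[leb2]_(y in box x r) cdot (z * torus_char k y) (w * torus_char l y) =
  dker (k.1 - l.1, k.2 - l.2) r *
  cdot (z * torus_char k (center x r)) (w * torus_char l (center x r)).
Proof.
move=> r0; have mb := measurable_box x r; have oob := box_lty x r.
under eq_Rintegral do rewrite !torus_charE cdot_expi phaseB.
have bp c : bounded_measurable (fun y => cos (phase (k.1 - l.1, k.2 - l.2) y + c)).
  exact: bmeas_cos.
have bp0 : bounded_measurable (fun y => cos (phase (k.1 - l.1, k.2 - l.2) y)).
  by have := bp 0; under eq_fun do rewrite addr0.
rewrite RintegralD//; last 2 first.
- by apply: bmeas_integrable => //; apply: bmeasM => //; exact: bmeas_cst.
- by apply: bmeas_integrable => //; apply: bmeasM => //; exact: bmeas_cst.
rewrite !RintegralZl//; last 2 first.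
- exact: bmeas_integrable.
- exact: bmeas_integrable.
under eq_Rintegral do rewrite -[phase _ _]addr0.
rewrite !Rintegral_box_cos// !torus_charE cdot_expi phaseB addr0; ring.
Qed.

Definition box_energy x r s a : R := \int[leb2]_(y in box x r) sqn (trig_sum s a y).

Lemma box_energyE x r s a : 0 <= r ->
  box_energy x r s a = \sum_(k <- s) \sum_(l <- s) dker (k.1 - l.1, k.2 - l.2) r *
    cdot (a k * torus_char k (center x r)) (a l * torus_char l (center x r)).
Proof.
move=> r0; rewrite /box_energy; under eq_Rintegral do rewrite sqn_trig_sum.
have mb := measurable_box x r; have oob := box_lty x r.
rewrite Rintegral_bmeas_sum//; last first.
  by move=> k; apply: bmeas_sum => l; exact: bmeas_cdot_char.
apply: eq_bigr => k _; rewrite Rintegral_bmeas_sum//; last first.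
  by move=> l; exact: bmeas_cdot_char.
by apply: eq_bigr => l _; rewrite Rintegral_box_cdot_char.
Qed.

End Plane.

(** * Isolating a coefficient by differencing *)

Section Estimates.
Variable R : realType.
Implicit Types (x v : R * R) (r : R) (k l : int * int) (s : seq (int * int))
  (a b : int * int -> R[i]).

Local Notation leb2 := (@lebesgue_measure R \x @lebesgue_measure R)%E.
Local Notation sqn := (@Defs.sqr_normc R).

Lemma expiD (t u : R) : expi (t + u) = expi t * expi u.
Proof. by rewrite /expi cosD sinD; apply/eqP; rewrite eq_complex /= eqxx; apply/eqP; ring. Qed.

Lemma torus_charD k x v :
  torus_char k (x.1 + v.1, x.2 + v.2) = torus_char k x * torus_char k v.
Proof. by rewrite !torus_charE -expiD /phase /=; congr expi; ring. Qed.

Lemma sqn_torus_char k x : sqn (torus_char k x) = 1.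
Proof. exact: sqn_expi. Qed.

Lemma sqn_sub_expi (t u : R) : sqn (expi t - expi u) = 4 * sin ((t - u) / 2) ^+ 2.
Proof.
have -> : sqn (expi t - expi u) =
    sqn (expi ((t + u) / 2 + (t - u) / 2) - expi ((t + u) / 2 - (t - u) / 2)).
  by congr (sqn (expi _ - expi _)); field.
set p := (t - u) / 2; set q := (t + u) / 2.
rewrite /Defs.sqr_normc /= cosB sinB cosD sinD.
have := cos2Dsin2 q; set A := cos q; set B := sin q => AB.
rewrite (_ : _ + _ = 4 * sin p ^+ 2 * (A ^+ 2 + B ^+ 2)); last by ring.
by rewrite AB mulr1.
Qed.

Lemma sqn_sub_le (z w : R[i]) : sqn (z - w) <= 2 * sqn z + 2 * sqn w.
Proof.
case: z w => [p q] [p' q']; rewrite /Defs.sqr_normc /=.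
by have := sqr_ge0 (p + p'); have := sqr_ge0 (q + q'); nra.
Qed.

Lemma sqn_trig_sum_integrable x r s a :
  leb2.-integrable (box x r) (EFin \o (fun y => sqn (trig_sum s a y))).
Proof.
by apply: bmeas_integrable; [exact: bmeas_sqn_trig_sum|exact: measurable_box|exact: box_lty].
Qed.

Lemma box_energy_ge0 x r s a : 0 <= box_energy x r s a.
Proof. by apply: Rintegral_ge0 => y _; exact: sqn_ge0. Qed.

Lemma le_box_energy x v r r' s a : box v r `<=` box x r' ->
  box_energy v r s a <= box_energy x r' s a.
Proof.
move=> sub; rewrite /box_energy.
have iB := sqn_trig_sum_integrable x r' s a.
have ib := sqn_trig_sum_integrable v r s a.
rewrite /Rintegral; apply: fine_le.
- by apply: integrable_fin_num => //; exact: measurable_box.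
- by apply: integrable_fin_num => //; exact: measurable_box.
apply: ge0_subset_integral => //; try exact: measurable_box.
- exact: (measurable_int leb2 iB).
- by move=> y _; rewrite lee_fin sqn_ge0.
Qed.

Lemma box_energy_shift x v r s a : 0 <= r ->
  box_energy (x.1 + v.1, x.2 + v.2) r s a =
  box_energy x r s (fun k => a k * torus_char k v).
Proof.
move=> r0; rewrite !box_energyE//; apply: eq_bigr => k _; apply: eq_bigr => l _.
have -> : center (x.1 + v.1, x.2 + v.2) r = ((center x r).1 + v.1, (center x r).2 + v.2).
  by rewrite /center /=; congr (_, _); ring.
by rewrite !torus_charD; congr (_ * cdot _ _); rewrite mulrAC mulrA.
Qed.

Lemma box_energyB x r s a b :
  box_energy x r s (fun k => a k - b k) <=
  2 * box_energy x r s a + 2 * box_energy x r s b.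
Proof.
have ia := sqn_trig_sum_integrable x r s a; have ib := sqn_trig_sum_integrable x r s b.
have mb := measurable_box x r.
have bZ c : bounded_measurable (fun y => 2 * sqn (trig_sum s c y)).
  by apply: bmeasM; [exact: bmeas_cst|exact: bmeas_sqn_trig_sum].
have ibox f : bounded_measurable f -> leb2.-integrable (box x r) (EFin \o f).
  by move=> bf; apply: bmeas_integrable => //; exact: box_lty.
rewrite /box_energy -!RintegralZl// -RintegralD//; try exact: ibox.
apply: le_Rintegral => //; first exact: sqn_trig_sum_integrable.
  by apply: ibox; exact: bmeasD.
move=> y _; rewrite (_ : trig_sum _ _ y = trig_sum s a y - trig_sum s b y); last first.
  by rewrite /trig_sum -sumrB; apply: eq_bigr => k _; rewrite mulrBl.
exact: sqn_sub_le.
Qed.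

Lemma box_energyZ x r s a (t : R) :
  box_energy x r s (fun k => a k * expi t) = box_energy x r s a.
Proof.
apply: eq_Rintegral => y _; rewrite /trig_sum.
under eq_bigr do rewrite mulrAC.
by rewrite -mulr_suml sqnM sqn_expi mulr1.
Qed.

Lemma dker0 r : dker (0, 0) r = r ^+ 2.
Proof. by rewrite /dker /sinc_int /= mulr0 eqxx. Qed.

Lemma box_energy1 x r k a : 0 <= r -> box_energy x r [:: k] a = r ^+ 2 * sqn (a k).
Proof.
move=> r0; rewrite box_energyE// !big_seq1 !subrr dker0 cdotzz sqnM.
by rewrite sqn_torus_char mulr1.
Qed.

Lemma subset_box_shift x r (t : R) (v : R * R) : 0 <= t ->
  0 <= v.1 <= t -> 0 <= v.2 <= t ->
  box (x.1 + v.1, x.2 + v.2) r `<=` box x (r + t).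
Proof.
move=> t0 /andP[v1 v1t] /andP[v2 v2t] y [] /=.
rewrite !in_itv /= => /andP[y1 y1'] /andP[y2 y2'].
split => /=; rewrite in_itv /=; apply/andP; split; lra.
Qed.

(* Subtracting from a translate by [v] the function times [expi] of the phase of
   [l] kills the frequency [l], and multiplies every other coefficient by at least
   [2 * sg] if the translation is along a coordinate where the frequencies
   differ.  At most [n] such steps isolate the coefficient at [k]. *)
Lemma turan_box (sg M : R) (n : nat) : 0 <= sg -> sg <= 1 -> 2 * pi * M * sg <= 1 ->
  forall s a x r k, uniq s -> (size s <= n.+1)%N -> 0 <= r ->
  {in s, forall k, `|k.1|%:~R <= M /\ `|k.2|%:~R <= M} -> k \in s ->
  r ^+ 2 * sqn (a k) * (sg ^+ 2) ^+ n <= box_energy x (r + n%:R * sg) s a.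
Proof.
move=> sg0 sg1 Msg; elim: n => [|n IH] s a x r k us sz r0 sM ks.
  rewrite expr0 mulr1 mul0r addr0.
  have -> : s = [:: k].
    by case: s us sz sM ks => [|k' [|//]] //= _ _ _; rewrite inE => /eqP ->.
  by rewrite box_energy1.
have mono t : 0 <= t -> box_energy x t s a <= box_energy x (t + sg) s a.
  move=> t0; apply: le_box_energy.
  have := @subset_box_shift x t sg (0, 0) sg0.
  by rewrite /= !addr0 lexx sg0 -surjective_pairing; apply.
have nsg : 0 <= r + n%:R * sg by rewrite addr_ge0// mulr_ge0.
rewrite -[n.+1]addn1 natrD mulrDl mul1r addrA.
(* When there is no frequency to remove, the step is spent on enlarging the box and on a factor
   [sg ^ 2 <= 1]. *)
have [sz'|sz'] := leqP (size s) n.+1.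
  apply: le_trans (mono _ nsg); apply: le_trans (IH _ _ _ _ _ us sz' r0 sM ks).
  rewrite ler_wpM2l ?mulr_ge0 ?exprn_ge0 ?sqn_ge0//.
  by rewrite ler_wiXn2l ?exprn_ge0 ?exprn_ile1 ?leq_addr.
have [l ls lk] : exists2 l, l \in s & l != k.
  case: s us sz' ks {sz sM mono} => [|i [|j s]]// /andP[]; rewrite inE negb_or.
  move=> /andP[ij _] _ _ _; have [ik|ik] := eqVneq i k.
    by exists j; rewrite ?mem_head ?inE ?eqxx ?orbT// -ik eq_sym.
  by exists i; rewrite ?mem_head.
have step (v : R * R) : 0 <= v.1 <= sg -> 0 <= v.2 <= sg ->
    4 * sg ^+ 2 <= sqn (torus_char k v - torus_char l v) ->
    r ^+ 2 * sqn (a k) * (sg ^+ 2) ^+ (n + 1) <=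
    box_energy x (r + n%:R * sg + sg) s a.
  move=> v1 v2 gap; pose b j := a j * torus_char j v - a j * torus_char l v.
  have bl : b l = 0 by rewrite /b subrr.
  have := IH (rem l s) b x r k (rem_uniq l us) _ r0 _ _.
  rewrite size_rem// -subn1 leq_subLR add1n => /(_ sz).
  have sub j : j \in rem l s -> j \in s by exact: mem_rem.
  move=> /(_ (fun j js => sM j (sub j js))).
  rewrite mem_rem_uniq// inE eq_sym lk => /(_ ks) IHb.
  have {IHb} : r ^+ 2 * sqn (b k) * (sg ^+ 2) ^+ n <= box_energy x (r + n%:R * sg) s b.
    apply: (le_trans IHb); rewrite /box_energy le_eqVlt; apply/orP; left; apply/eqP.
    apply: eq_Rintegral => y _; congr sqn; rewrite /trig_sum.
    by rewrite [in RHS](perm_big _ (perm_to_rem ls)) big_cons bl mul0r [RHS]add0r.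
  (* The energy of the difference is at most [2 + 2] times the energy on the box enlarged by [sg].
     The factor 4 in the gap compensates this exactly, so a step costs [sg ^ 2]. *)
  have := box_energyB x (r + n%:R * sg) s (fun j => a j * torus_char j v)
    (fun j => a j * torus_char l v).
  rewrite -box_energy_shift// box_energyZ -/b => h1 h2.
  have h3 := le_box_energy s a (@subset_box_shift x (r + n%:R * sg) sg v sg0 v1 v2).
  have h4 := mono _ nsg.
  have h5 : r ^+ 2 * (sqn (a k) * (4 * sg ^+ 2)) * (sg ^+ 2) ^+ n <=
      r ^+ 2 * sqn (b k) * (sg ^+ 2) ^+ n.
    rewrite ler_wpM2r ?exprn_ge0// ler_wpM2l ?exprn_ge0//.
    by rewrite /b -mulrBr sqnM ler_wpM2l ?sqn_ge0.
  rewrite exprD expr1; lra.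
(* Frequencies differ by at most [2 * M], so the argument of the sine stays in [[0, 1]], where
   [sin y >= y / 2]; [pi >= 2] and [|m| >= 1] then leave at least [sg]. *)
have gap (m : int) : m != 0 -> `|m|%:~R <= 2 * M -> 4 * sg ^+ 2 <= 4 * sin (pi * m%:~R * sg) ^+ 2.
  move=> m0 mM; rewrite ler_pM2l//.
  have m1 : 1 <= `|m|%:~R :> R by rewrite ler1z -gtz0_ge1 normr_gt0.
  have p2 : 2 <= pi :> R := pi_ge2 R.
  have ps0 : 0 <= pi * sg by rewrite mulr_ge0// (le_trans _ p2).
  have -> : sin (pi * m%:~R * sg) ^+ 2 = sin (pi * `|m|%:~R * sg) ^+ 2.
    case: (leP 0 m) => [/ger0_norm ->//|/ltr0_norm ->].
    by rewrite intrN mulrN mulNr sinN sqrrN.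
  have h0 : 0 <= pi * `|m|%:~R * sg by rewrite mulrAC mulr_ge0// (le_trans _ m1).
  have h1 : pi * `|m|%:~R * sg <= 1.
    apply: le_trans Msg; rewrite mulrAC [leRHS](_ : _ = pi * sg * (2 * M)); last by ring.
    by rewrite ler_wpM2l.
  have := @sin_ge_half R (pi * `|m|%:~R * sg); rewrite h0 h1 => /(_ isT) h2.
  rewrite lerXn2r ?nnegrE//; first exact: le_trans (divr_ge0 h0 _) h2.
  apply: le_trans h2; rewrite ler_pdivlMr// mulrAC mulrC.
  apply: (@le_trans _ _ (pi * sg)); first by rewrite ler_wpM2r.
  by rewrite ler_peMr.
have [k1 k2] := sM _ ks; have [l1 l2] := sM _ ls.
have dM (p q : int) : `|p|%:~R <= M -> `|q|%:~R <= M -> `|p - q|%:~R <= 2 * M.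
  move=> pM qM; rewrite mulr2n mulrDl mul1r; apply: le_trans (lerD pM qM).
  by rewrite -intrD ler_int ler_normB.
have [e1|d1] := eqVneq k.1 l.1; last first.
  apply: (step (sg, 0)) => /=; rewrite ?sg0 ?lexx//.
  rewrite !torus_charE sqn_sub_expi phaseB (_ : _ / 2 = pi * (k.1 - l.1)%:~R * sg).
    by apply: gap; rewrite ?subr_eq0//; exact: dM.
  by rewrite /phase /=; field.
apply: (step (0, sg)) => /=; rewrite ?sg0 ?lexx//.
rewrite !torus_charE sqn_sub_expi phaseB (_ : _ / 2 = pi * (k.2 - l.2)%:~R * sg).
  apply: gap; rewrite ?subr_eq0; last exact: dM.
  by apply: contraNneq lk => e2; rewrite [l]surjective_pairing -e1 -e2 -surjective_pairing.
by rewrite /phase /=; field.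
Qed.

End Estimates.

(** * Diagonal dominance of the Gram matrix *)

Section HighFrequency.
Variable R : realType.
Implicit Types (x v : R * R) (r : R) (k l : int * int) (s : seq (int * int))
  (a b : int * int -> R[i]).

Local Notation sqn := (@Defs.sqr_normc R).

Lemma sinc_intN (w r : R) : sinc_int (- w) r = sinc_int w r.
Proof.
rewrite /sinc_int oppr_eq0; case: ifP => // _.
by rewrite !mulNr sinN mulrN invrN mulrNN.
Qed.

Lemma dkerN k r : dker (- k.1, - k.2) r = dker k r.
Proof. by rewrite /dker /= !intrN !mulrN !sinc_intN. Qed.

Lemma sin_abs_le (y : R) : `|sin y| <= `|y|.
Proof.
have pos (z : R) : 0 <= z -> `|sin z| <= z.
  move=> z0; rewrite ler_norml; have := sin_le_id z0 => -> /=; rewrite andbT.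
  rewrite -subr_ge0 opprK.
  apply: (@ge0_of_derive _ (fun z => sin z + z) (fun z => cos z + 1)) => //.
  - by rewrite sin0 addr0.
case: (leP 0 y) => [y0|/ltW y0]; first by rewrite [X in _ <= X]ger0_norm// pos.
by rewrite [X in _ <= X]ler0_norm// -normrN -sinN pos// oppr_ge0.
Qed.

Lemma sinc_int_le (w r : R) : 0 <= r -> `|sinc_int w r| <= r.
Proof.
move=> r0; rewrite /sinc_int; case: eqVneq => [_|w0]; first by rewrite ger0_norm.
rewrite normrM normfV ler_pdivrMr ?normr_gt0// normrM (ger0_norm (ler0n _ 2)).
rewrite mulrC -ler_pdivlMr//; apply: le_trans (sin_abs_le _) _.
by rewrite !normrM (ger0_norm r0) normfV (ger0_norm (ler0n _ 2)) [r * _]mulrC.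
Qed.

Lemma sinc_int_far (w r : R) : w != 0 -> `|sinc_int w r| <= 2 / `|w|.
Proof.
move=> w0; rewrite /sinc_int (negbTE w0) normrM normfV ler_pM2r ?invr_gt0 ?normr_gt0//.
by rewrite normrM (ger0_norm (ler0n _ 2)) ler_piMr// sin_max.
Qed.

Lemma sin_mulrn_le (y : R) (n : nat) : `|sin (n%:R * y)| <= n%:R * `|sin y|.
Proof.
elim: n => [|n IH]; first by rewrite !mul0r sin0 normr0.
rewrite -addn1 natrD !mulrDl !mul1r sinD.
apply: le_trans (ler_normD _ _) _; rewrite !normrM lerD//.
  by apply: le_trans IH; rewrite ler_piMr// cos_max.
by rewrite ler_piMl// cos_max.
Qed.

(** By [sin_mulrn_le] no nonzero [m] is worse than [m = 1]. There the cubic term of the sine gives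
    the loss [pi^2 r^3 / 12], at least [r^3 / 3] since [pi >= 2]. *)
Lemma sinc_int_gap (m : int) (r : R) : m != 0 -> 0 <= r -> pi * r <= 1 ->
  `|sinc_int (2 * pi * m%:~R) r| <= r - r ^+ 3 / 3.
Proof.
move=> m0 r0 pr; have p2 : 2 <= pi :> R := pi_ge2 R.
have p0 : 0 < pi :> R by exact: pi_gt0.
have m0' : m%:~R != 0 :> R by rewrite intr_eq0.
have w0 : 2 * pi * m%:~R != 0 :> R by rewrite !mulf_neq0// gt_eqF.
have am : `|m%:~R| = `|m|%N%:R :> R by rewrite -intr_norm -abszE.
have am0 : 0 < `|m|%N%:R :> R by rewrite ltr0n absz_gt0.
have prr : 0 <= pi * r <= 1 by rewrite pr andbT mulr_ge0// ltW.
rewrite /sinc_int (negbTE w0) normrM normfV !normrM am.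
rewrite (ger0_norm (ler0n _ 2)) (gtr0_norm p0) ler_pdivrMr ?mulr_gt0//.
have -> : `|sin (2 * pi * m%:~R * r / 2)| = `|sin (`|m|%N%:R * (pi * r))|.
  have -> : 2 * pi * m%:~R * r / 2 = m%:~R * (pi * r) by field.
  rewrite -am; case: (leP 0 (m%:~R : R)) => [/ger0_norm ->//|/ltr0_norm ->].
  by rewrite mulNr sinN normrN.
have h1 := sin_mulrn_le (pi * r) `|m|.
have h2 := sin_le_cubic prr.
have h3 : 0 <= sin (pi * r).
  by apply: le_trans (sin_ge_half prr); case/andP: prr => *; rewrite divr_ge0.
rewrite (ger0_norm h3) in h1.
apply: (@le_trans _ _ (2 * (`|m|%N%:R * (pi * r - (pi * r) ^+ 3 / 12)))).
  rewrite ler_pM2l//; apply: le_trans h1 _; rewrite ler_pM2l//.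
rewrite (_ : (r - r ^+ 3 / 3) * _ = 2 * (`|m|%N%:R * (pi * (r - r ^+ 3 / 3)))); last by ring.
rewrite ler_pM2l// ler_pM2l// mulrBr lerD2l lerN2.
have -> : (pi * r) ^+ 3 / 12 = pi * (r ^+ 3 * (pi ^+ 2 / 12)) by field.
rewrite ler_pM2l// ler_wpM2l ?exprn_ge0//.
have : 4 <= pi ^+ 2 :> R by nra.
lra.
Qed.

Lemma dker_gap k r : k != (0, 0) -> 0 <= r -> pi * r <= 1 ->
  `|dker k r| <= r ^+ 2 - r ^+ 4 / 3.
Proof.
move=> k0 r0 pr; rewrite /dker normrM.
have -> : r ^+ 2 - r ^+ 4 / 3 = r * (r - r ^+ 3 / 3) by ring.
have [k1|k1] := eqVneq k.1 0; last first.
  by rewrite mulrC ler_pM// ?sinc_int_le// sinc_int_gap.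
rewrite ler_pM// ?sinc_int_le// sinc_int_gap//.
by apply: contraNneq k0 => k2; rewrite [k]surjective_pairing k1 k2.
Qed.

Lemma dker_far k (g : int) r : 0 < g -> g < `|k.1| \/ g < `|k.2| -> 0 <= r ->
  `|dker k r| <= r / g%:~R.
Proof.
move=> g0 kg r0; have p2 : 2 <= pi :> R := pi_ge2 R.
have far (m : int) : g < `|m| -> `|sinc_int (2 * pi * m%:~R) r| <= g%:~R^-1.
  move=> gm; have m0 : m != 0 by lia.
  have p0 : 0 < pi :> R by exact: pi_gt0.
  have w0 : 2 * pi * m%:~R != 0 :> R by rewrite !mulf_neq0 ?intr_eq0// gt_eqF.
  have gR : 0 < g%:~R :> R by rewrite ltr0z.
  have gmR : g%:~R <= `|m%:~R| :> R by rewrite -intr_norm ler_int ltW.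
  apply: le_trans (sinc_int_far _ w0) _.
  rewrite !normrM (ger0_norm (ler0n _ 2)) (gtr0_norm p0).
  rewrite ler_pdivrMr ?mulr_gt0//; last exact: lt_le_trans gmR.
  rewrite mulrC ler_pdivlMr//; nra.
rewrite /dker normrM; case: kg => kg.
  by rewrite mulrC ler_pM// ?sinc_int_le// far.
by rewrite ler_pM// ?sinc_int_le// far.
Qed.

(** Schur's test: a product [cdot z w] is at most the mean of the two squared moduli, and the
    symmetry of the kernel gathers both halves of the mean into the row sum. *)
Lemma diagonal_dominance s a x r (rho : R) : 0 <= r ->
  {in s, forall k, \sum_(l <- s | l != k) `|dker (k.1 - l.1, k.2 - l.2) r| <= r ^+ 2 - rho} ->
  uniq s ->
  rho * \sum_(k <- s) sqn (a k) <= box_energy x r s a.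
Proof.
move=> r0 row us; rewrite box_energyE//.
pose c k := a k * torus_char k (center x r).
have ca k : sqn (c k) = sqn (a k) by rewrite sqnM sqn_torus_char mulr1.
pose D k l := `|dker (k.1 - l.1, k.2 - l.2) r|.
have DC k l : D k l = D l k.
  by rewrite /D -[in RHS]dkerN /= !opprB.
have lowk : \sum_(k <- s) (r ^+ 2 * sqn (c k) -
      \sum_(l <- s | l != k) D k l * ((sqn (c k) + sqn (c l)) / 2)) <=
    \sum_(k <- s) \sum_(l <- s) dker (k.1 - l.1, k.2 - l.2) r * cdot (c k) (c l).
  rewrite !big_seq; apply: ler_sum => k ks.
  rewrite [leRHS](bigD1_seq k)//= !subrr dker0 cdotzz lerD2l lerNl -sumrN.
  apply: ler_sum => l lk; apply: le_trans (ler_norm _) _.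
  by rewrite normrN normrM ler_wpM2l// cdot_le.
apply: le_trans lowk.
have -> : \sum_(k <- s) (r ^+ 2 * sqn (c k) -
      \sum_(l <- s | l != k) D k l * ((sqn (c k) + sqn (c l)) / 2)) =
   \sum_(k <- s) sqn (c k) * (r ^+ 2 - \sum_(l <- s | l != k) D k l).
  rewrite !sumrB; under [in RHS]eq_bigr do rewrite mulrBr mulrC.
  rewrite [in RHS]sumrB; congr (_ - _).
  transitivity (\sum_(k <- s) \sum_(l <- s | l != k) D k l * (sqn (c k) / 2) +
                \sum_(k <- s) \sum_(l <- s | l != k) D k l * (sqn (c l) / 2)).
    rewrite -big_split; apply: eq_bigr => k _; rewrite -big_split; apply: eq_bigr => l _.
    by rewrite /= -mulrDr -mulrDl.
  rewrite [X in _ + X](exchange_big_dep xpredT)//=.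
  have -> : \sum_(l <- s) \sum_(k <- s | l != k) D k l * (sqn (c l) / 2) =
      \sum_(k <- s) \sum_(l <- s | l != k) D k l * (sqn (c k) / 2).
    by apply: eq_bigr => k _; apply: eq_big => l; [rewrite eq_sym|rewrite DC].
  rewrite -big_split; apply: eq_bigr => k _ /=.
  by rewrite -mulr_suml -mulrDr -splitr mulrC.
rewrite mulr_sumr !big_seq; apply: ler_sum => k ks.
rewrite mulrC ca ler_wpM2l ?sqn_ge0//; have := row k ks.
by rewrite -/(D k); lra.
Qed.

(* At most one other frequency of the circle lies within distance [g]; the
   kernel loses a factor [1 - r^2/3] there and is at most [r/g] farther away. *)
Lemma high_frequency_box s a x r (n g : int) : 0 < r -> pi * r <= 1 -> 0 < g ->
  8 * g ^+ 6 < n -> uniq s -> {in s, forall k, lattice_norm k = n} ->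
  (size s)%:R * (r / g%:~R) <= r ^+ 4 / 6 ->
  r ^+ 4 / 6 * \sum_(k <- s) sqn (a k) <= box_energy x r s a.
Proof.
move=> r0 pr g0 gn us sn sg; apply: diagonal_dominance => //; first exact: ltW.
move=> k ks; have gR : 0 < g%:~R :> R by rewrite ltr0z.
pose near l := (`|l.1 - k.1| <= g) && (`|l.2 - k.2| <= g).
pose B := r ^+ 2 - r ^+ 4 / 3.
have B0 : 0 <= B.
  by apply: le_trans (normr_ge0 _) (@dker_gap (1, 0) r _ (ltW r0) pr).
have near1 : (size [seq l <- s | (l != k) && near l] <= 1)%N.
  set t := [seq l <- s | _].
  have tP l : l \in t -> [/\ l != k, `|l.1 - k.1| <= g, `|l.2 - k.2| <= g & l \in s].
    by rewrite mem_filter => /andP[/and3P[]].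
  have ut : uniq t by exact: filter_uniq.
  case: t tP ut => [|l [|l' t]]// tP /= /andP[]; rewrite inE negb_or => /andP[/eqP ll' _] _.
  case: ll'; have [lk l1 l2 ls] := tP l (mem_head _ _).
  have [|lk' l1' l2' ls'] := tP l'; first by rewrite !inE eqxx orbT.
  by apply: (@circle_near_unique n g k l l') => //; [exact: sn|exact: sn|exact: sn|exact: ltW].
have bnd l : l != k -> `|dker (k.1 - l.1, k.2 - l.2) r| <= (if near l then B else 0) + r / g%:~R.
  move=> lk; case: ifPn => [_|].
    apply: (@le_trans _ _ B); last by rewrite lerDl divr_ge0// ltW.
    apply: dker_gap => //; last exact: ltW.
    apply: contraNneq lk => -[/eqP]; rewrite subr_eq0 => /eqP e1 /eqP.
    by rewrite subr_eq0 => /eqP e2; rewrite [l]surjective_pairing -e1 -e2 -surjective_pairing.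
  rewrite /near negb_and -!ltNge add0r => /orP lg; apply: dker_far => //=; last exact: ltW.
  by case: lg => lg; [left|right]; rewrite distrC.
apply: (@le_trans _ _ (\sum_(l <- s | l != k) ((if near l then B else 0) + r / g%:~R))).
  exact: ler_sum.
rewrite big_split /= -big_mkcondr /= -big_filter big_const_seq count_predT iter_addr_0.
(* Half of the gap [r^4 / 3] at the near neighbour pays for the far frequencies; the other half is
   the lower bound obtained. *)
have -> : r ^+ 2 - r ^+ 4 / 6 = B + r ^+ 4 / 6 by rewrite /B; field.
apply: lerD.
  case: (size _) near1 => [|[|//]] _; [by rewrite mulr0n|by rewrite mulr1n].
apply: le_trans sg; rewrite -big_filter big_const_seq count_predT iter_addr_0 -[leLHS]mulr_natl.
rewrite ler_wpM2r ?divr_ge0 ?(ltW r0) ?(ltW gR)// ler_nat size_filter; exact: count_size.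
Qed.

End HighFrequency.

(** * Choice of constants and the inequality on one circle *)

Section Constants.
Variable R : realType.
Implicit Types (x : R * R) (r : R) (k l : int * int) (s : seq (int * int))
  (a : int * int -> R[i]).

Local Notation sqn := (@Defs.sqr_normc R).

Lemma size_circle_exp (m : nat) (n : int) s : (0 < m)%N -> 0 < n -> uniq s ->
  {in s, forall k, lattice_norm k = n} ->
  (size s ^ m <= 10 ^ m * (`|n| ^ 2 * (m ^ (m * 2 ^ m)) ^ 2))%N.
Proof.
move=> m0 n0 us sn; apply: (@leq_trans ((10 * size (divisors `|n|) ^ 2) ^ m)).
  by rewrite leq_exp2r//; apply: size_circle n0 us sn.
rewrite expnMn leq_mul2l -expnMn -expnM mulnC expnM leq_exp2r// orbC.
by rewrite size_divisors_bound// absz_gt0 gt_eqF.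
Qed.

Lemma pi_le4 : pi <= 4 :> R.
Proof. by have := pihalf_lt2 R; lra. Qed.

Lemma low_frequency_box s a r (M : R) (N : nat) : 0 < r -> r <= 1 -> 1 <= M ->
  (0 < N)%N -> (size s <= N)%N -> uniq s ->
  {in s, forall k, `|k.1|%:~R <= M /\ `|k.2|%:~R <= M} ->
  \sum_(k <- s) sqn (a k) <=
  N%:R * (4 / r ^+ 2) * ((16 * N%:R * M / r) ^+ 2) ^+ N * box_energy (0, 0) r s a.
Proof.
move=> r0 r1 M1 N0 sN us sM.
have M0 : 0 < M by rewrite (lt_le_trans _ M1).
have N1 : 1 <= N%:R :> R by rewrite ler1n.
have N0R : 0 < N%:R :> R by rewrite ltr0n.
(* Small enough for two purposes: [N] translations by [sg] use up at most half of the side of the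
   box, and the phases [2 * pi * M * sg] stay below 1. *)
pose sg := r / (16 * N%:R * M).
have d0 : 0 < 16 * N%:R * M by rewrite !mulr_gt0.
have sg0 : 0 < sg by rewrite divr_gt0.
have NM1 : 1 <= N%:R * M by rewrite mulr_ege1.
have sg1 : sg <= 1 by rewrite ler_pdivrMr// mul1r -mulrA; nra.
have Nsg : r / 2 + N%:R * sg <= r.
  have -> : N%:R * sg = r / (16 * M) by rewrite /sg; field; rewrite !gt_eqF.
  have : r / (16 * M) <= r / 2.
    by rewrite ler_pM2l// lef_pV2 ?posrE ?mulr_gt0//; nra.
  lra.
have Msg : 2 * pi * M * sg <= 1.
  have -> : 2 * pi * M * sg = pi * r / (8 * N%:R) by rewrite /sg; field; rewrite !gt_eqF.
  rewrite ler_pdivrMr ?mulr_gt0// mul1r.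
  have p4 := pi_le4.
  have p0 : 0 < pi :> R by exact: pi_gt0.
  nra.
have E0 := box_energy_ge0 (0, 0) r s a.
have one k : k \in s ->
    sqn (a k) <= (4 / r ^+ 2) * ((16 * N%:R * M / r) ^+ 2) ^+ N * box_energy (0, 0) r s a.
  move=> ks; have r2 : 0 <= r / 2 by rewrite divr_ge0// ltW.
  have := turan_box (ltW sg0) sg1 Msg a (0, 0) us (leq_trans sN (leqnSn N)) r2 sM ks.
  move=> /le_trans /(_ (@le_box_energy R (0, 0) (0, 0) _ r s a _)) h.
  have {h} : (r / 2) ^+ 2 * sqn (a k) * (sg ^+ 2) ^+ N <= box_energy (0, 0) r s a.
    apply: h => y [] /=; rewrite !in_itv /= => /andP[y1 y1'] /andP[y2 y2'].
    by split; rewrite /= in_itv /= ?y1 ?y2 /=; lra.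
  have -> : 16 * N%:R * M / r = sg^-1 by rewrite /sg invf_div.
  have sgN : 0 < (sg ^+ 2) ^+ N by rewrite !exprn_gt0.
  rewrite !exprVn => h.
  rewrite -(ler_pM2l (_ : 0 < (r / 2) ^+ 2)) ?exprn_gt0 ?divr_gt0//.
  rewrite -(ler_pM2r sgN); apply: le_trans h _.
  rewrite le_eqVlt; apply/orP; left; apply/eqP.
  by field; rewrite !expf_neq0 ?gt_eqF.
rewrite big_seq; apply: le_trans (ler_sum _ one) _.
rewrite -big_seq big_const_seq count_predT iter_addr_0 -[leLHS]mulr_natl -!mulrA.
rewrite ler_wpM2r ?ler_nat// mulrA !mulr_ge0// ?invr_ge0 ?exprn_ge0 ?ltW//.
by rewrite !mulr_gt0 ?invr_gt0.
Qed.

(** With [m] fixed, the count is [O (n^(2/m))], which is compared with the separation on high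
    circles. On low circles [m] has to grow as [eps] shrinks, and [size_circle_expR] keeps it
    explicit. *)
Lemma size_circle_power (m : nat) : (0 < m)%N -> exists2 A : nat, (0 < A)%N &
  forall (n : int) s, 0 < n -> uniq s -> {in s, forall k, lattice_norm k = n} ->
  (size s ^ m <= A * `|n| ^ 2)%N.
Proof.
move=> m0; exists (10 ^ m * (m ^ (m * 2 ^ m)) ^ 2)%N.
  by rewrite muln_gt0 !expn_gt0 m0.
move=> n s n0 us sn; apply: leq_trans (size_circle_exp m0 n0 us sn) _.
by rewrite -mulnA leq_mul2l [X in (_ <= X)%N]mulnC leqnn orbT.
Qed.

Lemma natr_le_expR (n : nat) : n%:R <= expR n%:R :> R.
Proof. by apply: le_trans (expR_ge1Dx _); rewrite lerDr. Qed.

Lemma size_circle_expR (m : nat) (n : int) s (X : R) : (0 < m)%N -> 0 < n -> uniq s ->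
  {in s, forall k, lattice_norm k = n} -> `|n|%N%:R <= expR X ->
  (size s)%:R <= 10 * expR (2 * X / m%:R + 2 * 2 ^+ m * m%:R).
Proof.
move=> m0 n0 us sn nX; have h := size_circle_exp m0 n0 us sn.
have m0R : 0 < m%:R :> R by rewrite ltr0n.
rewrite -(ler_pXn2r m0) ?nnegrE ?mulr_ge0 ?expR_ge0//.
rewrite -[leLHS]natrX; apply: le_trans (_ : (10 ^ m * (`|n| ^ 2 * (m ^ (m * 2 ^ m)) ^ 2))%N%:R <= _).
  by rewrite ler_nat.
rewrite exprMn !natrM natrX ler_pM2l ?exprn_gt0//.
rewrite -expRM_natl mulrDr expRD.
rewrite [X in expR X * _](_ : _ = 2%:R * X); last by field; rewrite gt_eqF.
rewrite expRM_natl; apply: ler_pM; rewrite ?natrX -?expr2 ?exprn_ge0 ?ler0n//.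
  by rewrite lerXn2r ?nnegrE ?expR_ge0.
rewrite -!exprM.
rewrite [X in expR X](_ : _ = (m * 2 ^ m * 2)%N%:R * m%:R); last first.
  by rewrite !natrM natrX; ring.
rewrite expRM_natl lerXn2r ?nnegrE ?expR_ge0// ; exact: natr_le_expR.
Qed.

Lemma sqr_le_expR (t : R) : 0 <= t -> t ^+ 2 <= 4 * expR t.
Proof.
move=> t0; have -> : expR t = expR (t / 2) ^+ 2.
  by rewrite -expRM_natl; congr expR; field.
have := expR_ge1Dx (t / 2); nra.
Qed.

(** The left side is the exponent lost on low circles, where [Y = log (1/eps)]: up to constants, a
    logarithm of order [Y] times a bound for the number of frequencies. Here [148 * Y] is twice the
    bound [37 * (2 * Y)] for [log n], and [6120 * Y] is [3060 * (2 * Y)]. *)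
Definition exponent_bound (Y Z : R) (m : nat) :=
  6120 * Y * expR (148 * Y / m%:R + 2 * 2 ^+ m * m%:R) <= expR (7000 * Y / Z).

(* [m] is about half of the iterated logarithm [Z], so that [2^m] stays below
   the square root of [Y]. *)
Lemma iterated_exp_bound (Y Z : R) : 4 <= Z -> Y = expR Z ->
  exists2 m : nat, (0 < m)%N & exponent_bound Y Z m.
Proof.
move=> Z4 YE; have Z0 : 0 < Z by lra.
have Y0 : 0 < Y by rewrite YE expR_gt0.
have /andP[mZ Zm] : (Num.Def.truncn (Z / 2))%:R <= Z / 2 < (Num.Def.truncn (Z / 2)).+1%:R.
  by apply: truncn_itv; lra.
set m := Num.Def.truncn _ in mZ Zm; have {}Zm : Z / 2 < m%:R + 1 by rewrite natr1.
exists m.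
  rewrite lt0n; apply/eqP => m0; move: Zm; rewrite m0 mulr0n => Zm; lra.
have Zm4 : Z / 4 <= m%:R by lra.
have m0 : 0 < m%:R :> R by lra.
have Z2 : Z ^+ 2 <= 4 * Y by rewrite YE sqr_le_expR// ltW.
(* The exponent splits into [6124 + 592 + 16] multiples of [Y / Z], which fit under 7000. The first
   piece pays for the prefactor, since [6120 * Y <= expR (6120 + Z)]. *)
have e1 : 6120 + Z <= 6124 * (Y / Z).
  by rewrite mulrA ler_pdivlMr//; nra.
have e2 : 148 * Y / m%:R <= 592 * (Y / Z).
  rewrite mulrA ler_pdivlMr// mulrAC ler_pdivrMr//; nra.
have e3 : 2 * 2 ^+ m * m%:R <= 16 * (Y / Z).
  have h1 : 2 ^+ m <= expR (Z / 2).
    apply: (@le_trans _ _ (expR m%:R)); last by rewrite ler_expR.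
    rewrite -[m%:R]mulr1 expRM_natl lerXn2r ?nnegrE ?expR_ge0//.
    by apply: le_trans (expR_ge1Dx _); clear; lra.
  have h2 : (Z / 2) ^+ 2 <= 4 * expR (Z / 2) by apply: sqr_le_expR; rewrite divr_ge0// ltW.
  have h3 : Y = expR (Z / 2) ^+ 2 by rewrite YE -expRM_natl; congr expR; field.
  rewrite mulrA ler_pdivlMr// h3; set E := expR (Z / 2) in h1 h2 *.
  have E0 : 0 < E by exact: expR_gt0.
  have p0 : 0 <= 2 ^+ m :> R by rewrite exprn_ge0.
  apply: (@le_trans _ _ (2 * E * (Z / 2) * Z)).
    by rewrite ler_wpM2r ?(ltW Z0)// ler_pM ?mulr_ge0 ?ler_pM2l// ltW.
  rewrite (_ : 2 * E * (Z / 2) * Z = E * Z ^+ 2); last by field.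
  have h4 : Z ^+ 2 <= 16 * E by move: h2; rewrite exprMn; clear; lra.
  by rewrite expr2 [leRHS]mulrA [leRHS]mulrC ler_pM2l.
rewrite /exponent_bound; apply: (@le_trans _ _ (expR (6120 + Z + (148 * Y / m%:R + 2 * 2 ^+ m * m%:R)))).
  rewrite (expRD (6120 + Z)) (expRD 6120 Z) -YE ler_wpM2r ?expR_ge0// ler_pM2r//.
  by apply: le_trans (expR_ge1Dx _); clear -Z0; lra.
have YZ : 0 < Y / Z by rewrite divr_gt0.
rewrite ler_expR -mulrA; clear -e1 e2 e3 YZ; lra.
Qed.

Lemma le_int_normsq (p q n : int) : p ^+ 2 + q ^+ 2 = n ->
  `|p|%:~R <= (`|n|%N%:R : R) /\ `|q|%:~R <= (`|n|%N%:R : R).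
Proof.
have sq (z : int) : `|z| <= z ^+ 2 by rewrite -real_normK ?num_real//; nia.
move=> pq; have p2 := sq p; have q2 := sq q.
have p0 := sqr_ge0 p; have q0 := sqr_ge0 q.
rewrite -[`|n|%N%:R](_ : `|n|%N%:~R = _)// !ler_int; split; lia.
Qed.

(** Each factor is at most a power of [expR T], which also absorbs the numerical constants because
    [64 <= q <= expR T]. The prefactor contributes [78 * T] and each of the [N] powers [228 * T],
    hence at most [306 * N * T] with [N <= 10 * E]. *)
Lemma low_constant (N n : nat) (q T E : R) : 64 <= q -> q <= expR T -> 0 <= T ->
  (0 < N)%N -> N%:R <= expR (75 * T) -> (maxn n 1)%:R <= expR (37 * T) -> N%:R <= 10 * E ->
  4 * pi * (N%:R * (4 / (q^-1) ^+ 2) *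
    ((16 * N%:R * (maxn n 1)%:R / q^-1) ^+ 2) ^+ N) <= expR (3060 * T * E).
Proof.
move=> q64 qT T0 N0 Nq nq NE; have q0 : 0 < q by lra.
have p4 := pi_le4.
have p0 : 0 < pi :> R by exact: pi_gt0.
set M := (maxn n 1)%:R in nq *; have M0 : 0 <= M by exact: ler0n.
have N0R : 0 <= N%:R :> R by exact: ler0n.
have N1 : 1 <= N%:R :> R by rewrite ler1n.
rewrite exprVn !invrK.
have mulE : forall x y X Y : R, 0 <= x -> 0 <= y -> x <= expR X -> y <= expR Y ->
    x * y <= expR (X + Y).
  by move=> *; rewrite expRD ler_pM.
have powE : forall (x X : R) (j : nat), 0 <= x -> x <= expR X -> x ^+ j <= expR (j%:R * X).
  by move=> *; rewrite expRM_natl lerXn2r ?nnegrE ?expR_ge0.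
have nn : 0 <= 16 * N%:R * M * q by rewrite !mulr_ge0// ltW.
have h1 : 16 * N%:R * M * q <= expR (T + 75 * T + 37 * T + T).
  have e1 : 16 * N%:R <= expR (T + 75 * T) by apply: mulE => //; lra.
  have e2 : 16 * N%:R * M <= expR (T + 75 * T + 37 * T).
    by apply: mulE => //; rewrite mulr_ge0.
  by apply: mulE => //; rewrite ?mulr_ge0 ?(ltW q0).
have h2 := powE _ _ 2%N nn h1; have nn2 := exprn_ge0 2 nn.
have h3 := powE _ _ N nn2 h2; have nn3 := exprn_ge0 N nn2.
have h4 : 4 * pi * (N%:R * (4 * q ^+ 2)) <= expR (T + (75 * T + 2%:R * T)).
  rewrite (_ : 4 * pi * _ = 16 * pi * (N%:R * q ^+ 2)); last by ring.
  have qq := powE _ _ 2%N (ltW q0) qT; have q2 := exprn_ge0 2 (ltW q0).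
  have e1 : 16 * pi <= expR T by lra.
  have e2 := mulE _ _ _ _ N0R q2 Nq qq.
  by apply: mulE e1 e2; rewrite mulr_ge0 ?(ltW p0)// ltW.
have nn4 : 0 <= 4 * pi * (N%:R * (4 * q ^+ 2)) by rewrite !mulr_ge0// ltW.
rewrite [leLHS]mulrA; apply: le_trans (mulE _ _ _ _ nn4 nn3 h4 h3) _.
rewrite ler_expR; nra.
Qed.

(** The twelfth root of [N^24 <= A * c^2 * g^12], with the constants rounded up. *)
Lemma power_bound (A N n g c : nat) : (0 < A)%N -> (0 < c)%N ->
  (N ^ 24 <= A * n ^ 2)%N -> (n <= c * g ^ 6)%N -> (N ^ 2 <= c * A * g)%N.
Proof.
move=> A0 c0 NA nc; rewrite -(@leq_exp2r _ _ 12)// -expnM.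
apply: leq_trans NA _; apply: (@leq_trans (A * (c * g ^ 6) ^ 2)).
  by rewrite leq_mul2l leq_exp2r ?nc ?orbT.
rewrite !(expnMn _ g) (expnMn c (g ^ 6)) -(expnM g) mulnA leq_mul2r; apply/orP; right.
rewrite mulnC expnMn leq_mul//; first by rewrite leq_pexp2l.
by rewrite -[X in (X <= _)%N]expn1 leq_pexp2l.
Qed.

(** In [4 * pi], the part [2 * pi] is the inverse of the length of the time interval; the remaining
    2 is lost when a function is replaced by its Fourier sum. *)
Lemma circle_observability : exists C eps0 : R, 0 < C /\ 0 < eps0 /\
  forall eps : R, 0 < eps -> eps < eps0 ->
  forall (n : int) s a, uniq s -> {in s, forall k, lattice_norm k = n} ->
  4 * pi * \sum_(k <- s) sqn (a k) <=
  obs_const C eps * box_energy (0, 0) (eps / 2) s a.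
Proof.
(* The exponent 24 makes [(size s)^2] linear in the separation [g], where
   [n] is about [8 g^6]. *)
have [A A0 HA] := @size_circle_power 24 isT.
have A1 : 1 <= A%:R :> R by rewrite ler1n.
(* [512 = 8 * 2 ^ 6] is the price of replacing [g.+1] by [2 * g]; it yields
   [(size s)^2 <= B * g]. *)
have [B BE] : exists B : R, B = 512 * A%:R by exists (512 * A%:R).
have B1 : 512 <= B by lra.
(* [296 = 8 * 37]: below [r0] the numerical factor [8 * (37 * B)^6] in the threshold for [n] is at
   most [1/eps]. *)
pose r0 : R := ((296 * B) ^+ 6)^-1.
have Bg : 64 <= (296 * B) ^+ 6.
  apply: (@le_trans _ _ (296 * B)); first lra.
  by rewrite -[leLHS]expr1 ler_weXn2l//; lra.
have Bg0 : 0 < (296 * B) ^+ 6 by lra.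
have r0_gt0 : 0 < r0 by rewrite invr_gt0.
(* The second bound on [eps] makes the iterated logarithm of [1/eps] at least 4. *)
exists 7000, (Num.min r0 (expR (- expR 4))).
split; first by lra.
split.
  by rewrite lt_min r0_gt0 expR_gt0.
move=> eps e0; rewrite lt_min => /andP[er eY] n s a us sn.
have [->|snil] := eqVneq s [::].
  by rewrite big_nil mulr0 mulr_ge0 ?expR_ge0 ?box_energy_ge0.
pose Y := ln eps^-1; pose Z := ln Y; pose q := 2 * eps^-1.
have eV0 : 0 < eps^-1 by rewrite invr_gt0.
have YE : expR Y = eps^-1 by rewrite lnK.
have Y4 : expR 4 <= Y.
  rewrite -ler_expR YE -[leLHS]invrK -expRN lef_pV2 ?posrE ?expR_gt0//; exact: ltW.
have Y0 : 0 < Y by apply: lt_le_trans Y4; exact: expR_gt0.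
have ZE : Y = expR Z by rewrite lnK.
have Z4 : 4 <= Z by rewrite -ler_expR -ZE.
have qr0 : (296 * B) ^+ 6 <= eps^-1.
  by rewrite -[leLHS]invrK lef_pV2 ?posrE ?invr_gt0// ltW.
have q64 : 64 <= q by rewrite /q; lra.
have q0 : 0 < q by lra.
have qY : q <= expR (2 * Y).
  by rewrite mulr2n mulrDl mul1r expRD YE /q ler_pM2r//; lra.
pose r := eps / 2; have rq : r = q^-1 by rewrite /q invfM invrK mulrC.
have r_gt0 : 0 < r by rewrite /r divr_gt0.
have r1 : r <= 64^-1 by rewrite rq lef_pV2 ?posrE//.
have [m m0 Hm] := iterated_exp_bound Z4 ZE.
have E0 := box_energy_ge0 (0, 0) r s a.
rewrite -/r /obs_const -/Y -/Z.
have s0 : (0 < size s)%N by rewrite lt0n size_eq0.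
have n_ge0 : 0 <= n.
  case: s s0 sn {us snil E0} => // k s _ sn; rewrite -(sn k (mem_head _ _)).
  by rewrite addr_ge0 ?sqr_ge0.
pose W := 148 * Y / m%:R + 2 * 2 ^+ m * m%:R.
have W0 : 0 <= W by rewrite addr_ge0 ?mulr_ge0 ?invr_ge0 ?exprn_ge0 ?(ltW Y0).
pose T := 2 * Y; have T0 : 0 < T by rewrite mulr_gt0.
have lowcase : `|n|%N%:R <= expR (37 * T) ->
    4 * pi * \sum_(k <- s) sqn (a k) <= expR (expR (7000 * Y / Z)) * box_energy (0, 0) r s a.
  move=> nX.
  have [NE Nq] : (size s)%:R <= 10 * expR W /\ (size s)%:R <= expR (75 * T).
    move: n_ge0; rewrite le_eqVlt => /predU1P[n0|n0].
      have -> : size s = 1%N.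
        apply/eqP; rewrite eqn_leq s0 andbT (_ : 1 = size [:: ((0 : int), (0 : int))])%N//.
        apply: uniq_leq_size => // k /sn; rewrite -n0 /lattice_norm => /eqP.
        rewrite paddr_eq0 ?sqr_ge0// !sqrf_eq0 => /andP[/eqP k1 /eqP k2].
        by rewrite inE [k]surjective_pairing k1 k2.
      split; first by have := expR_ge1Dx W; clear -W0; lra.
      by apply: le_trans (expR_ge1Dx _); rewrite lerDl mulr_ge0// ltW.
    split.
      have := size_circle_expR m0 n0 us sn nX.
      by rewrite (_ : 2 * (37 * T) = 148 * Y)// /T; ring.
    (* The exponent 1 gives the crude count [10 * n^2], enough for the factors in which [N] enters
       only through its logarithm. *)
    have := size_circle_exp (ltn0Sn 0) n0 us sn.
    rewrite !expn1 exp1n muln1 -(ler_nat R) natrM natrX => /le_trans; apply.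
    apply: (@le_trans _ _ (q * (expR (37 * T)) ^+ 2)).
      by rewrite ler_pM ?exprn_ge0// ?lerXn2r ?nnegrE ?expR_ge0//; clear -q64; lra.
    rewrite -expRM_natl; apply: (@le_trans _ _ (expR T * expR (2%:R * (37 * T)))).
      by rewrite ler_wpM2r ?expR_ge0.
    by rewrite -expRD ler_expR; clear -T0; lra.
  (* The maximum takes care of [n = 0], where the frequency bound must still be at least 1. *)
  pose M : R := (maxn `|n| 1)%:R.
  have M1 : 1 <= M by rewrite ler1n leq_maxr.
  have Mq : M <= expR (37 * T).
    rewrite /M; case: (leqP `|n| 1) => // _.
    by apply: le_trans (expR_ge1Dx _); rewrite lerDl mulr_ge0// ltW.
  have sM : {in s, forall k, `|k.1|%:~R <= M /\ `|k.2|%:~R <= M}.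
    move=> k /sn /le_int_normsq[k1 k2].
    by split; [apply: le_trans k1 _|apply: le_trans k2 _]; rewrite ler_nat leq_maxl.
  have rle1 : r <= 1 by clear -r1; lra.
  have := low_frequency_box a r_gt0 rle1 M1 s0 (leqnn _) us sM.
  rewrite -(ler_pM2l (_ : 0 < 4 * pi)) ?mulr_gt0 ?pi_gt0// => /le_trans; apply.
  rewrite [leLHS]mulrA ler_wpM2r// rq; apply: le_trans (low_constant q64 qY (ltW T0) s0 Nq Mq NE) _.
  rewrite ler_expR; apply: le_trans Hm; rewrite le_eqVlt; apply/orP; left.
  by apply/eqP; rewrite /T; ring.
move: n_ge0; rewrite le_eqVlt => /predU1P[n0|n0].
  by apply: lowcase; rewrite -n0 /= expR_ge0.
(* The largest separation that [circle_near_unique] allows on this circle. *)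
have [g gP gmin] : exists2 g : nat, (`|n| <= 8 * g.+1 ^ 6)%N & (8 * g ^ 6 < `|n|)%N.
  have ex : exists g, (`|n| <= 8 * g.+1 ^ 6)%N.
    exists `|n|%N; apply: (@leq_trans (`|n|.+1 ^ 6)); last by rewrite leq_pmull.
    by rewrite (leq_trans (leqnSn _))// -[X in (X <= _)%N]expn1 leq_pexp2l.
  case: (ex_minnP ex) => -[|g] Pg ming; [exists 0%N|exists g.+1] => //.
    by rewrite exp0n// muln0 absz_gt0 gt_eqF.
  by rewrite ltnNge; apply/negP => /ming; rewrite ltnn.
(* Squaring [size s * (r / g) <= r^4 / 6] and inserting [(size s)^2 <= B * g] gives the condition
   [36 * B * q^6 <= g], with [q = 1 / r]. If it fails, [n] is at most [8 * (37 * B * q^6)^6], hence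
   at most [q^37], which is the origin of [37 * T]. *)
have [gbig|gsmall] := leP (36 * B * q ^+ 6) g%:R; last first.
  apply: lowcase; apply: (@le_trans _ _ (8 * g.+1 ^ 6)%N%:R); first by rewrite ler_nat.
  rewrite natrM natrX; apply: (@le_trans _ _ (8 * (37 * B * q ^+ 6) ^+ 6)).
    have q6 : 1 <= q ^+ 6 by rewrite exprn_ege1//; clear -q64; lra.
    have gq : g.+1%:R <= 37 * B * q ^+ 6.
      rewrite -[g.+1%:R]natr1 (_ : 37 * B * q ^+ 6 = 36 * B * q ^+ 6 + B * q ^+ 6); last by ring.
      by rewrite lerD ?(ltW gsmall)// mulr_ege1//; clear -B1; lra.
    by rewrite ler_pM2l// lerXn2r ?nnegrE// (le_trans _ gq).
  have q6 : (q ^+ 6) ^+ 6 <= expR (6%:R * (6%:R * T)).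
    by rewrite expRM_natl lerXn2r ?nnegrE ?exprn_ge0 ?expR_ge0 ?(ltW q0)//
      expRM_natl lerXn2r ?nnegrE ?expR_ge0 ?(ltW q0).
  have T37 : T + 6%:R * (6%:R * T) = 37 * T by ring.
  have B37 : 0 <= 37 * B by clear -B1; lra.
  have n1 : 0 <= 8 * (37 * B) ^+ 6 by rewrite mulr_ge0// exprn_ge0.
  have n2 : 0 <= (q ^+ 6) ^+ 6 by rewrite !exprn_ge0// ltW.
  rewrite -T37 (expRD T) (exprMn _ (37 * B)) [leLHS]mulrA.
  apply: (ler_pM n1 n2 _ q6).
  apply: le_trans qY; apply: (@le_trans _ _ ((296 * B) ^+ 6)); last by rewrite /q; clear -qr0 eV0; lra.
  have -> : 296 * B = 8 * (37 * B) by ring.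
  by rewrite (exprMn _ 8) ler_wpM2r ?exprn_ge0// -[leLHS]expr1 ler_weXn2l// ler1n.
have g0R : 0 < g%:R :> R.
  by apply: lt_le_trans gbig; rewrite !mulr_gt0 ?exprn_gt0//; apply: lt_le_trans B1.
have g0 : (0 < g)%N by move: g0R; rewrite ltr0n.
have NB : ((size s)%:R) ^+ 2 <= B * g%:R.
  have n512 : (`|n| <= 512 * g ^ 6)%N.
    apply: leq_trans gP _; rewrite (_ : 512 * g ^ 6 = 8 * (2 * g) ^ 6)%N; last first.
      by rewrite expnMn mulnA.
    have g2 : (g.+1 <= 2 * g)%N by rewrite mul2n -addnn -[g.+1]addn1 leq_add2l.
    by rewrite leq_mul2l leq_exp2r// g2 orbT.
  have := power_bound A0 (isT : (0 < 512)%N) (HA n s n0 us sn) n512.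
  by rewrite -(ler_nat R) natrX !natrM BE.
have high : (size s)%:R * (r / g%:R) <= r ^+ 4 / 6.
  rewrite -(ler_pXn2r (isT : (0 < 2)%N)) ?nnegrE; last 2 first.
  - by rewrite mulr_ge0 ?divr_ge0 ?ler0n// ltW.
  - by rewrite divr_ge0// exprn_ge0// ltW.
  rewrite exprMn; apply: (@le_trans _ _ (B * g%:R * (r / g%:R) ^+ 2)).
    by rewrite ler_wpM2r// sqr_ge0.
  have -> : B * g%:R * (r / g%:R) ^+ 2 = B * r ^+ 2 / g%:R by field; rewrite gt_eqF.
  rewrite ler_pdivrMr//; apply: (@le_trans _ _ ((r ^+ 4 / 6) ^+ 2 * (36 * B * q ^+ 6))).
    rewrite rq le_eqVlt; apply/orP; left; apply/eqP; field; rewrite gt_eqF//.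
  by rewrite ler_wpM2l ?sqr_ge0.
have pr : pi * r <= 1.
  apply: (@le_trans _ _ (4 * 64^-1)); last by rewrite ler_pdivrMr// mul1r ler_nat.
  by rewrite ler_pM ?pi_ge0 ?pi_le4// ltW.
have gn : 8 * (g%:Z) ^+ 6 < n.
  move: gmin; rewrite -ltz_nat (gez0_abs (ltW n0)) => /le_lt_trans; apply.
  by rewrite -[leRHS]natz natrM natrX (natz g).
have := @high_frequency_box R s a (0, 0) r n g r_gt0 pr _ gn us sn high.
rewrite ltz_nat => /(_ g0) hf.
apply: (@le_trans _ _ (4 * pi * (6 / r ^+ 4 * box_energy (0, 0) r s a))).
  rewrite ler_pM2l ?mulr_gt0 ?pi_gt0//.
  rewrite mulrAC ler_pdivlMr ?exprn_gt0// mulrC.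
  by move: hf; rewrite mulrAC ler_pdivrMr// [6 * _]mulrC.
rewrite [leLHS]mulrA ler_wpM2r//.
(* The constant [24 * pi / r^4] is polynomial in [1/eps]; its logarithm, at most [6 * T], is far
   below the exponent allowed for low circles. *)
apply: (@le_trans _ _ (q ^+ 6)).
  have q4 : 0 <= q ^+ 4 by rewrite exprn_ge0// ltW.
  have qq : 4 * pi * 6 <= q * q.
    apply: (@le_trans _ _ (64 * 64)); last by rewrite ler_pM.
    apply: (@le_trans _ _ (4 * 4 * 6)); last by rewrite -!natrM ler_nat.
    by rewrite ler_wpM2r// ler_wpM2l// pi_le4.
  rewrite rq exprVn invrK (_ : q ^+ 6 = q * q * q ^+ 4); last by ring.
  by rewrite [leLHS]mulrA ler_wpM2r.
apply: (@le_trans _ _ (expR T ^+ 6)).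
  by rewrite lerXn2r ?nnegrE ?expR_ge0 ?(ltW q0).
rewrite -expRM_natl ler_expR; apply: le_trans Hm.
have W1 : 1 <= expR W by apply: le_trans (expR_ge1Dx _); rewrite lerDl.
have cT : 6%:R * T <= 6120 * Y by rewrite /T; clear -Y0; lra.
have c0 : 0 <= 6120 * Y by clear -Y0; lra.
by apply: le_trans cT _; rewrite ler_peMr.
Qed.

End Constants.

(** * Fourier series on the torus *)

Section SquareIntegrable.
Variable R : realType.
Implicit Types (x : R * R) (k l : int * int) (s : seq (int * int))
  (u v w : R * R -> R[i]) (a : int * int -> R[i]).

Local Notation leb2 := (@lebesgue_measure R \x @lebesgue_measure R)%E.
Local Notation sqn := (@Defs.sqr_normc R).
Local Notation cell := (@torus_cell R).

Lemma torus_cell_box : cell = box (0, 0) 1.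
Proof. by rewrite /box /= add0r. Qed.

Lemma measurable_cell : measurable cell.
Proof. by rewrite torus_cell_box; exact: measurable_box. Qed.

Lemma cell_lty : (leb2 cell < +oo)%E.
Proof. by rewrite torus_cell_box; exact: box_lty. Qed.

Lemma sin_pi_int (m : int) : sin (pi * m%:~R) = 0 :> R.
Proof.
have nat0 (n : nat) : sin (pi * n%:R) = 0 :> R.
  elim: n => [|n IH]; first by rewrite mulr0 sin0.
  by rewrite -natr1 mulrDr mulr1 sinDpi IH oppr0.
case: m => n; first exact: nat0.
by rewrite NegzE intrN mulrN sinN nat0 oppr0.
Qed.

Lemma sinc_int1 (m : int) : sinc_int (2 * pi * m%:~R) 1 = (m == 0)%:R :> R.
Proof.
rewrite /sinc_int !mulf_eq0 intr_eq0 pnatr_eq0 /= (gt_eqF (@pi_gt0 R)) /=.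
case: eqP => // _.
rewrite (_ : 2 * pi * m%:~R * 1 / 2 = pi * m%:~R); last by field.
by rewrite sin_pi_int mulr0 mul0r.
Qed.

Lemma Rintegral_cell_cdot_char k l (z w : R[i]) :
  \int[leb2]_(x in cell) cdot (z * torus_char k x) (w * torus_char l x) =
  (k == l)%:R * cdot z w.
Proof.
rewrite torus_cell_box Rintegral_box_cdot_char// /dker !sinc_int1 !subr_eq0.
have [->|kl] := eqVneq k l.
  rewrite !eqxx !mul1r; set c := center _ _.
  case: z w => p q [p' q']; rewrite torus_charE /cdot /expi /=.
  have := cos2Dsin2 (phase l c); set A := cos _; set B := sin _ => AB.
  rewrite (_ : _ + _ = (p * p' + q * q') * (A ^+ 2 + B ^+ 2)); last by ring.
  by rewrite AB mulr1.
rewrite -natrM mulnb (_ : _ && _ = false) ?mul0r//.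
apply: contraNF kl => /andP[/eqP e1 /eqP e2].
by rewrite [k]surjective_pairing e1 e2 -surjective_pairing.
Qed.

Definition sq_integrable u :=
  [/\ measurable_fun setT (fun x => complex.Re (u x)),
      measurable_fun setT (fun x => complex.Im (u x)) &
      leb2.-integrable cell (EFin \o (fun x => sqn (u x)))].

Definition norm2 u : R := \int[leb2]_(x in cell) sqn (u x).

Definition inner u v : R := \int[leb2]_(x in cell) cdot (u x) (v x).

Lemma norm2_ge0 u : 0 <= norm2 u.
Proof. by apply: Rintegral_ge0 => x _; exact: sqn_ge0. Qed.

Lemma measurable_sqn u : measurable_fun setT (fun x => complex.Re (u x)) ->
  measurable_fun setT (fun x => complex.Im (u x)) -> measurable_fun setT (fun x => sqn (u x)).
Proof. by move=> mr mi; apply: measurable_funD; apply: measurable_funX. Qed.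

Lemma measurable_cdot u v :
  measurable_fun setT (fun x => complex.Re (u x)) ->
  measurable_fun setT (fun x => complex.Im (u x)) ->
  measurable_fun setT (fun x => complex.Re (v x)) ->
  measurable_fun setT (fun x => complex.Im (v x)) ->
  measurable_fun setT (fun x => cdot (u x) (v x)).
Proof. by move=> *; apply: measurable_funD; apply: measurable_funM. Qed.

Lemma L2norm_sqr_setT u : sq_integrable u -> L2norm_sqr setT u = (norm2 u)%:E.
Proof.
move=> [_ _ iu]; rewrite /L2norm_sqr setIT /norm2 /Rintegral fineK//.
by apply: (integrable_fin_num _ iu); exact: measurable_cell.
Qed.

Lemma in_L2P u : in_L2 u <-> torus_periodic u /\ sq_integrable u.
Proof.
split=> [[pu mr mi uoo]|[pu [mr mi iu]]]; split => //.
  split=> //; apply/integrableP; split.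
    by apply/measurable_EFinP; apply: measurable_funTS; exact: measurable_sqn.
  apply: le_lt_trans uoo; rewrite /L2norm_sqr setIT.
  apply: ge0_le_integral => //.
  - exact: measurable_cell.
  - by apply: measurableT_comp => //; apply/measurable_EFinP; apply: measurable_funTS; exact: measurable_sqn.
  - by apply/measurable_EFinP; apply: measurable_funTS; exact: measurable_sqn.
  - by move=> x _ /=; rewrite ger0_norm// sqn_ge0.
by rewrite L2norm_sqr_setT// ltry.
Qed.

Lemma integrable_cdot u v : sq_integrable u -> sq_integrable v ->
  leb2.-integrable cell (EFin \o (fun x => cdot (u x) (v x))).
Proof.
move=> [ur ui iu] [vr vi iv].
have iuv : leb2.-integrable cell (fun x => (sqn (u x))%:E + (sqn (v x))%:E)%E.
  by apply: (@integrableD _ _ R leb2 cell _ _ _ iu iv); exact: measurable_cell.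
apply: le_integrable iuv; first exact: measurable_cell.
  by apply/measurable_EFinP; apply: measurable_funTS; exact: measurable_cdot.
move=> x _ /=; rewrite lee_fin [leRHS]ger0_norm ?(addr_ge0 (sqn_ge0 _) (sqn_ge0 _))//.
apply: le_trans (cdot_le _ _) _.
by have := sqn_ge0 (u x); have := sqn_ge0 (v x); lra.
Qed.

Lemma bmeas_sq_integrable u : bounded_measurable (fun x => complex.Re (u x)) ->
  bounded_measurable (fun x => complex.Im (u x)) -> sq_integrable u.
Proof.
move=> br bi; split; [by case: br|by case: bi|].
apply: bmeas_integrable; [|exact: measurable_cell|exact: cell_lty].
by apply: bmeasD; under eq_fun do rewrite expr2; exact: bmeasM.
Qed.

Lemma torus_char0 x : torus_char (0, 0) x = 1.
Proof. by rewrite torus_charE /phase /= !mul0r addr0 mulr0 /expi cos0 sin0. Qed.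

Lemma sq_integrable_trig_sum s a : sq_integrable (trig_sum s a).
Proof.
have b (z : R[i]) : bounded_measurable (fun x => cdot (trig_sum s a x) z).
  under eq_fun do rewrite cdot_suml; apply: bmeas_sum => k.
  have -> : (fun x => cdot (a k * torus_char k x) z) =
      (fun x => cdot (a k * torus_char k x) (z * torus_char (0, 0) x)).
    by apply/funext => x; rewrite torus_char0 mulr1.
  exact: bmeas_cdot_char.
apply: bmeas_sq_integrable.
- have := b 1; congr bounded_measurable; apply/funext => x.
  by rewrite /cdot /= mulr1 mulr0 addr0.
- have := b (Complex 0 1); congr bounded_measurable; apply/funext => x.
  by rewrite /cdot /= mulr1 mulr0 add0r.
Qed.

Lemma sqnB (z w : R[i]) : sqn (z - w) = sqn z - 2 * cdot z w + sqn w.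
Proof. by case: z w => [p q] [p' q']; rewrite /Defs.sqr_normc /cdot /=; ring. Qed.

Lemma sq_integrableB u v : sq_integrable u -> sq_integrable v ->
  sq_integrable (fun x => u x - v x).
Proof.
move=> su sv; have [ur ui iu] := su; have [vr vi iv] := sv.
have dr : measurable_fun setT (fun x => complex.Re (u x - v x)).
  under eq_fun do rewrite raddfB; exact: measurable_funB.
have di : measurable_fun setT (fun x => complex.Im (u x - v x)).
  under eq_fun do rewrite raddfB; exact: measurable_funB.
split => //; have mc := measurable_cell.
have iuv : leb2.-integrable cell (fun x => 2%:E * (sqn (u x))%:E + 2%:E * (sqn (v x))%:E)%E.
  apply: (@integrableD _ _ R leb2 cell) => //; exact: (@integrableZl _ _ R leb2 cell _ 2).
apply: le_integrable iuv => //.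
  by apply/measurable_EFinP; apply: measurable_funTS; exact: measurable_sqn.
move=> x _ /=; rewrite lee_fin [leLHS]ger0_norm ?sqn_ge0//.
rewrite [leRHS]ger0_norm ?sqn_sub_le//.
by have := sqn_ge0 (u x); have := sqn_ge0 (v x); lra.
Qed.

Lemma norm2B u v : sq_integrable u -> sq_integrable v ->
  norm2 (fun x => u x - v x) = norm2 u - 2 * inner u v + norm2 v.
Proof.
move=> su sv; have [ur ui iu] := su; have [vr vi iv] := sv.
have iuv := integrable_cdot su sv; have mc := measurable_cell.
rewrite /norm2; under eq_Rintegral do rewrite sqnB.
have i2 : leb2.-integrable cell (EFin \o (fun x => 2 * cdot (u x) (v x))).
  exact: (@integrableZl _ _ R leb2 cell mc 2 _ iuv).
rewrite RintegralD//; last first.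
  exact: (@integrableB _ _ R leb2 cell mc _ _ iu i2).
by rewrite RintegralB// RintegralZl.
Qed.

Lemma cdot_conj (z w e : R[i]) : cdot z (w * e) =
  complex.Re (z * e^*%C) * complex.Re w + complex.Im (z * e^*%C) * complex.Im w.
Proof. by case: z w e => [p q] [p' q'] [r t]; rewrite /cdot /=; ring. Qed.

(** Letting [z] vary recovers the complex coefficient by [cdot_inj]; identities between coefficients
    thus follow from the linearity of real integrals. *)
Lemma inner_char u k (z : R[i]) : sq_integrable u ->
  inner u (fun x => z * torus_char k x) = cdot (fourier_coef u k) z.
Proof.
move=> su; have mc := measurable_cell.
have i1 (w : R[i]) : leb2.-integrable cell (EFin \o (fun x => cdot (u x) (w * torus_char k x))).
  apply: integrable_cdot => //.
  have := sq_integrable_trig_sum [:: k] (fun=> w); congr sq_integrable.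
  by apply/funext => x; rewrite /trig_sum big_seq1.
have ir : leb2.-integrable cell (EFin \o (fun x => complex.Re (u x * (torus_char k x)^*%C))).
  have := i1 1; congr (leb2.-integrable cell _); apply/funext => x /=.
  by rewrite cdot_conj /= mulr1 mulr0 addr0.
have ii : leb2.-integrable cell (EFin \o (fun x => complex.Im (u x * (torus_char k x)^*%C))).
  have := i1 (Complex 0 1); congr (leb2.-integrable cell _); apply/funext => x /=.
  by rewrite cdot_conj /= mulr1 mulr0 add0r.
rewrite /inner; under eq_Rintegral do rewrite cdot_conj.
rewrite RintegralD// ?RintegralZr//.
- exact: (@integrableZr _ _ R leb2 cell mc (complex.Re z) _ ir).
- exact: (@integrableZr _ _ R leb2 cell mc (complex.Im z) _ ii).
Qed.

Lemma inner_trig_sum u s a : sq_integrable u ->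
  inner u (trig_sum s a) = \sum_(k <- s) cdot (fourier_coef u k) (a k).
Proof.
move=> su; have mc := measurable_cell.
have i1 k t : leb2.-integrable cell (EFin \o (fun x => cdot (u x) (trig_sum t a x))).
  by apply: integrable_cdot => //; exact: sq_integrable_trig_sum.
elim: s => [|k s IH].
  rewrite big_nil /inner; under eq_Rintegral do rewrite /trig_sum big_nil cdotC cdot0z.
  by rewrite Rintegral_cst// mul0r.
rewrite big_cons -IH -inner_char// /inner -RintegralD//.
- by apply: eq_Rintegral => x _; rewrite /trig_sum big_cons cdotC cdotDl !(cdotC _ (u x)).
- have := i1 k [:: k]; congr (leb2.-integrable cell _); apply/funext => x /=.
  by rewrite /trig_sum big_seq1.
- exact: (i1 k s).
Qed.

Lemma norm2_trig_sum s a : uniq s -> norm2 (trig_sum s a) = \sum_(k <- s) sqn (a k).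
Proof.
move=> us; rewrite /norm2 torus_cell_box -/(box_energy _ _ _ _) box_energyE//.
rewrite !big_seq; apply: eq_bigr => k ks.
rewrite (bigD1_seq k)//= big1 ?addr0.
  by rewrite !subrr dker0 expr1n mul1r cdotzz sqnM sqn_torus_char mulr1.
move=> l lk; rewrite -Rintegral_box_cdot_char// -torus_cell_box.
by rewrite Rintegral_cell_cdot_char eq_sym (negbTE lk) mul0r.
Qed.

(** Kept as an identity: its sign gives Bessel's inequality, and its value is the truncation error
    charged against the observed energy. *)
Lemma bessel_identity u s : sq_integrable u -> uniq s ->
  norm2 (fun x => u x - trig_sum s (fourier_coef u) x) =
  norm2 u - \sum_(k <- s) sqn (fourier_coef u k).
Proof.
move=> su us; rewrite norm2B//; last exact: sq_integrable_trig_sum.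
rewrite inner_trig_sum// norm2_trig_sum//.
under eq_bigr do rewrite cdotzz; ring.
Qed.

Lemma bessel_le u k : sq_integrable u -> sqn (fourier_coef u k) <= norm2 u.
Proof.
move=> su; rewrite -subr_ge0; have := @bessel_identity u [:: k] su isT.
by rewrite big_seq1 => <-; exact: norm2_ge0.
Qed.

Lemma cdot_inj (z w : R[i]) : (forall t, cdot z t = cdot w t) -> z = w.
Proof.
case: z w => [p q] [p' q'] h; have := h 1; have := h (Complex 0 1).
by rewrite /cdot /= !mulr1 !mulr0 !addr0 !add0r => -> ->.
Qed.

Lemma fourier_coefB u v k : sq_integrable u -> sq_integrable v ->
  fourier_coef (fun x => u x - v x) k = fourier_coef u k - fourier_coef v k.
Proof.
move=> su sv; apply: cdot_inj => t.
have cB (z1 z2 z : R[i]) : cdot (z1 - z2) z = cdot z1 z - cdot z2 z.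
  by case: z1 z2 z => [p q] [p' q'] [r r']; rewrite /cdot /=; ring.
have st : sq_integrable (fun x => t * torus_char k x).
  have := sq_integrable_trig_sum [:: k] (fun=> t); congr sq_integrable.
  by apply/funext => x; rewrite /trig_sum big_seq1.
rewrite cB -!inner_char//; last exact: sq_integrableB.
rewrite /inner -RintegralB//; [|exact: measurable_cell|exact: integrable_cdot|exact: integrable_cdot].
by apply: eq_Rintegral => x _; rewrite cB.
Qed.

Lemma fourier_coef_trig_sum s a k : uniq s ->
  fourier_coef (trig_sum s a) k = if k \in s then a k else 0.
Proof.
move=> us; apply: cdot_inj => t; rewrite -inner_char; last exact: sq_integrable_trig_sum.
have mc := measurable_cell; have cl := cell_lty.
rewrite /inner; under eq_Rintegral do rewrite cdot_suml.
rewrite Rintegral_bmeas_sum//; last by move=> l; exact: bmeas_cdot_char.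
under eq_bigr do rewrite Rintegral_cell_cdot_char.
case: ifP => ks.
  rewrite (bigD1_seq k)//= eqxx mul1r big1 ?addr0// => l lk.
  by rewrite (negbTE lk) mul0r.
rewrite cdot0z big_seq big1// => l ls; case: eqP => [lk|]; last by rewrite mul0r.
by rewrite -lk ls in ks.
Qed.

End SquareIntegrable.

(** * Multipliers of functions with vanishing moments *)

Section Totality.
Variable R : realType.
Implicit Types (x : R * R) (k l : int * int) (V h : R * R -> R).

Local Notation leb2 := (@lebesgue_measure R \x @lebesgue_measure R)%E.
Local Notation cell := (@torus_cell R).

Lemma mulrn_expr_le (z : R) (n : nat) : 0 <= z <= 1 ->
  n%:R * z ^+ n * (1 - z) <= 1 - z ^+ n.
Proof.
move=> /andP[z0 z1]; elim: n => [|n IH]; first by rewrite !mul0r expr0 subrr.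
have p : 0 <= z ^+ n by rewrite exprn_ge0.
have p1 : z ^+ n <= 1 by rewrite exprn_ile1.
rewrite -[n.+1%:R]natr1 exprS; set t := z ^+ n in IH p p1 *.
have h1 : 0 <= z * (1 - t - n%:R * t * (1 - z)).
  by rewrite mulr_ge0// subr_ge0.
have h2 : 0 <= (1 - z) * (1 - z * t).
  by rewrite mulr_ge0 ?subr_ge0// mulr_ile1.
nra.
Qed.

(** Half of the decay pays for the factor [n]: if [z = sqrt y], then [n z^n] is bounded by the
    geometric sum [1 / (1 - z)], and another [z^n] remains. *)
Lemma cvg_mulrn_expr (y : R) : 0 <= y < 1 -> (fun n => n%:R * y ^+ n) @ \oo --> (0 : R).
Proof.
move=> /andP[y0 y1]; pose z := Num.sqrt y.
have z0 : 0 <= z by exact: sqrtr_ge0.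
have zy : z ^+ 2 = y by rewrite sqr_sqrtr.
have z1 : z < 1 by rewrite -(@ltr_pXn2r _ 2) ?nnegrE// expr1n zy.
have c : (fun n => (1 - z)^-1 * z ^+ n) @ \oo --> (0 : R).
  rewrite -(mulr0 (1 - z)^-1); apply: cvgMr; apply: cvg_expr.
  by rewrite ger0_norm.
apply: (squeeze_cvgr _ (cvg_cst (0 : R)) c); apply: nearW => n.
rewrite mulr_ge0 ?exprn_ge0//= -zy -exprM mulnC exprM.
have z1' : 0 < 1 - z by rewrite subr_gt0.
rewrite ler_pdivlMl// mulrA expr2 mulrA ler_piMl ?exprn_ge0//.
have := @mulrn_expr_le z n; rewrite z0 (ltW z1) => /(_ isT) h.
have := exprn_ge0 n z0; lra.
Qed.

Lemma bernoulli_ineq (t : R) (n : nat) : 0 <= t <= 1 -> 1 - n%:R * t <= (1 - t) ^+ n.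
Proof.
move=> /andP[t0 t1]; elim: n => [|n IH]; first by rewrite mul0r subr0 expr0.
have h : 0 <= (1 - t) * ((1 - t) ^+ n - (1 - n%:R * t)) by rewrite mulr_ge0 ?subr_ge0.
have h2 : 0 <= n%:R * t ^+ 2 by rewrite mulr_ge0 ?exprn_ge0.
rewrite -[n.+1%:R]natr1 exprS; nra.
Qed.

(** The polynomials of the elementary proofs of Weierstrass' theorem. Below [1/2] Bernoulli's
    inequality keeps them near 1, as [n (2 t)^n] tends to 0; from [1/2] on they are at most
    [exp (- n (2 t)^n)]. The factor [n] in the exponent forces the limit 0 at [t = 1/2] itself. *)
Lemma cvg_step (t : R) : 0 <= t <= 1 ->
  (fun n => (1 - t ^+ n) ^+ (n * 2 ^ n)) @ \oo --> ((t < 2^-1)%R%:R : R).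
Proof.
move=> /andP[t0 t1].
have tn n : 0 <= t ^+ n <= 1 by rewrite exprn_ge0//= exprn_ile1.
have b0 n : 0 <= 1 - t ^+ n by rewrite subr_ge0; case/andP: (tn n).
have b1 n : 1 - t ^+ n <= 1 by rewrite gerBl; case/andP: (tn n).
have [th|th] := ltP t 2^-1.
  have y01 : 0 <= 2 * t < 1 by rewrite mulr_ge0//= mulrC -ltr_pdivlMr// mul1r.
  have c : (fun n => 1 - n%:R * (2 * t) ^+ n) @ \oo --> (1 : R).
    by rewrite -[X in _ --> X]subr0; apply: cvgB; [exact: cvg_cst|exact: cvg_mulrn_expr].
  apply: (squeeze_cvgr _ c (cvg_cst (1 : R))); apply: nearW => n.
  rewrite exprn_ile1//= andbT; apply: le_trans (bernoulli_ineq (n * 2 ^ n) (tn n)).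
  by rewrite natrM natrX exprMn mulrA.
have c : harmonic @ \oo --> (0 : R) by exact: cvg_harmonic.
apply: (squeeze_cvgr _ (cvg_cst (0 : R)) c); apply: nearW => n.
rewrite exprn_ge0//=.
apply: (@le_trans _ _ (expR (- t ^+ n) ^+ (n * 2 ^ n))).
  by rewrite lerXn2r ?nnegrE ?expR_ge0// expR_ge1Dx.
rewrite -expRM_natl mulrN expRN lef_pV2 ?posrE ?expR_gt0//.
apply: le_trans (expR_ge1Dx _); rewrite -natr1 addrC lerD2l natrM -mulrA.
rewrite ler_peMr// natrX -exprMn exprn_ege1//.
by rewrite -ler_pdivrMl// mulr1.
Qed.

(** The free phase [c] covers the cosine and the sine of each frequency, so this says that all
    Fourier coefficients of the real function [V] vanish. *)
Definition null_moments V :=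
  leb2.-integrable cell (EFin \o V) /\
  forall k (c : R), \int[leb2]_(x in cell) (V x * cos (phase k x + c)) = 0.

(* Multipliers form an algebra that contains the trigonometric polynomials and is
   closed under bounded pointwise limits, hence contains all indicators. *)
Definition multiplier h := bounded_measurable h /\
  forall V, null_moments V -> null_moments (fun x => h x * V x).

Lemma bmeas_integrableM h V : bounded_measurable h -> leb2.-integrable cell (EFin \o V) ->
  leb2.-integrable cell (EFin \o (fun x => h x * V x)).
Proof.
move=> [mh [M hM]] iV; apply: (@integrableMr _ _ R leb2 cell _ h (EFin \o V)) => //.
- exact: measurable_cell.
- exact: measurable_funTS.
- exists M; split; first exact: num_real.
  by move=> y My x _; exact: le_trans (hM x) (ltW My).
Qed.

Lemma bmeas_phase k (c : R) : bounded_measurable (fun x => cos (phase k x + c)).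
Proof. exact: bmeas_cos. Qed.

Lemma integrable_moment V k (c : R) : leb2.-integrable cell (EFin \o V) ->
  leb2.-integrable cell (EFin \o (fun x => V x * cos (phase k x + c))).
Proof.
move=> iV; have := bmeas_integrableM (bmeas_phase k c) iV.
by congr (leb2.-integrable cell _); apply/funext => x /=; rewrite mulrC.
Qed.

Lemma multiplier_cst (c : R) : multiplier (fun=> c).
Proof.
split=> [|V [iV V0]]; first exact: bmeas_cst.
split=> [|k d]; first by apply: bmeas_integrableM => //; exact: bmeas_cst.
under eq_Rintegral do rewrite -mulrA.
rewrite RintegralZl ?V0 ?mulr0//; [exact: measurable_cell|exact: integrable_moment].
Qed.

Lemma multiplierD h h' : multiplier h -> multiplier h' -> multiplier (fun x => h x + h' x).
Proof.
move=> [bh mh] [bh' mh']; split=> [|V nV]; first exact: bmeasD.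
have [iV _] := nV; have [ih h0] := mh _ nV; have [ih' h0'] := mh' _ nV.
split=> [|k d]; first by apply: bmeas_integrableM => //; exact: bmeasD.
under eq_Rintegral do rewrite !mulrDl.
rewrite RintegralD ?h0 ?h0' ?addr0//; first exact: measurable_cell.
  exact: integrable_moment.
exact: integrable_moment.
Qed.

Lemma multiplierM h h' : multiplier h -> multiplier h' -> multiplier (fun x => h x * h' x).
Proof.
move=> [bh mh] [bh' mh']; split=> [|V nV]; first exact: bmeasM.
have := mh _ (mh' _ nV); congr null_moments.
by apply/funext => x; rewrite mulrA.
Qed.

Lemma multiplierX h (n : nat) : multiplier h -> multiplier (fun x => h x ^+ n).
Proof.
move=> mh; elim: n => [|n IH]; first exact: multiplier_cst.
by under eq_fun do rewrite exprS; exact: multiplierM.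
Qed.

Lemma multiplier_cos k (c : R) : multiplier (fun x => cos (phase k x + c)).
Proof.
split=> [|V [iV V0]]; first exact: bmeas_phase.
have bi := bmeas_integrableM (bmeas_phase k c) iV; split=> // l d.
have mc := @measurable_cell R.
pose p := (k.1 + l.1, k.2 + l.2); pose m := (k.1 - l.1, k.2 - l.2).
transitivity (\int[leb2]_(x in cell) (2^-1 * (V x * cos (phase p x + (c + d))) +
                                      2^-1 * (V x * cos (phase m x + (c - d))))).
  apply: eq_Rintegral => x _.
  have -> : phase p x + (c + d) = (phase k x + c) + (phase l x + d).
    by rewrite /phase /= !intrD; ring.
  have -> : phase m x + (c - d) = (phase k x + c) - (phase l x + d).
    by rewrite /phase /= !intrB; ring.
  by set A := phase k x + c; set B := phase l x + d; rewrite (cosD A) (cosB A); field.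
have iZ (q : int * int) (e : R) : leb2.-integrable cell
    (EFin \o (fun x => 2^-1 * (V x * cos (phase q x + e)))).
  exact: (@integrableZl _ _ R leb2 cell mc 2^-1 _ (integrable_moment q e iV)).
rewrite RintegralD//; try exact: iZ.
by rewrite !RintegralZl ?V0 ?mulr0 ?addr0//; exact: integrable_moment.
Qed.

Lemma Rintegral_lim0 (f_ : nat -> R * R -> R) (f g : R * R -> R) :
  (forall n, measurable_fun cell (f_ n)) -> (forall x, f_ n x @[n --> \oo] --> f x) ->
  leb2.-integrable cell (EFin \o g) -> (forall n x, `|f_ n x| <= g x) ->
  (forall n, \int[leb2]_(x in cell) f_ n x = 0) -> \int[leb2]_(x in cell) f x = 0.
Proof.
move=> mf ff ig fg f0; have mc := @measurable_cell R.
have if_ n : leb2.-integrable cell (EFin \o f_ n).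
  apply: le_integrable ig => //; first by apply: measurableT_comp; [exact: EFin_measurable|exact: mf].
  by move=> x _ /=; rewrite lee_fin (le_trans (fg n x))// ler_norm.
have mflim : measurable_fun cell f.
  by apply: (measurable_fun_cvg mf) => x _; exact: ff.
have ffE x : (f_ n x)%:E @[n --> \oo] --> (f x)%:E.
  by apply: cvg_EFin; [exact: nearW|exact: ff].
have [|||||_ _] := @dominated_convergence _ _ R leb2 cell mc (fun n => EFin \o f_ n) (EFin \o f)
  (EFin \o g).
- by move=> n; apply: measurableT_comp; [exact: EFin_measurable|exact: mf].
- by apply: measurableT_comp; [exact: EFin_measurable|exact: mflim].
- by apply: aeW => x _; exact: ffE.
- exact: ig.
- by apply: aeW => x n _; rewrite lee_fin; exact: fg.
have -> : [sequence (\int[leb2]_(x in cell) (EFin \o f_ n) x)%E]_n = cst 0%E.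
  apply/funext => n /=; have := f0 n; rewrite /Rintegral.
  have := @integrable_fin_num _ _ R leb2 cell mc _ (if_ n); case: integral => //= r _ ->//.
move=> cv; rewrite /Rintegral.
have -> : (\int[leb2]_(x in cell) (f x)%:E)%E = 0%E.
  by apply: (cvg_unique _ cv); [exact: ereal_hausdorff|exact: cvg_cst].
by [].
Qed.

Lemma multiplier_lim (h_ : nat -> R * R -> R) h (M : R) :
  (forall n, multiplier (h_ n)) -> (forall n x, `|h_ n x| <= M) ->
  (forall x, h_ n x @[n --> \oo] --> h x) -> multiplier h.
Proof.
move=> mh hM hh.
have bh : bounded_measurable h.
  split; first by apply: (measurable_fun_cvg (h := h_)) => [n|x _]; [case: (mh n) => [[]]|exact: hh].
  exists M => x; have cn : `|h_ n x| @[n --> \oo] --> `|h x| by exact: cvg_norm.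
  by rewrite -(cvg_lim _ cn)//; apply: limr_le; [exact: cvgP cn|exact: nearW].
split=> // V nV; have [iV _] := nV; split=> [|k c]; first exact: bmeas_integrableM.
apply: (@Rintegral_lim0 (fun n x => h_ n x * V x * cos (phase k x + c)) _
  (fun x => M * `|V x|)).
- move=> n; have [bn mn] := mh n; have [i1 _] := mn _ nV.
  by have /integrableP[/measurable_EFinP] := integrable_moment k c i1.
- by move=> x; apply: cvgMl; apply: cvgMl; exact: hh.
- have iVn : leb2.-integrable cell (EFin \o (fun x => `|V x|)) by exact: integrable_norm.
  exact: (@integrableZl _ _ R leb2 cell (@measurable_cell R) M _ iVn).
- move=> n x; rewrite !normrM -[leRHS]mulr1 ler_pM ?mulr_ge0//.
    by rewrite ler_wpM2r.
  exact: cos_max.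
- by move=> n; have [bn mn] := mh n; have [] := mn _ nV.
Qed.

(** Moments are integrals over the cell, so a multiplier may be modified outside it; indicators of
    sets in the plane become accessible to periodic polynomials. *)
Lemma multiplier_eq h h' : multiplier h -> bounded_measurable h' ->
  {in cell, h =1 h'} -> multiplier h'.
Proof.
move=> [bh mh] bh' hh'; split=> // V nV; have [iV _] := nV; have [ih h0] := mh _ nV.
split=> [|k c]; first exact: bmeas_integrableM.
by rewrite -(h0 k c); apply: eq_Rintegral => x xc; rewrite hh'.
Qed.

Lemma multiplier_step h : multiplier h -> (forall x, 0 <= h x <= 1) ->
  multiplier (fun x => (h x < 2^-1)%R%:R).
Proof.
move=> mh h01; apply: (@multiplier_lim (fun n x => (1 - h x ^+ n) ^+ (n * 2 ^ n)) _ 1).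
- move=> n; apply: multiplierX; apply: multiplierD; first exact: multiplier_cst.
  have := multiplierM (multiplier_cst (- 1)) (multiplierX n mh).
  by congr multiplier; apply/funext => x; rewrite mulN1r.
- move=> n x; have /andP[h0 h1] := h01 x.
  have p0 : 0 <= h x ^+ n by rewrite exprn_ge0.
  have p1 : h x ^+ n <= 1 by rewrite exprn_ile1.
  by rewrite ger0_norm ?exprn_ge0 ?exprn_ile1 ?subr_ge0 ?gerBl.
- by move=> x; exact: cvg_step.
Qed.

Lemma bmeas_indic (E : set (R * R)) : measurable E -> bounded_measurable (\1_E : R * R -> R).
Proof.
move=> mE; split; first exact: measurable_indic.
by exists 1 => x; rewrite indicE ger0_norm ?lern1 ?leq_b1.
Qed.

End Totality.

(** * Indicators of measurable sets, and uniqueness of Fourier coefficients *)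

Section TotalitySets.
Variable R : realType.
Implicit Types (x : R * R) (k l : int * int) (V h : R * R -> R) (E : set (R * R)).

Local Notation leb2 := (@lebesgue_measure R \x @lebesgue_measure R)%E.
Local Notation cell := (@torus_cell R).

Definition multiplier_set E := measurable E /\ multiplier (\1_E : R * R -> R).

Lemma multiplier_set0 : multiplier_set set0.
Proof.
split=> //; have := @multiplier_cst R 0; congr multiplier.
by apply/funext => x; rewrite indicE in_set0.
Qed.

Lemma multiplier_setC E : multiplier_set E -> multiplier_set (~` E).
Proof.
move=> [mE hE]; split; first exact: measurableC.
have := multiplierD (multiplier_cst 1) (multiplierM (multiplier_cst (- 1)) hE).
congr multiplier; apply/funext => x; rewrite !indicE in_setC.
by case: (x \in E) => /=; rewrite ?mulr1 ?mulr0 ?subrr ?addr0.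
Qed.

Lemma multiplier_setI E E' : multiplier_set E -> multiplier_set E' ->
  multiplier_set (E `&` E').
Proof.
move=> [mE hE] [mE' hE']; split; first exact: measurableI.
have := multiplierM hE hE'; congr multiplier; apply/funext => x.
by rewrite !indicE in_setI -natrM mulnb.
Qed.

Lemma multiplier_setU E E' : multiplier_set E -> multiplier_set E' ->
  multiplier_set (E `|` E').
Proof.
move=> hE hE'; rewrite -[E `|` E']setCK setCU.
by apply: multiplier_setC; apply: multiplier_setI; exact: multiplier_setC.
Qed.

Lemma multiplier_bigcup (F : (set (R * R))^nat) : (forall n, multiplier_set (F n)) ->
  multiplier_set (\bigcup_n F n).
Proof.
move=> hF; have mF n : measurable (F n) by case: (hF n).
split; first exact: bigcupT_measurable.
pose G n := \big[setU/set0]_(i < n) F i.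
have hG n : multiplier_set (G n).
  elim: n => [|n IH]; first by rewrite /G big_ord0; exact: multiplier_set0.
  by rewrite /G big_ord_recr /=; exact: multiplier_setU.
apply: (@multiplier_lim R (fun n => \1_(G n)) _ 1).
- by move=> n; case: (hG n).
- by move=> n x; rewrite indicE ger0_norm ?lern1 ?leq_b1.
move=> x; have [[N _ FNx]|nF] := pselect ((\bigcup_n F n) x).
  rewrite [X in _ --> X]indicE mem_set; last by exists N.
  apply: cvg_near_cst; near=> n; rewrite indicE mem_set// /G -bigcup_mkord.
  by exists N => //=; near: n; exact: nbhs_infty_gt.
rewrite [X in _ --> X]indicE memNset//; apply: cvg_near_cst; apply: nearW => n.
rewrite indicE memNset// /G -bigcup_mkord => -[i _ Fix].
by apply: nF; exists i.
Unshelve. all: by end_near.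
Qed.

(* [2 sin (pi t) sin (pi (t - a))] is a trigonometric polynomial in [t] which on
   [[0, 1[] is positive exactly when [a < t]. *)
Lemma cos_gap_gt0 (a t : R) : 0 <= a < 1 -> 0 <= t < 1 ->
  (0 < cos (pi * a) - cos (2 * pi * t - pi * a)) = (a < t).
Proof.
move=> /andP[a0 a1] /andP[t0 t1]; have p0 := @pi_gt0 R.
have -> : cos (pi * a) - cos (2 * pi * t - pi * a) =
    2 * (sin (pi * t) * sin (pi * (t - a))).
  have -> : pi * a = pi * t - pi * (t - a) by ring.
  have -> : 2 * pi * t - (pi * t - pi * (t - a)) = pi * t + pi * (t - a) by ring.
  by rewrite cosB cosD; ring.
have st (u : R) : 0 < u < 1 -> 0 < sin (pi * u).
  move=> /andP[u0 u1]; apply: sin_gt0_pi; rewrite mulr_gt0//=.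
  by rewrite -[ltRHS]mulr1 ltr_pM2l.
have [a_t|t_a] := ltP a t.
  rewrite !mulr_gt0 ?st//; last by apply/andP; split; lra.
  by apply/andP; split; lra.
apply/negbTE; rewrite -leNgt; move: t0; rewrite le_eqVlt => /predU1P[<-|t0].
  by rewrite mulr0 sin0 mul0r mulr0.
move: t_a; rewrite le_eqVlt => /predU1P[->|t_a].
  by rewrite subrr mulr0 sin0 !mulr0.
have h1 := st t; have h2 := st (a - t); rewrite -opprB mulrN sinN mulrN mulrN oppr_le0.
rewrite ltW// !mulr_gt0// ?h1 ?h2//; apply/andP; split; lra.
Qed.

Lemma multiplier_coordinate_ray (p : R * R -> R) k (a : R) :
  measurable_fun setT p ->
  (forall x, cell x -> 0 <= p x < 1 /\ phase k x = 2 * pi * p x) ->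
  multiplier_set (p @^-1` `]a, +oo[).
Proof.
move=> mp pk.
have mP : measurable (p @^-1` `]a, +oo[).
  by rewrite -[X in measurable X]setTI; exact: mp.
split=> //; have b1 := bmeas_indic mP.
have [a0|a0] := ltP a 0.
  apply: (multiplier_eq (multiplier_cst 1)) => // x /set_mem/pk[/andP[x0 x1] _].
  by rewrite indicE mem_set//= in_itv /= (lt_le_trans a0).
have [a1|a1] := leP 1 a.
  apply: (multiplier_eq (multiplier_cst 0)) => // x /set_mem/pk[/andP[x0 x1] _].
  by rewrite indicE memNset//= in_itv /= andbT => h; have := lt_trans h x1; rewrite ltNge a1.
(* The gap of [cos_gap_gt0] lies in [[-2, 2]]; rescaled, it has values in [[0, 1]] and falls below
   [1/2] exactly where the gap is positive. *)
pose q x : R := 2^-1 - 4^-1 * (cos (pi * a) - cos (phase k x + - (pi * a))).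
have mq : multiplier q.
  have m1 := multiplierM (multiplier_cst 4^-1) (multiplier_cos k (- (pi * a))).
  have := multiplierD (multiplier_cst (2^-1 - 4^-1 * cos (pi * a))) m1.
  by congr multiplier; apply/funext => x; rewrite /q; ring.
apply: multiplier_eq (multiplier_step mq _) b1 _ => [x|x /set_mem xc].
  have := cos_le1 (pi * a); have := cos_geN1 (pi * a).
  have := cos_le1 (phase k x + - (pi * a)); have := cos_geN1 (phase k x + - (pi * a)).
  by rewrite /q => *; apply/andP; split; lra.
have [p01 pE] := pk x xc; rewrite indicE /q pE.
have a01 : 0 <= a < 1 by rewrite a0.
rewrite gtrBl pmulr_rgt0 ?invr_gt0// cos_gap_gt0//.
congr ((nat_of_bool _)%:R); apply/idP/idP => [h|/set_mem] /=; last by rewrite in_itv /= andbT.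
by rewrite mem_set//= in_itv /= andbT.
Qed.

Lemma multiplier_coordinate (p : R * R -> R) k (A : set R) :
  measurable_fun setT p ->
  (forall x, cell x -> 0 <= p x < 1 /\ phase k x = 2 * pi * p x) ->
  measurable A -> multiplier_set (p @^-1` A).
Proof.
move=> mp pk mA.
have mA' : <<s @RGenOInfty.G R >> A.
  have e := congr1 (fun S : set (set R) => S A) (RGenOInfty.measurableE R).
  exact: (eq_ind _ (fun P => P) mA _ e).
apply: (smallest_sub (X := [set A | multiplier_set (p @^-1` A)]) _ _ mA').
  split=> /=; first by rewrite preimage_set0; exact: multiplier_set0.
    by move=> B hB; rewrite setTD preimage_setC; exact: multiplier_setC.
  by move=> F hF; rewrite preimage_bigcup; exact: multiplier_bigcup.
by move=> _ [a ->]; exact: multiplier_coordinate_ray pk.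
Qed.

Lemma multiplier_measurable E : measurable E -> multiplier_set E.
Proof.
move=> mE; have mE' : <<s [set A `*` B | A in @measurable _ R & B in @measurable _ R] >> E.
  have e := congr1 (fun S : set (set (R * R)) => S E) (@measurable_prod_measurableType _ _ R R).
  exact: (eq_ind _ (fun P => P) mE _ e).
have c1 x : cell x -> 0 <= x.1 < 1 /\ phase (1, 0) x = 2 * pi * x.1.
  move=> [] /=; rewrite !in_itv /= => h1 h2; split => //.
  by rewrite /phase /= mul1r mul0r addr0.
have c2 x : cell x -> 0 <= x.2 < 1 /\ phase (0, 1) x = 2 * pi * x.2.
  move=> [] /=; rewrite !in_itv /= => h1 h2; split => //.
  by rewrite /phase /= mul1r mul0r add0r.
apply: (smallest_sub (X := [set E | multiplier_set E]) _ _ mE').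
  split=> /=; first exact: multiplier_set0.
    by move=> B hB; rewrite setTD; exact: multiplier_setC.
  exact: multiplier_bigcup.
move=> _ [A mA [B mB <-]] /=.
have -> : A `*` B = (fst @^-1` A) `&` (snd @^-1` B) by [].
apply: multiplier_setI.
  exact: multiplier_coordinate measurable_fst c1 mA.
exact: multiplier_coordinate measurable_snd c2 mB.
Qed.

(** Multiplying by the indicators of [V >= 0] and of its complement preserves null moments; the
    moments of frequency 0 then say that [|V|] has integral 0. *)
Lemma null_moments_ae_eq0 V : measurable_fun setT V -> null_moments V ->
  ae_eq leb2 cell (EFin \o V) (cst 0%E).
Proof.
move=> mV nV; have [iV _] := nV; have mc := @measurable_cell R.
pose P := [set x | 0 <= V x].
have mP : measurable P.
  have -> : P = V @^-1` `[0, +oo[ by apply/seteqP; split => x /=; rewrite in_itv /= andbT.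
  by rewrite -[X in measurable X]setTI; exact: mV.
have zero E : measurable E -> \int[leb2]_(x in cell) (\1_E x * V x) = 0.
  move=> mE; have [_ [_ hm]] := multiplier_measurable mE; have [_ /(_ (0, 0) 0)] := hm _ nV.
  by under eq_Rintegral do rewrite /phase /= !mul0r !addr0 mulr0 cos0 mulr1.
apply/(ae_eq_integral_abs leb2 mc); first by apply/measurable_EFinP; exact: measurable_funTS.
have i1 E : measurable E -> leb2.-integrable cell (EFin \o (fun x => \1_E x * V x)).
  by move=> mE; apply: bmeas_integrableM => //; exact: bmeas_indic.
have -> : (\int[leb2]_(x in cell) `|(EFin \o V) x|)%E =
    (\int[leb2]_(x in cell) ((\1_P x * V x) - (\1_(~` P) x * V x))%:E)%E.
  apply: eq_integral => x _ /=; congr (_%:E); rewrite !indicE in_setC.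
  have [h|h] := leP 0 (V x).
    by rewrite (mem_set (h : P x)) ger0_norm//= mul1r mul0r subr0.
  rewrite memNset /= ?mul0r ?mul1r ?sub0r ?ltr0_norm//.
  by rewrite /P /=; apply/negP; rewrite -ltNge.
have mCP : measurable (~` P) by exact: measurableC.
have := @RintegralB _ _ R leb2 cell _ _ mc (i1 _ mP) (i1 _ mCP).
rewrite !zero// subr0 /Rintegral.
have iB := @integrableB _ _ R leb2 cell mc _ _ (i1 _ mP) (i1 _ mCP).
have := @integrable_fin_num _ _ R leb2 cell mc _ iB.
rewrite (_ : (\int[leb2]_(x in cell) _)%E = (\int[leb2]_(x in cell)
  ((\1_P x * V x) - (\1_(~` P) x * V x))%:E)%E)//.
by case: integral => //= r _ ->.
Qed.

Lemma norm2_eq (u v : R * R -> R[i]) : sq_integrable u -> sq_integrable v ->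
  (forall k, fourier_coef u k = fourier_coef v k) -> norm2 u = norm2 v.
Proof.
move=> su sv uv; pose w x := u x - v x.
have sw : sq_integrable w by exact: sq_integrableB.
have w0 k : fourier_coef w k = 0 by rewrite fourier_coefB// uv subrr.
have mc := @measurable_cell R.
have [ur ui iu] := su; have [vr vi iv] := sv; have [wr wi iw] := sw.
have i_w (z : R[i]) k : leb2.-integrable cell (EFin \o (fun x => cdot (w x) (z * torus_char k x))).
  apply: integrable_cdot => //.
  have := sq_integrable_trig_sum [:: k] (fun=> z); congr sq_integrable.
  by apply/funext => x; rewrite /trig_sum big_seq1.
have z0 (z : R[i]) k : \int[leb2]_(x in cell) cdot (w x) (z * torus_char k x) = 0.
  by have := inner_char k z sw; rewrite w0 cdot0z.
have iRe : leb2.-integrable cell (EFin \o (fun x => complex.Re (w x))).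
  have := i_w 1 (0, 0); congr (leb2.-integrable cell _); apply/funext => x /=.
  by rewrite torus_char0 mulr1 /cdot /= mulr1 mulr0 addr0.
have iIm : leb2.-integrable cell (EFin \o (fun x => complex.Im (w x))).
  have := i_w (Complex 0 1) (0, 0); congr (leb2.-integrable cell _); apply/funext => x /=.
  by rewrite torus_char0 mulr1 /cdot /= mulr1 mulr0 add0r.
(* A moment of the real part, or of the imaginary part, of [w] combines the coefficients of [w] at
   [k] and at [- k]. *)
pose opp k : int * int := (- k.1, - k.2).
have phN k x : phase (opp k) x = - phase k x by rewrite /phase /= !intrN; ring.
have momRe k (c : R) : \int[leb2]_(x in cell) (complex.Re (w x) * cos (phase k x + c)) = 0.
  transitivity (\int[leb2]_(x in cell)
     (2^-1 * cdot (w x) (expi c * torus_char k x) +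
      2^-1 * cdot (w x) (expi (- c) * torus_char (opp k) x))).
    apply: eq_Rintegral => x _; rewrite !torus_charE phN -!expiD -opprD addrC.
    by rewrite /cdot /expi /= cosN sinN (addrC c); field.
  rewrite RintegralD//.
  - by rewrite !RintegralZl ?z0 ?mulr0 ?addr0.
  - exact: (@integrableZl _ _ R leb2 cell mc 2^-1 _ (i_w _ _)).
  - exact: (@integrableZl _ _ R leb2 cell mc 2^-1 _ (i_w _ _)).
have momIm k (c : R) : \int[leb2]_(x in cell) (complex.Im (w x) * cos (phase k x + c)) = 0.
  transitivity (\int[leb2]_(x in cell)
     (2^-1 * cdot (w x) (Complex 0 1 * expi c * torus_char k x) +
      2^-1 * cdot (w x) (Complex 0 1 * expi (- c) * torus_char (opp k) x))).
    apply: eq_Rintegral => x _; rewrite !torus_charE phN -!mulrA -!expiD -opprD addrC.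
    by rewrite /cdot /expi /= cosN sinN (addrC c); field.
  rewrite RintegralD//.
  - by rewrite !RintegralZl ?z0 ?mulr0 ?addr0.
  - exact: (@integrableZl _ _ R leb2 cell mc 2^-1 _ (i_w _ _)).
  - exact: (@integrableZl _ _ R leb2 cell mc 2^-1 _ (i_w _ _)).
have aeR := null_moments_ae_eq0 wr (conj iRe momRe).
have aeI := null_moments_ae_eq0 wi (conj iIm momIm).
rewrite /norm2 /Rintegral; congr fine; apply: ae_eq_integral => //.
- by apply/measurable_EFinP; apply: measurable_funTS; exact: measurable_sqn.
- by apply/measurable_EFinP; apply: measurable_funTS; exact: measurable_sqn.
apply: filterS2 aeR aeI => x hR hI xc; congr (_%:E).
have [] := hR xc; have [] := hI xc; rewrite /w !raddfB => /eqP; rewrite subr_eq0 => /eqP eI.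
by move=> /eqP; rewrite subr_eq0 => /eqP eR; rewrite /Defs.sqr_normc eI eR.
Qed.

End TotalitySets.

(** * Fatou's lemma and almost everywhere convergence of partial sums *)

Section RieszFischer.
Variable R : realType.
Implicit Types (x : R * R) (k l : int * int) (s : seq (int * int))
  (u v w : R * R -> R[i]) (c : int * int -> R[i]).

Local Notation leb2 := (@lebesgue_measure R \x @lebesgue_measure R)%E.
Local Notation sqn := (@Defs.sqr_normc R).
Local Notation cell := (@torus_cell R).

Definition freq_range (N : nat) : seq int := [seq n%:Z - N%:Z | n <- iota 0 (N + N).+1].

Definition freq_box (N : nat) : seq (int * int) :=
  [seq (i, j) | i <- freq_range N, j <- freq_range N].

Lemma mem_freq_range (N : nat) (m : int) : (m \in freq_range N) = (`|m| <= N%:Z).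
Proof.
apply/mapP/idP => [[n + ->]|mN]; first by rewrite mem_iota; lia.
by exists `|(m + N%:Z)%R|%N; [rewrite mem_iota; lia|lia].
Qed.

Lemma mem_freq_box (N : nat) k : (k \in freq_box N) = (`|k.1| <= N%:Z) && (`|k.2| <= N%:Z).
Proof.
rewrite -!mem_freq_range; apply/allpairsP/andP => [[[i j] [/= hi hj ->]]//|[h1 h2]].
by exists k; split=> //; exact: surjective_pairing.
Qed.

Lemma freq_box_uniq (N : nat) : uniq (freq_box N).
Proof.
have ur : uniq (freq_range N) by rewrite map_inj_uniq ?iota_uniq// => m n; lia.
by apply: allpairs_uniq => // -[i j] [i' j'].
Qed.

Lemma freq_box_sum_le c (N N' : nat) : (N <= N')%N ->
  \sum_(k <- freq_box N) sqn (c k) <= \sum_(k <- freq_box N') sqn (c k).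
Proof.
move=> NN'; rewrite [leRHS](bigID [in freq_box N])/= -[leLHS]addr0 lerD ?sumr_ge0//; last first.
  by move=> k _; exact: sqn_ge0.
rewrite -[leRHS]big_filter le_eqVlt; apply/orP; left; apply/eqP/perm_big.
apply: uniq_perm; rewrite ?filter_uniq ?freq_box_uniq// => k.
rewrite mem_filter; apply/idP/andP => [kN|[]//]; split => //.
by move: kN; rewrite !mem_freq_box => /andP[h1 h2]; apply/andP; split; lia.
Qed.

Lemma limn_esup_le (u_ : (\bar R)^nat) (B : \bar R) : (forall n, (u_ n <= B)%E) ->
  (limn_esup u_ <= B)%E.
Proof.
move=> uB; rewrite limn_esup_lim; apply: lime_le; first exact: is_cvg_esups.
by apply: nearW => n; apply: ge_ereal_sup => _ [m _ <-].
Qed.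

Lemma ae_leb2_filter : Filter (almost_everywhere leb2).
Proof. exact: ae_filter_ringOfSetsType. Qed.

(** Serves twice: for the partial sums, to place the limit in L^2, and for their differences with a
    fixed one, to estimate the distance to the limit. *)
Lemma fatou_norm2 (w_ : nat -> R * R -> R[i]) w (B : R) :
  (forall j, sq_integrable (w_ j)) ->
  measurable_fun setT (fun x => complex.Re (w x)) ->
  measurable_fun setT (fun x => complex.Im (w x)) ->
  {ae leb2, forall x, cell x -> complex.Re (w_ j x) @[j --> \oo] --> complex.Re (w x) /\
                                complex.Im (w_ j x) @[j --> \oo] --> complex.Im (w x)} ->
  (forall j, norm2 (w_ j) <= B) -> sq_integrable w /\ norm2 w <= B.
Proof.
move=> sw mr mi ww wB; have mc := @measurable_cell R.
have mw : measurable_fun cell (EFin \o (fun x => sqn (w x))).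
  by apply/measurable_EFinP; apply: measurable_funTS; exact: measurable_sqn.
have mwj j : measurable_fun cell (EFin \o (fun x => sqn (w_ j x))).
  have [? ? _] := sw j.
  by apply/measurable_EFinP; apply: measurable_funTS; exact: measurable_sqn.
have ge0 (z : R[i]) : (0 <= (sqn z)%:E)%E by rewrite lee_fin sqn_ge0.
have ae : ae_eq leb2 cell (EFin \o (fun x => sqn (w x)))
    (fun x => limn_einf (fun j => (sqn (w_ j x))%:E)).
  have FF := ae_leb2_filter.
  apply: filterS ww => x h xc; have [cr ci] := h xc.
  have cs : (sqn (w_ j x))%:E @[j --> \oo] --> (sqn (w x))%:E.
    apply: cvg_EFin; first exact: nearW.
    by rewrite /Defs.sqr_normc; apply: cvgD; under eq_fun do rewrite expr2; rewrite expr2; exact: cvgM.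
  by have [-> _] := cvg_limn_einf_sup cs.
have mli : measurable_fun cell (fun x => limn_einf (fun j => (sqn (w_ j x))%:E)).
  rewrite (_ : (fun _ => _) = fun x => (- limn_esup (fun j => - (sqn (w_ j x))%:E))%E); last first.
    by apply/funext => x; rewrite (limn_esupN (fun j => (sqn (w_ j x))%:E)) oppeK.
  apply: measurableT_comp => //; apply: (measurable_fun_limn_esup (f := fun j x => (- (sqn (w_ j x))%:E)%E)) => j.
  by apply: measurableT_comp => //; exact: mwj.
have le : (\int[leb2]_(x in cell) (sqn (w x))%:E <= B%:E)%E.
  have -> : (\int[leb2]_(x in cell) (sqn (w x))%:E)%E =
      (\int[leb2]_(x in cell) limn_einf (fun j => (sqn (w_ j x))%:E))%E.
    apply: ge0_ae_eq_integral => //.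
    - move=> x _; rewrite limn_einf_lim; apply: lime_ge; first exact: is_cvg_einfs.
      by apply: nearW => n; apply: le_ereal_inf_tmp => _ [m _ <-].
  apply: (le_trans (@fatou _ _ R leb2 cell mc (fun j => EFin \o (fun x => sqn (w_ j x))) mwj
    (fun n x _ => ge0 _))).
  apply: le_trans (limn_einf_sup _) _; apply: limn_esup_le => j.
  rewrite -[leLHS]fineK; first by rewrite lee_fin; exact: wB.
  by have [_ _ ij] := sw j; exact: (@integrable_fin_num _ _ R leb2 cell mc _ ij).
have iw : leb2.-integrable cell (EFin \o (fun x => sqn (w x))).
  apply/integrableP; split => //; apply: le_lt_trans (ltry B); apply: le_trans le.
  rewrite le_eqVlt; apply/orP; left; apply/eqP; apply: eq_integral => x _ /=.
  by rewrite ger0_norm ?sqn_ge0.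
split; first by split.
rewrite /norm2 /Rintegral -lee_fin fineK//.
exact: (@integrable_fin_num _ _ R leb2 cell mc _ iw).
Qed.

Lemma trig_sum_periodic s c : torus_periodic (trig_sum s c).
Proof.
move=> x k; apply: eq_bigr => l _; rewrite (torus_charD l x (k.1%:~R, k.2%:~R)).
suff -> : torus_char l (k.1%:~R, k.2%:~R) = 1 :> R[i] by rewrite mulr1.
rewrite torus_charE (_ : phase l _ = pi * (2 * (l.1 * k.1 + l.2 * k.2))%:~R); last first.
  by rewrite /phase /= !intrM !intrD !intrM; ring.
have s0 := @sin_pi_int R (2 * (l.1 * k.1 + l.2 * k.2)).
rewrite /expi s0; congr (Complex _ 0).
pose A : R := pi * (l.1 * k.1 + l.2 * k.2)%:~R.
have sA : sin A = 0 by exact: sin_pi_int.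
rewrite (_ : pi * _ = A + A); last by rewrite /A intrM; ring.
have := cos2Dsin2 A.
by rewrite cosD sA mulr0 subr0 expr0n /= addr0 expr2.
Qed.

Lemma norm2_ext u v : u =1 v -> norm2 u = norm2 v.
Proof. by move=> uv; apply: eq_Rintegral => x _; rewrite uv. Qed.

Lemma norm2_trig_sumB c (N N' : nat) : (N <= N')%N ->
  norm2 (fun x => trig_sum (freq_box N') c x - trig_sum (freq_box N) c x) =
  \sum_(k <- freq_box N') sqn (c k) - \sum_(k <- freq_box N) sqn (c k).
Proof.
move=> NN'; have S' := sq_integrable_trig_sum (freq_box N') c.
have sub k : k \in freq_box N -> k \in freq_box N'.
  by rewrite !mem_freq_box => /andP[h1 h2]; apply/andP; split; lia.
have E k : k \in freq_box N -> fourier_coef (trig_sum (freq_box N') c) k = c k.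
  by move=> kN; rewrite fourier_coef_trig_sum ?freq_box_uniq// sub.
have := bessel_identity S' (freq_box_uniq N); rewrite norm2_trig_sum ?freq_box_uniq//.
rewrite (eq_big_seq _ (fun k kN => congr1 sqn (E k kN))) => <-.
by apply: norm2_ext => x; congr (_ - _); apply: eq_big_seq => k kN; rewrite E.
Qed.

Lemma cvg_of_dominated_increments (z e : R^nat) (g : R) :
  (forall n, `|z n.+1 - z n| <= e n) -> (forall n, \sum_(0 <= j < n) e j <= g) -> cvgn z.
Proof.
move=> ze eg; have e0 n : 0 <= e n by apply: le_trans (ze n).
have ce : cvgn (series e).
  apply: nondecreasing_is_cvgn; first by apply: nondecreasing_series => n _ _.
  by exists g => _ [n _ <-]; exact: eg.
have cd : cvgn (series (fun n => z n.+1 - z n)).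
  by apply: normed_cvg; apply: (series_le_cvg _ e0 ze ce) => n; exact: normr_ge0.
have zE : z = fun n => z 0%N + series (fun n => z n.+1 - z n) n.
  by apply/funext => n; rewrite /series /= telescope_sumr// subrKC.
by rewrite zE; apply: is_cvgD => //; exact: is_cvg_cst.
Qed.

(** The sum of the series has a finite integral, by exchanging sum and integral, and is therefore
    finite almost everywhere. *)
Lemma nneseries_integrable_cvg (e : nat -> R * R -> R) (b : R) :
  (forall j x, 0 <= e j x) -> (forall j, measurable_fun setT (e j)) ->
  (forall n, (\sum_(0 <= j < n) \int[leb2]_(x in cell) (e j x)%:E <= b%:E)%E) ->
  {ae leb2, forall x, cell x -> exists g, forall n, \sum_(0 <= j < n) e j x <= g}.
Proof.
move=> e0 me eb; have mc := @measurable_cell R; have FF := ae_leb2_filter.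
have meE j : measurable_fun cell (fun x => (e j x)%:E).
  by apply/measurable_EFinP; exact: measurable_funTS.
have e0E j x : (0 <= (e j x)%:E)%E by rewrite lee_fin.
have iG : leb2.-integrable cell (fun x => (\sum_(0 <= j <oo) (e j x)%:E)%E).
  apply/integrableP; split.
    apply: (@ge0_emeasurable_sum _ _ R cell (fun j x => (e j x)%:E) xpredT) => //.
  apply: le_lt_trans (ltry b).
  have -> : (\int[leb2]_(x in cell) `|\sum_(0 <= j <oo) (e j x)%:E|)%E =
      (\sum_(0 <= j <oo) \int[leb2]_(x in cell) (e j x)%:E)%E.
    rewrite -(@integral_nneseries _ _ R leb2 cell mc (fun j x => (e j x)%:E))//.
    by apply: eq_integral => x _; rewrite gee0_abs// nneseries_ge0.
  apply: lime_le; last exact: nearW.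
  by apply: is_cvg_nneseries => n _ _; exact: integral_ge0.
have := @integrable_ae _ _ R leb2 cell mc _ iG.
apply: filterS => x /[apply] fin.
exists (fine (\sum_(0 <= j <oo) (e j x)%:E)%E) => n.
rewrite -lee_fin fineK// -sumEFin.
by apply: (@nneseries_lim_ge _ _ xpredT 0%N n) => j _ _.
Qed.

End RieszFischer.

(** * Riesz-Fischer and Parseval *)

Section Parseval.
Variable R : realType.
Implicit Types (x : R * R) (k l : int * int) (u v w : R * R -> R[i])
  (c : int * int -> R[i]).

Local Notation leb2 := (@lebesgue_measure R \x @lebesgue_measure R)%E.
Local Notation sqn := (@Defs.sqr_normc R).
Local Notation cell := (@torus_cell R).
Local Notation A c N := (\sum_(k <- freq_box N) sqn (c k)).

(** Geometric tails make the increments of the partial sums summable almost everywhere, so a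
    pointwise limit exists along [phi]. *)
Lemma rapid_subsequence (a : nat -> R) (M : R) : (forall N N', (N <= N')%N -> a N <= a N') ->
  (forall N, a N <= M) ->
  exists phi : nat -> nat, [/\ forall i j, (i <= j)%N -> (phi i <= phi j)%N,
    forall i, (i <= phi i)%N & forall i N, a N - a (phi i) <= 4^-1 ^+ i].
Proof.
move=> am aM; have hs : has_sup (range a).
  by split; [exists (a 0%N), 0%N|exists M => _ [N _ <-]].
have : forall j : nat, exists N, sup (range a) - 4^-1 ^+ j < a N.
  move=> j; have [|_ [N _ <-] hN] := @sup_adherent _ _ (4^-1 ^+ j : R) _ hs.
    by rewrite exprn_gt0.
  by exists N.
move=> /choice[N_ HN]; exists (fun j => \sum_(i < j.+1) (N_ i).+1)%N.
have mono i j : (i <= j)%N -> (\sum_(m < i.+1) (N_ m).+1 <= \sum_(m < j.+1) (N_ m).+1)%N.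
  elim: j => [|j IH]; first by rewrite leqn0 => /eqP ->.
  rewrite leq_eqVlt => /predU1P[->//|ij]; rewrite [leqRHS]big_ord_recr /=.
  exact: leq_trans (IH ij) (leq_addr _ _).
have ge i : (N_ i <= \sum_(m < i.+1) (N_ m).+1)%N.
  by rewrite big_ord_recr /=; apply: leq_trans (leqnSn _) (leq_addl _ _).
split=> //.
- by elim=> [//|i IH]; rewrite big_ord_recr /= addnS ltnS (leq_trans IH)// leq_addr.
- move=> i N; have h1 := am _ _ (ge i); have h2 := HN i.
  have h3 : a N <= sup (range a) by apply: ub_le_sup; [case: hs|exists N].
  lra.
Qed.

Lemma sqn_eq0 (z : R[i]) : sqn z = 0 -> z = 0.
Proof.
case: z => p q; rewrite /Defs.sqr_normc /= => /eqP.
by rewrite paddr_eq0 ?sqr_ge0// !sqrf_eq0 => /andP[/eqP -> /eqP ->].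
Qed.

(** Replaces Cauchy-Schwarz: with [t = 2^-j], a squared norm of size [4^-j] becomes a majorant of
    the absolute value whose integral over the unit cell is at most [2^-j]. *)
Lemma abs_le_weighted (a b t : R) : 0 < t -> a ^+ 2 <= b -> `|a| <= (t + t^-1 * b) / 2.
Proof.
move=> t0 ab; have -> : (t + t^-1 * b) / 2 = (t ^+ 2 + b) / (2 * t).
  by field; rewrite gt_eqF.
rewrite ler_pdivlMr ?mulr_gt0//.
have h : `|a| ^+ 2 = a ^+ 2 by rewrite real_normK// num_real.
have := sqr_ge0 (t - `|a|); nra.
Qed.

(** The last clause is Parseval's inequality for the function just built; uniqueness of coefficients
    will carry it over to any function with the same coefficients. *)
Lemma riesz_fischer c (M : R) : (forall N, A c N <= M) ->
  exists V, [/\ in_L2 V, forall k, fourier_coef V k = c k &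
    forall d, 0 < d -> exists N, norm2 V <= A c N + d].
Proof.
move=> cM; have mc := @measurable_cell R; have FF := ae_leb2_filter.
have [phi [phim phige phi4]] := rapid_subsequence (freq_box_sum_le c) cM.
pose S j := trig_sum (freq_box (phi j)) c.
have sS j : sq_integrable (S j) by exact: sq_integrable_trig_sum.
have dS i j : (i <= j)%N -> norm2 (fun x => S j x - S i x) <= 4^-1 ^+ i.
  by move=> ij; rewrite norm2_trig_sumB ?phim//; exact: phi4.
pose t j : R := 2^-1 ^+ j.
have t0 j : 0 < t j by rewrite exprn_gt0.
have sD j : sq_integrable (fun x => S j.+1 x - S j x) by exact: sq_integrableB.
pose e j x : R := (t j + (t j)^-1 * sqn (S j.+1 x - S j x)) / 2.
have e_ge0 j x : 0 <= e j x by rewrite divr_ge0// addr_ge0 ?mulr_ge0 ?invr_ge0 ?sqn_ge0// ltW.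
have me j : measurable_fun setT (e j).
  have [mr mi _] := sD j; apply: measurable_funM => //; apply: measurable_funD => //.
  by apply: measurable_funM => //; exact: measurable_sqn.
have eE j : (\int[leb2]_(x in cell) (e j x)%:E <= (t j)%:E)%E.
  have [_ _ iD] := sD j.
  have iC : leb2.-integrable cell (EFin \o (fun=> t j / 2)).
    by apply: bmeas_integrable; [exact: bmeas_cst|exact: mc|exact: cell_lty].
  have iZ := @integrableZl _ _ R leb2 cell mc ((t j)^-1 / 2) _ iD.
  have ie : leb2.-integrable cell (EFin \o e j).
    have := @integrableD _ _ R leb2 cell mc _ _ iC iZ.
    by apply: eq_integrable => // x _ /=; rewrite /e; congr (_%:E); field; rewrite gt_eqF.
  rewrite -[leLHS]fineK; last exact: (@integrable_fin_num _ _ R leb2 cell mc _ ie).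
  rewrite lee_fin -/(Rintegral leb2 cell (e j)).
  have -> : \int[leb2]_(x in cell) e j x =
      \int[leb2]_(x in cell) (t j / 2 + (t j)^-1 / 2 * sqn (S j.+1 x - S j x)).
    by apply: eq_Rintegral => x _; rewrite /e; field; rewrite gt_eqF.
  rewrite RintegralD// (@Rintegral_cst _ _ R leb2 cell mc) RintegralZl//.
  rewrite -/(norm2 (fun x => S j.+1 x - S j x)).
  (* The area of the cell is read off as the squared norm of the constant character. *)
  have -> : fine (leb2 cell) = 1.
    have := @Rintegral_cst _ _ R leb2 cell mc 1; rewrite mul1r => <-.
    have := @Rintegral_cell_cdot_char R (0, 0) (0, 0) 1 1; rewrite eqxx mul1r.
    rewrite [X in _ = X -> _](_ : _ = 1); last by rewrite /cdot /= !mulr1 mulr0 addr0.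
    by move=> h; rewrite -[RHS]h; apply: eq_Rintegral => x _; rewrite torus_char0 mulr1 /cdot /= !mulr1 mulr0 addr0.
  have h4 := dS _ _ (leqnSn j); have tt : 4^-1 ^+ j = t j * t j.
    by rewrite /t -exprMn; congr (_ ^+ _); field.
  rewrite tt in h4; have h5 : (t j)^-1 * norm2 (fun x => S j.+1 x - S j x) <= t j.
    by rewrite ler_pdivrMl.
  lra.
have tsum n : \sum_(0 <= j < n) t j <= 2 - 2 * t n.
  elim: n => [|n IH]; first by rewrite big_geq// /t expr0 mulr1 subrr.
  rewrite big_nat_recr//=; have -> : t n.+1 = t n / 2 by rewrite /t exprS mulrC.
  lra.
have esum n : (\sum_(0 <= j < n) \int[leb2]_(x in cell) (e j x)%:E <= 2%:E)%E.
  apply: le_trans (_ : (\sum_(0 <= j < n) (t j)%:E)%E <= _)%E; first exact: lee_sum.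
  by rewrite sumEFin lee_fin; have := tsum n; have := t0 n; lra.
have bd := nneseries_integrable_cvg e_ge0 me esum.
(* An upper limit is defined everywhere, and it stays measurable and periodic also where the partial
   sums diverge. *)
pose Vr x : R := fine (limn_esup (fun n => (complex.Re (S n x))%:E)).
pose Vi x : R := fine (limn_esup (fun n => (complex.Im (S n x))%:E)).
pose V x := Complex (Vr x) (Vi x).
have mVr : measurable_fun setT Vr.
  apply: measurableT_comp => //.
  apply: (measurable_fun_limn_esup (f := fun n x => (complex.Re (S n x))%:E)) => n.
  by apply/measurable_EFinP; case: (sS n).
have mVi : measurable_fun setT Vi.
  apply: measurableT_comp => //.
  apply: (measurable_fun_limn_esup (f := fun n x => (complex.Im (S n x))%:E)) => n.
  by apply/measurable_EFinP; case: (sS n).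
have limE (z : nat -> R) : cvgn z -> z @ \oo --> fine (limn_esup (fun n => (z n)%:E)).
  move=> cz; have cE : (z n)%:E @[n --> \oo] --> (limn z)%:E.
    by apply: cvg_EFin; [exact: nearW|exact: cz].
  by have [_ ->] := cvg_limn_einf_sup cE.
have aeV : {ae leb2, forall x, cell x ->
    complex.Re (S n x) @[n --> \oo] --> complex.Re (V x) /\
    complex.Im (S n x) @[n --> \oo] --> complex.Im (V x)}.
  apply: filterS bd => x h xc; have [g hg] := h xc.
  split; apply: limE; apply: cvg_of_dominated_increments hg => n.
    rewrite -raddfB; apply: abs_le_weighted => //.
    by rewrite /Defs.sqr_normc lerDl sqr_ge0.
  rewrite -raddfB; apply: abs_le_weighted => //.
  by rewrite /Defs.sqr_normc lerDr sqr_ge0.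
have [sV _] : sq_integrable V /\ norm2 V <= M.
  apply: (@fatou_norm2 R S V M sS mVr mVi aeV) => j.
  by rewrite norm2_trig_sum ?freq_box_uniq.
have VS i : norm2 (fun x => V x - S i x) <= 4^-1 ^+ i.
  have [mr mi _] := sq_integrableB sV (sS i).
  have [||//] := @fatou_norm2 _ (fun j x => S (j + i)%N x - S i x) (fun x => V x - S i x)
    (4^-1 ^+ i) (fun j => sq_integrableB (sS _) (sS i)) mr mi.
    apply: filterS aeV => x h xc; have [hr hi] := h xc; split.
      under eq_fun do rewrite raddfB; rewrite raddfB; apply: cvgB; last exact: cvg_cst.
      by rewrite (cvg_shiftn i (fun n => complex.Re (S n x))).
    under eq_fun do rewrite raddfB; rewrite raddfB; apply: cvgB; last exact: cvg_cst.
    by rewrite (cvg_shiftn i (fun n => complex.Im (S n x))).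
  by move=> j; apply: dS; rewrite leq_addl.
have h0 : (fun i => 4^-1 ^+ i) @ \oo --> (0 : R).
  by apply: cvg_expr; rewrite ger0_norm// invf_lt1// ltr1n.
have coefV k : fourier_coef V k = c k.
  apply/eqP; rewrite -subr_eq0; apply/eqP/sqn_eq0/eqP; rewrite eq_le sqn_ge0 andbT.
  have near i : (`|k.1| + `|k.2| <= i)%N -> sqn (fourier_coef V k - c k) <= 4^-1 ^+ i.
    move=> ki; apply: le_trans (VS i); apply: le_trans (bessel_le k (sq_integrableB sV (sS i))).
    rewrite fourier_coefB// fourier_coef_trig_sum ?freq_box_uniq// mem_freq_box.
    have ii := phige i; rewrite (_ : _ && _)//; apply/andP; split; lia.
  rewrite -(cvg_lim _ h0)//; apply: limr_ge; first exact: cvgP h0.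
  by exists (`|k.1| + `|k.2|)%N => // i /= ki; exact: near.
exists V; split=> //.
  apply/in_L2P; split=> // x k; rewrite /V /Vr /Vi.
  by congr (Complex (fine (limn_esup _)) (fine (limn_esup _))); apply/funext => n;
    rewrite /S (trig_sum_periodic _ c x k).
move=> d d0; have [i _ hi] : \forall i \near \oo, 4^-1 ^+ i < d.
  exact: (cvgr_lt _ h0 d d0).
exists (phi i); have := bessel_identity sV (freq_box_uniq (phi i)).
have -> : fourier_coef V = c by apply/funext => k; exact: coefV.
have := VS i; have := hi i (leqnn i); rewrite /S; lra.
Qed.

Lemma parseval u : sq_integrable u -> forall d, 0 < d ->
  exists N, norm2 u <= A (fourier_coef u) N + d.
Proof.
move=> su; have bes N : A (fourier_coef u) N <= norm2 u.
  by rewrite -subr_ge0 -bessel_identity ?freq_box_uniq// norm2_ge0.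
have [V [/in_L2P[_ sV] cV hV]] := riesz_fischer bes.
by have -> : norm2 u = norm2 V by apply: norm2_eq.
Qed.

End Parseval.

(* No measurability is assumed: the integral of a nonnegative function is a
   supremum over simple functions below it. *)
Lemma ge0_le_integral_subset d (T : measurableType d) (R : realType)
    (mu : {measure set T -> \bar R}) (D D' : set T) (f g : T -> \bar R) :
  (forall x, D x -> 0 <= f x)%E -> (forall x, D' x -> 0 <= g x)%E -> D `<=` D' ->
  (forall x, D x -> f x <= g x)%E ->
  (\int[mu]_(x in D) f x <= \int[mu]_(x in D') g x)%E.
Proof.
move=> f0 g0 DD' fg; rewrite !ge0_integralE//.
apply: ereal_sup_le => _ [h /= hf <-]; exists h => // x.
apply: le_trans (hf x) _; rewrite !patchE; case: ifPn => [/set_mem Dx|_].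
  by rewrite mem_set ?fg//; exact: DD'.
by case: ifPn => // /set_mem /g0.
Qed.

Lemma Rintegral_sum d (T : measurableType d) (R : realType)
    (mu : {measure set T -> \bar R}) (D : set T) (I : Type) (s : seq I) (f : I -> T -> R) :
  measurable D -> (forall i, mu.-integrable D (EFin \o f i)) ->
  mu.-integrable D (EFin \o (fun x => \sum_(i <- s) f i x)) /\
  \int[mu]_(x in D) (\sum_(i <- s) f i x) = \sum_(i <- s) \int[mu]_(x in D) f i x.
Proof.
move=> mD fi.
have ii (t : seq I) : mu.-integrable D (EFin \o (fun x => \sum_(i <- t) f i x)).
  have := @integrable_sum _ _ R mu D mD I t xpredT (fun i => EFin \o f i) (fun i _ => fi i).
  by apply: eq_integrable => // x _ /=; rewrite sumEFin.
split=> //; elim: s => [|i s IH].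
  by under eq_Rintegral do rewrite big_nil; rewrite Rintegral_cst// mul0r big_nil.
by under eq_Rintegral do rewrite big_cons; rewrite RintegralD// IH big_cons.
Qed.

(** * Observability *)

Section Observability.
Variable R : realType.
Implicit Types (x : R * R) (k l : int * int) (u v w : R * R -> R[i])
  (c : int * int -> R[i]).

Local Notation leb := (@lebesgue_measure R).
Local Notation leb2 := (@lebesgue_measure R \x @lebesgue_measure R)%E.
Local Notation sqn := (@Defs.sqr_normc R).
Local Notation cell := (@torus_cell R).
Local Notation period := ((2 * pi)^-1 : R).
Local Notation A c N := (\sum_(k <- freq_box N) sqn (c k)).

(** * The flow on coefficients, and averaging over one period *)

Definition flow (t : R) c k : R[i] := expi (t * laplace_eigenvalue R k) * c k.

Lemma sqn_flow t c k : sqn (flow t c k) = sqn (c k).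
Proof. by rewrite sqnM sqn_expi mul1r. Qed.

(** Rotating the coefficients keeps their squared sums bounded, so Riesz-Fischer provides a
    candidate and the default value of [xget] never occurs. *)
Lemma schrodingerP t u : sq_integrable u -> in_L2 (schrodinger t u) /\
  forall k, fourier_coef (schrodinger t u) k = flow t (fourier_coef u) k.
Proof.
move=> su; apply: (@xgetPex _ (fun=> 0) [set v | in_L2 v /\
  forall k, fourier_coef v k = flow t (fourier_coef u) k]).
have bes N : A (flow t (fourier_coef u)) N <= norm2 u.
  under eq_bigr do rewrite sqn_flow.
  by rewrite -subr_ge0 -bessel_identity ?freq_box_uniq// norm2_ge0.
by have [V [LV cV _]] := riesz_fischer bes; exists V.
Qed.

Lemma period_gt0 : 0 < period.
Proof. by rewrite invr_gt0 mulr_gt0// pi_gt0. Qed.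

Lemma laplace_eigenvalueB k l : laplace_eigenvalue R k - laplace_eigenvalue R l =
  - (4 * pi ^+ 2 * (lattice_norm k - lattice_norm l)%:~R) :> R.
Proof.
rewrite /laplace_eigenvalue /lattice_norm intrB !intrD !expr2 !intrM; ring.
Qed.

(** Eigenvalues differ by [4 * pi^2] times an integer, so over a time [1 / (2 * pi)] the relative
    phase makes a whole number of turns. The interval is written [[0, 0 + period[] to match
    [Rintegral_cos]. *)
Lemma time_integral_cdot k l (z w : R[i]) :
  leb.-integrable `[0, 0 + period[ (EFin \o (fun t : R =>
    cdot (z * expi (t * laplace_eigenvalue R k)) (w * expi (t * laplace_eigenvalue R l)))) /\
  \int[leb]_(t in `[0, 0 + period[) cdot (z * expi (t * laplace_eigenvalue R k))
      (w * expi (t * laplace_eigenvalue R l)) =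
  period * ((lattice_norm k == lattice_norm l)%:R * cdot z w).
Proof.
have p0 := @pi_gt0 R; have T0 := period_gt0.
pose W : R := laplace_eigenvalue R k - laplace_eigenvalue R l.
pose p := cdot z w.
pose q : R := complex.Im z * complex.Re w - complex.Re z * complex.Im w.
have E t : cdot (z * expi (t * laplace_eigenvalue R k)) (w * expi (t * laplace_eigenvalue R l)) =
    p * cos (W * t + 0) + q * cos (W * t + pi / 2).
  by rewrite cdot_expi -mulrBr addr0 [t * _]mulrC.
have mI : measurable `[(0 : R), 0 + period[ by [].
have ic (b : R) := integrable_cos_itv W b 0 period.
have iZ (a b : R) : leb.-integrable `[0, 0 + period[ (EFin \o (fun t => a * cos (W * t + b))).
  exact: (@integrableZl _ _ R leb _ mI a _ (ic b)).
have -> : (fun t => cdot (z * expi (t * laplace_eigenvalue R k))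
    (w * expi (t * laplace_eigenvalue R l))) =
    (fun t => p * cos (W * t + 0) + q * cos (W * t + pi / 2)).
  by apply/funext => t; exact: E.
split; first exact: (@integrableD _ _ R leb _ mI _ _ (iZ p 0) (iZ q (pi / 2))).
rewrite RintegralD// !RintegralZl// !Rintegral_cos ?(ltW T0)//.
have WE : W = - (4 * pi ^+ 2 * (lattice_norm k - lattice_norm l)%:~R).
  exact: laplace_eigenvalueB.
rewrite /sinc_int; case: eqVneq => [W0|W0].
  have -> : lattice_norm k == lattice_norm l.
    rewrite -subr_eq0 -(intr_eq0 R); apply/eqP; move: WE; rewrite W0 => /esym/eqP.
    by rewrite oppr_eq0 mulf_eq0 mulf_eq0 expf_eq0 /= (gt_eqF p0) pnatr_eq0 /= => /eqP.
  by rewrite W0 mul0r !add0r cos0 cos_pihalf !mulr0 addr0 mul1r mulr1 mulrC.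
have -> : lattice_norm k == lattice_norm l = false.
  by apply: contra_neqF W0 => /eqP e; rewrite WE e subrr mulr0 oppr0.
have -> : W * period / 2 = - (pi * (lattice_norm k - lattice_norm l)%:~R).
  by rewrite WE; move: p0; generalize (pi : R) => P P0; field; rewrite gt_eqF.
by rewrite sinN sin_pi_int oppr0 !(mulr0, mul0r) addr0.
Qed.

Lemma sum_level_sets (I J : eqType) (s : seq I) (f : I -> J) (F : I -> R) :
  \sum_(k <- s) F k = \sum_(n <- undup (map f s)) \sum_(k <- s | f k == n) F k.
Proof.
rewrite (exchange_big_dep xpredT)//= !big_seq; apply: eq_bigr => k ks.
rewrite -big_filter (eq_filter (a2 := pred1 (f k))); last by move=> n; rewrite /= eq_sym.
by rewrite filter_pred1_uniq ?undup_uniq ?mem_undup ?map_f// big_seq1.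
Qed.

Lemma sum_level_sets2 (I J : eqType) (s : seq I) (f : I -> J) (F : I -> I -> R) :
  \sum_(k <- s) \sum_(l <- s) (f k == f l)%:R * F k l =
  \sum_(n <- undup (map f s)) \sum_(k <- [seq k <- s | f k == n])
    \sum_(l <- [seq l <- s | f l == n]) F k l.
Proof.
rewrite (sum_level_sets _ f); apply: eq_bigr => n _; rewrite big_filter.
apply: eq_bigr => k /eqP kn; rewrite big_filter [RHS]big_mkcond; apply: eq_bigr => l _.
by rewrite kn eq_sym; case: (f l == n); rewrite ?mul1r ?mul0r.
Qed.

Lemma time_integral_box_energy c (s : seq (int * int)) (r : R) : 0 <= r ->
  leb.-integrable `[0, 0 + period[ (EFin \o (fun t => box_energy (0, 0) r s (flow t c))) /\
  \int[leb]_(t in `[0, 0 + period[) box_energy (0, 0) r s (flow t c) =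
  period * \sum_(n <- undup (map lattice_norm s))
    box_energy (0, 0) r [seq k <- s | lattice_norm k == n] c.
Proof.
move=> r0; have mI : measurable `[(0 : R), 0 + period[ by [].
pose b k := c k * torus_char k (center (0, 0) r).
pose D k l := dker (k.1 - l.1, k.2 - l.2) r.
pose G k l t := cdot (b k * expi (t * laplace_eigenvalue R k))
  (b l * expi (t * laplace_eigenvalue R l)).
have E t : box_energy (0, 0) r s (flow t c) = \sum_(k <- s) \sum_(l <- s) D k l * G k l t.
  rewrite box_energyE//; apply: eq_bigr => k _; apply: eq_bigr => l _.
  by rewrite /G /b /flow; congr (_ * cdot _ _); rewrite -[LHS]mulrA [LHS]mulrC.
have iG k l : leb.-integrable `[0, 0 + period[ (EFin \o G k l).
  by have [] := time_integral_cdot k l (b k) (b l).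
have iDG k l : leb.-integrable `[0, 0 + period[ (EFin \o (fun t => D k l * G k l t)).
  exact: (@integrableZl _ _ R leb _ mI (D k l) _ (iG k l)).
have inner k := @Rintegral_sum _ _ R leb _ _ s (fun l t => D k l * G k l t) mI (iDG k).
have [iS ES] := @Rintegral_sum _ _ R leb _ _ s
  (fun k t => \sum_(l <- s) D k l * G k l t) mI (fun k => (inner k).1).
have -> : (fun t => box_energy (0, 0) r s (flow t c)) =
    (fun t => \sum_(k <- s) \sum_(l <- s) D k l * G k l t).
  by apply/funext => t; exact: E.
split=> //; rewrite ES mulr_sumr.
transitivity (\sum_(k <- s) \sum_(l <- s) (lattice_norm k == lattice_norm l)%:R *
    (period * (D k l * cdot (b k) (b l)))).
  apply: eq_bigr => k _; rewrite (inner k).2; apply: eq_bigr => l _.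
  rewrite RintegralZl//; have [_ ->] := time_integral_cdot k l (b k) (b l); ring.
rewrite sum_level_sets2; apply: eq_bigr => n _; rewrite box_energyE// mulr_sumr.
by apply: eq_bigr => k _; rewrite mulr_sumr.
Qed.

(** * From Fourier sums on the box to functions on the ball *)

Lemma box_sub_ball (eps : R) : 0 < eps -> eps <= 1 ->
  box (0, 0) (eps / 2) `<=` cell `&` torus_ball eps.
Proof.
move=> e0 e1 x [] /=; rewrite !in_itv /= !add0r => /andP[x10 x1e] /andP[x20 x2e]; split.
  by split; rewrite /= in_itv /=; apply/andP; split; lra.
exists (0, 0) => /=; rewrite !subr0.
rewrite -[ltRHS](ger0_norm (ltW e0)) -sqrtr_sqr ltr_sqrt; last by rewrite exprn_gt0.
have e20 : 0 <= eps / 2 by rewrite divr_ge0// ltW.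
have h1 : x.1 ^+ 2 <= (eps / 2) ^+ 2 by rewrite lerXn2r ?nnegrE// ltW.
have h2 : x.2 ^+ 2 <= (eps / 2) ^+ 2 by rewrite lerXn2r ?nnegrE// ltW.
have : 0 < eps ^+ 2 by rewrite exprn_gt0.
move: h1 h2; rewrite exprMn; lra.
Qed.

(** On the box [|S|^2 <= 2 |v|^2 + 2 |v - S|^2]. The integral of the last term is extended to the
    whole cell, where Bessel's identity evaluates it. *)
Lemma box_energy_le_ball (eps : R) v (s : seq (int * int)) : 0 < eps -> eps <= 1 ->
  sq_integrable v -> uniq s ->
  ((box_energy (0, 0) (eps / 2) s (fourier_coef v) / 2 -
    (norm2 v - \sum_(k <- s) sqn (fourier_coef v k)))%:E <=
   L2norm_sqr (torus_ball eps) v)%E.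
Proof.
move=> e0 e1 sv us; set B := box (0, 0) (eps / 2); set S := trig_sum s (fourier_coef v).
have mc := @measurable_cell R; have mB : measurable B by exact: measurable_box.
have sB := box_sub_ball e0 e1.
have sS : sq_integrable S by exact: sq_integrable_trig_sum.
have sD := sq_integrableB sv sS.
have BC : B `<=` cell by move=> x /sB[].
have iB w : sq_integrable w -> leb2.-integrable B (EFin \o (fun x => sqn (w x))).
  by case=> _ _; apply: (@integrableS _ _ R leb2 cell B).
have h1 : \int[leb2]_(x in B) sqn (S x) <=
    2 * \int[leb2]_(x in B) sqn (v x) + 2 * \int[leb2]_(x in B) sqn (v x - S x).
  have i2 w (sw : sq_integrable w) := @integrableZl _ _ R leb2 B mB 2 _ (iB w sw).
  rewrite -!RintegralZl//; [|exact: iB|exact: iB].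
  rewrite -RintegralD//; [|exact: (i2 _ sv)|exact: (i2 _ sD)].
  apply: le_Rintegral => //; first exact: iB.
    exact: (@integrableD _ _ R leb2 B mB _ _ (i2 _ sv) (i2 _ sD)).
  by move=> x _; have := sqn_sub_le (v x) (v x - S x); rewrite opprB subrKC.
have h2 : \int[leb2]_(x in B) sqn (v x - S x) <= norm2 (fun x => v x - S x).
  have i1 := iB _ sD; have [_ _ i2] := sD.
  have f1 := @integrable_fin_num _ _ R leb2 B mB _ i1.
  have f2 := @integrable_fin_num _ _ R leb2 cell mc _ i2.
  rewrite /norm2 /Rintegral; apply: fine_le => //.
  by apply: (@ge0_le_integral_subset _ _ R leb2 _ _ _ _ _ _ BC) => x _; rewrite lee_fin ?sqn_ge0.
have h3 : ((\int[leb2]_(x in B) sqn (v x))%:E <= L2norm_sqr (torus_ball eps) v)%E.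
  rewrite /Rintegral fineK; last exact: (@integrable_fin_num _ _ R leb2 B mB _ (iB _ sv)).
  by apply: (@ge0_le_integral_subset _ _ R leb2 _ _ _ _ _ _ sB) => x _; rewrite lee_fin ?sqn_ge0.
apply: le_trans h3; rewrite lee_fin -bessel_identity// -/S.
have -> : box_energy (0, 0) (eps / 2) s (fourier_coef v) = \int[leb2]_(x in B) sqn (S x) by [].
by move: h1 h2; move: (\int[_]_(x in _) _) (\int[_]_(x in _) _) (\int[_]_(x in _) _) (norm2 _) => *; lra.
Qed.

End Observability.

Theorem theorem2 (R : realType) :
  exists C eps0 : R, 0 < C /\ 0 < eps0 /\
    forall eps : R, 0 < eps -> eps < eps0 ->
    forall u0 : R * R -> R[i], in_L2 u0 ->
      (L2norm_sqr setT u0 <=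
       (obs_const C eps)%:E *
       \int[@lebesgue_measure R]_(t in `[0%R, (2 * pi)^-1%R])
          L2norm_sqr (torus_ball eps) (schrodinger t u0))%E.
Proof.
have [C [eps0 [C0 [eps00 H]]]] := circle_observability R.
exists C, (Num.min eps0 1); split=> //; split; first by rewrite lt_min eps00 ltr01.
move=> eps e0; rewrite lt_min => /andP[ee /ltW e1] u0 /in_L2P[pu su].
have {}H := H eps e0 ee; rewrite L2norm_sqr_setT//.
set J := (\int[_]_(t in _) _)%E; set K := obs_const C eps in H *.
have K0 : 0 < K by exact: expR_gt0.
pose T : R := (2 * pi)^-1; have T0 : 0 < T by exact: period_gt0.
have p0 := @pi_gt0 R.
pose c := fourier_coef u0; pose A N := \sum_(k <- freq_box N) Defs.sqr_normc (c k).
have r0 : 0 <= eps / 2 by rewrite divr_ge0// ltW.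
have mI : measurable `[(0 : R), 0 + T[ by [].
have evol t := schrodingerP t su.
have sV t : sq_integrable (schrodinger t u0) by have [/in_L2P[]] := evol t.
(* Parseval for the evolved state and Bessel for the datum, whose coefficients have the same
   moduli. *)
have nV t : norm2 (schrodinger t u0) <= norm2 u0.
  apply/ler_addgt0Pr => d d0; have [N hN] := parseval (sV t) d0.
  apply: le_trans hN _; rewrite lerD2r.
  have -> : \sum_(k <- freq_box N) Defs.sqr_normc (fourier_coef (schrodinger t u0) k) = A N.
    by apply: eq_bigr => k _; rewrite (evol t).2 sqn_flow.
  by rewrite -subr_ge0 -bessel_identity ?freq_box_uniq// norm2_ge0.
have lower N : ((A N / K - T * (norm2 u0 - A N))%:E <= J)%E.
  set s := freq_box N; have us : uniq s by exact: freq_box_uniq.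
  have [iG EG] := time_integral_box_energy c s r0.
  set G := (fun t => box_energy _ _ _ (flow t c)) in iG EG.
  pose g t := G t / 2 - (norm2 u0 - A N).
  have gF t : ((g t)%:E <= L2norm_sqr (torus_ball eps) (schrodinger t u0))%E.
    apply: le_trans (box_energy_le_ball e0 e1 (sV t) us); rewrite lee_fin.
    have -> : fourier_coef (schrodinger t u0) = flow t c by apply/funext => k; exact: (evol t).2.
    under [X in _ <= _ - (_ - X)]eq_bigr do rewrite sqn_flow.
    by have := nV t; rewrite /g /G /A; lra.
  have iH : lebesgue_measure.-integrable `[0, 0 + T[ (EFin \o (fun t => 2^-1 * G t)).
    exact: (@integrableZl _ _ R (@lebesgue_measure R) _ mI 2^-1 _ iG).
  have iC : lebesgue_measure.-integrable `[0, 0 + T[ (EFin \o (fun=> norm2 u0 - A N)).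
    apply: measurable_bounded_integrable => //; first exact: itv_lty.
    exists `|norm2 u0 - A N|; split; first exact: num_real.
    by move=> M /ltW hM t _.
  have ig : lebesgue_measure.-integrable `[0, 0 + T[ (EFin \o g).
    have := @integrableB _ _ R (@lebesgue_measure R) _ mI _ _ iH iC.
    by apply: eq_integrable => // t _ /=; rewrite /g mulrC.
  have intg : A N / K - T * (norm2 u0 - A N) <= \int[lebesgue_measure]_(t in `[0, 0 + T[) g t.
    have -> : \int[lebesgue_measure]_(t in `[0, 0 + T[) g t =
        \int[lebesgue_measure]_(t in `[0, 0 + T[) (2^-1 * G t - (norm2 u0 - A N)).
      by apply: eq_Rintegral => t _; rewrite /g mulrC.
    rewrite RintegralB// RintegralZl// EG (@Rintegral_cst _ _ R (@lebesgue_measure R) _ mI).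
    have -> : fine (@lebesgue_measure R `[0, 0 + T[) = T.
      by rewrite lebesgue_measure_itv /= add0r lte_fin T0 oppr0 addr0.
    rewrite [_ * T]mulrC lerD2r.
    rewrite ler_pdivrMr//.
    have -> : A N = \sum_(n <- undup (map lattice_norm s))
        \sum_(k <- [seq k <- s | lattice_norm k == n]) Defs.sqr_normc (c k).
      rewrite /A (sum_level_sets _ lattice_norm); apply: eq_bigr => n _.
      by rewrite big_filter.
    rewrite mulrA [leRHS]mulrAC mulr_sumr; apply: ler_sum => n _.
    have := H n [seq k <- s | lattice_norm k == n] c (filter_uniq _ us).
    have sn : {in [seq k <- s | lattice_norm k == n], forall k, lattice_norm k = n}.
      by move=> k; rewrite mem_filter => /andP[/eqP].
    move=> /(_ sn) h; rewrite -(ler_pM2l (_ : 0 < 4 * pi)) ?mulr_gt0//.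
    apply: le_trans h _; rewrite le_eqVlt; apply/orP; left; apply/eqP.
    by rewrite /T; move: p0; generalize (pi : R) => P P0; field; rewrite gt_eqF.
  (* The minorant [g] may be negative; its positive part still lies below the nonnegative observed
     energy, and for nonnegative functions the half-open interval can be enlarged to the closed
     one. *)
  apply: (@le_trans _ _ (\int[lebesgue_measure]_(t in `[0%R, (0 + T)%R[) (Num.max (g t) 0)%:E)%E).
    apply: (@le_trans _ _ (\int[lebesgue_measure]_(t in `[0%R, (0 + T)%R[) (g t)%:E)%E).
      rewrite -[leRHS]fineK; first by rewrite lee_fin.
      exact: (@integrable_fin_num _ _ R (@lebesgue_measure R) _ mI _ ig).
    apply: le_integral => //.
      have := @integrable_funepos _ _ R (@lebesgue_measure R) _ mI _ ig.
      by apply: eq_integrable => // t _; rewrite funeposE /= -EFin_max.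
    by move=> t _; rewrite lee_fin le_max lexx.
  have FE0 t : (0 <= L2norm_sqr (torus_ball eps) (schrodinger t u0))%E.
    by apply: integral_ge0 => x _; rewrite lee_fin sqn_ge0.
  apply: ge0_le_integral_subset => // t.
  - by move=> _; rewrite lee_fin le_max lexx orbT.
  - by rewrite /= !in_itv /= add0r => /andP[-> /ltW ->].
  - by move=> _; rewrite EFin_max ge_max gF FE0.
have J0 : (0 <= J)%E.
  by apply: integral_ge0 => t _; apply: integral_ge0 => x _; rewrite lee_fin sqn_ge0.
(* By Parseval some [N] brings [A N] within [d] of the full norm, which controls the truncation
   error as well. *)
have key d : 0 < d -> (((norm2 u0 - d) / K - T * d)%:E <= J)%E.
  move=> d0; have [N hN] := parseval su d0.
  apply: le_trans (lower N); rewrite lee_fin lerB//.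
    by rewrite ler_pM2r ?invr_gt0// lerBlDr.
  by rewrite ler_pM2l// lerBlDl.
have [->|] := eqVneq J +oo%E; first by rewrite gt0_muley ?lte_fin// leey.
move: J0 key {lower}; case: J => [j|//|//] j0 key _.
rewrite -EFinM lee_fin; apply/ler_addgt0Pr => d d0.
have KT : 0 < 1 + K * T by rewrite addr_gt0// mulr_gt0.
(* After multiplication by [K] the two errors add up to exactly [d]. *)
have := key (d / (1 + K * T)); rewrite divr_gt0// => /(_ isT).
rewrite lee_fin; set d' := d / _ => h.
have dE : d = d' + K * (T * d').
  by rewrite /d'; field; rewrite gt_eqF.
have : K * ((norm2 u0 - d') / K - T * d') <= K * j by rewrite ler_pM2l.
rewrite mulrBr (mulrC K (_ / _)) divfK ?gt_eqF//; lra.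
Qed.
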